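(* Let $G$ be an online $k$-list-critical graph that is not a complete graph, and let $d(G)=\frac{2|E(G)|}{|V(G)|}$ denote its average degree. If $k \ge 7$, then \[d(G) \ge k-1 + \frac{(k-3)^2 (2 k-3)}{k^4-2 k^3-11 k^2+28 k-14}.\] If $k = 6$, then \[d(G) \ge 5 + \frac{93}{766}.\]
   Context: All graphs are finite and simple. Online choosability (also called paintability) is defined recursively: for a graph $G$ and $f\colon V(G)\to\mathbb{Z}$, $G$ is online $f$-choosable if either $V(G)=\emptyset$, or $f(v)\ge 1$ for all $v\in V(G)$ and for every nonempty $S\subseteq V(G)$ there is an independent set $I\subseteq S$ of $G$ such that $G-I$ is online $f'$-choosable, where $f'(v)=f(v)-1$ for $v\in S\setminus I$ and $f'(v)=f(v)$ for $v\in V(G)\setminus S$. $G$ is online $m$-choosable if it is online $f$-choosable for the constant function $f= m$. A graph $G$ is online $k$-list-critical if $G$ is not online $(k-1)$-choosable, but every proper subgraph of $G$ is online $(k-1)$-choosable. *)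

(* Defs.v *)
From mathcomp Require Import all_boot all_order all_algebra.

Set Implicit Arguments.
Unset Strict Implicit.
Unset Printing Implicit Defensive.

Import Order.TTheory GRing.Theory Num.Theory.
Local Open Scope ring_scope.

(* A finite simple graph on [T] is a symmetric irreflexive [e : rel T].  The
   pair [(V, e)] with [V : {set T}] stands for the graph with vertex set [V]
   and the edges of [e] having both ends in [V]; thus G - I is
   [(V :\: I, e)]. *)

Definition independent (T : finType) (e : rel T) (I : {set T}) : Prop :=
  {in I &, forall x y, ~~ e x y}.

(* The least fixed point agrees with the recursive definition: every round
   either deletes a vertex or lowers some [f v], and [f v >= 1] is required on
   [V].  The values of [f] outside [V] play no role. *)
Inductive online_choosable (T : finType) (e : rel T) :
    {set T} -> (T -> int) -> Prop :=
| online_choosable_empty (f : T -> int) : online_choosable e set0 f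
| online_choosable_step (V : {set T}) (f : T -> int) :
    (forall v, v \in V -> 1 <= f v) ->
    (forall S : {set T}, S \subset V -> S != set0 ->
       exists I : {set T},
         [/\ I \subset S, independent e I &
             online_choosable e (V :\: I)
               (fun v => if v \in S :\: I then f v - 1 else f v)]) ->
    online_choosable e V f.

Definition online_nchoosable (T : finType) (e : rel T) (V : {set T}) (m : int) :
  Prop := online_choosable e V (fun=> m).

(* [(W, e')] is a subgraph (not necessarily induced or spanning) of [(T, e)]
   other than [(T, e)] itself. *)
Definition proper_subgraph (T : finType) (W : {set T}) (e' e : rel T) : Prop :=
  [/\ symmetric e',
      forall x y, e' x y -> [&& e x y, x \in W & y \in W] &
      W != [set: T] \/ exists x y, e x y && ~~ e' x y].

Definition online_list_critical (T : finType) (e : rel T) (k : nat) : Prop :=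
  ~ online_nchoosable e [set: T] (k%:Z - 1) /\
  forall (W : {set T}) (e' : rel T),
    proper_subgraph W e' e -> online_nchoosable e' W (k%:Z - 1).

Definition complete_graph (T : finType) (e : rel T) : Prop :=
  forall x y, x != y -> e x y.

Definition edge_set (T : finType) (e : rel T) : {set {set T}} :=
  [set A : {set T} | [exists x, exists y, e x y && (A == [set x; y])]].

Definition average_degree (T : finType) (e : rel T) : rat :=
  2 * #|edge_set e|%:R / #|T|%:R.

(* Main.v *)
Require Import Defs.
From mathcomp Require Import all_boot all_order all_algebra.
From mathcomp Require Import zify ring lra.

(* Let [L] be the set of vertices of degree [k - 1] and [H] its complement.  If
   all induced subdigraphs of a digraph on [G[X]] have kernels, then [G[X]] is
   online choosable from lists longer than the outdegrees; so in a critical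
   graph no nonempty [X] carries such a digraph whose outdegrees are smaller
   than [k - 1 - d_G + d_X].  This is used for two kinds of digraphs.

   Orienting only the edges at an independent set [A] bounds the number of edges
   at [A].  Inside [L] the bound says that the edges leaving an independent set
   form a forest, whence the blocks of [G[L]] are cliques or cycles.

   A second digraph, built on copies of [K_(k-1)] inside [L] and on vertices of
   degree [k], has kernels found in two phases.  It shows that, up to a bounded
   number per such vertex and per connected union ("unit") of copies of
   [K_(k-1)], no edges join vertices of degree [k] to copies of [K_(k-1)].

   Removing end blocks one at a time, a potential bounds the number of edges of
   [G[L]] plus twice the size of an independent set [I] of vertices without
   neighbours in [H]; the error term counts the vertices of the [K_(k-1)] with a
   neighbour in [H], which the second digraph controls.  The bound for the edges
   at the union of [I] and a large independent subset of [H] then gives the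
   average degree.  The argument is uniform in [k >= 6], and for [k = 6] its
   value 5 + 81/622 exceeds 5 + 93/766. *)

Set Implicit Arguments.
Unset Strict Implicit.
Unset Printing Implicit Defensive.

Import Order.TTheory GRing.Theory Num.Theory.
Local Open Scope ring_scope.

(** * Online choosability and kernels *)

Section OnlineChoosability.

Variables (T : finType) (e : rel T).

(** The obstacle is [K_(k-1)], whose degree [K - 2] exceeds the [K - 3 + p] that the potential
    grants per vertex. Each vertex of such a clique inside [L] has a single neighbour outside it. If
    that neighbour lies in [H], the vertex is credited with [h], and these credits must be paid for
    at [H]. A vertex of degree [k] is charged for three of them on average: one because it may have
    one neighbour more in the cliques than it meets units, and two because its outdegree in the
    second digraph has to stay two below its degree. The remaining charge is carried by the units,
    and the potential contains a term [- h * #|D|] that cancels it. Units with no neighbour in [L]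
    outside the cliques are charged twice; the second charge is covered because a component of
    [G[L]] made up of such cliques alone still has potential [h]. At a vertex of degree above [k]
    all edges may be conceded, since its surplus degree pays for them. *)

Definition deg (X : {set T}) (v : T) : nat := #|[set u in X | e v u]|.

Definition clique (X : {set T}) : Prop := {in X &, forall x y, x != y -> e x y}.

(** The recursive occurrence sits under [exists] and a conjunction, so the induction passes through
    the painter's answer by an explicit fixpoint. *)
Lemma online_choosable_rect (P : {set T} -> (T -> int) -> Prop) :
  (forall f, P set0 f) ->
  (forall (V : {set T}) f, (forall v, v \in V -> 1 <= f v) ->
     (forall S : {set T}, S \subset V -> S != set0 ->
        exists I : {set T},
          [/\ I \subset S, independent e I &
              P (V :\: I) (fun v => if v \in S :\: I then f v - 1 else f v)]) ->
     P V f) ->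
  forall V f, online_choosable e V f -> P V f.
Proof.
move=> P0 PS; fix IH 3 => V f [g|{}V {}f f1 step]; first exact: P0.
apply: PS => // S SV S0; case: (step S SV S0) => I [IS iI oI].
by exists I; split=> //; apply: IH.
Qed.

Lemma online_choosable_le (V : {set T}) (f g : T -> int) :
  online_choosable e V f -> (forall v, v \in V -> f v <= g v) ->
  online_choosable e V g.
Proof.
move=> H; move: g; elim/online_choosable_rect: H => {V f} [f g _|V f f1 step g fg].
  exact: online_choosable_empty.
apply: online_choosable_step => [v vV|S SV S0].
  exact: le_trans (f1 v vV) (fg v vV).
case: (step S SV S0) => I [IS iI oI]; exists I; split=> //; apply: oI => v.
by case/setDP=> vV _; case: ifP => _; rewrite ?lerD2r fg.
Qed.

Lemma online_choosable_pos (V : {set T}) (f : T -> int) :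
  online_choosable e V f -> forall v, v \in V -> 1 <= f v.
Proof. by case=> // g v; rewrite inE. Qed.

Lemma independent0 : independent e set0.
Proof. by move=> x y; rewrite inE. Qed.

Lemma online_choosable_round (V : {set T}) (f : T -> int) (S : {set T}) :
  online_choosable e V f -> S \subset V ->
  exists I : {set T},
    [/\ I \subset S, independent e I &
        online_choosable e (V :\: I)
          (fun v => if v \in S :\: I then f v - 1 else f v)].
Proof.
move=> H SV; have [->|S0] := eqVneq S set0.
  exists set0; split=> //; first exact: independent0.
  by rewrite setD0; apply: online_choosable_le H _ => v _; rewrite !inE.
case: H SV => [g|{}V {}f _ step] SV; last exact: step.
by case/eqP: S0; apply/eqP; rewrite -subset0.
Qed.

Lemma online_choosable_eqrel (e' : rel T) (V : {set T}) (f : T -> int) :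
  {in V &, e =2 e'} -> online_choosable e V f -> online_choosable e' V f.
Proof.
move=> ee' H; elim/online_choosable_rect: H ee' => {V f} [f _|V f f1 step ee'].
  exact: online_choosable_empty.
apply: online_choosable_step => // S SV S0.
case: (step S SV S0) => I [IS iI oI]; exists I; split=> //.
  move=> x y xI yI; rewrite -ee' ?(subsetP SV) ?(subsetP IS) //; exact: iI.
by apply: oI => x y /setDP[xV _] /setDP[yV _]; apply: ee'.
Qed.

Lemma deg_le (X Y : {set T}) v : X \subset Y -> (deg X v <= deg Y v)%N.
Proof.
move=> XY; apply: subset_leq_card; apply/subsetP => u.
by rewrite !inE => /andP[uX ->]; rewrite (subsetP XY).
Qed.

Lemma deg_lt (X Y : {set T}) v u :
  X \subset Y -> u \in Y -> u \notin X -> e v u -> (deg X v < deg Y v)%N.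
Proof.
move=> XY uY uX evu; apply: proper_card; apply/properP; split.
  by apply/subsetP => w; rewrite !inE => /andP[wX ->]; rewrite (subsetP XY).
by exists u; rewrite !inE ?uY ?evu // (negPf uX).
Qed.

Lemma deg_setU (X Y : {set T}) v :
  [disjoint X & Y] -> deg (X :|: Y) v = (deg X v + deg Y v)%N.
Proof.
move=> XY; rewrite /deg -cardsUI [X in (_ + X)%N](_ : _ = 0%N) ?addn0.
  by congr #|pred_of_set _|; apply/setP => u; rewrite !inE andb_orl.
apply/eqP; rewrite cards_eq0 -subset0; apply/subsetP => u; rewrite !inE.
case/andP=> /andP[uX _] /andP[uY _]; by rewrite (disjointFr XY uX) in uY.
Qed.

Lemma absz_pred (z : int) : 1 <= z -> (`|(z - 1)%R| < `|z|)%N.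
Proof. lia. Qed.

Hypothesis e_sym : symmetric e.

(* The painter answers on [Z] first; a vertex of [X] that is refused because of
   a neighbour coloured in [Z] loses that neighbour. *)
Lemma online_choosable_setU (X Z : {set T}) (f fX fZ : T -> int) :
  [disjoint X & Z] -> online_choosable e X fX -> online_choosable e Z fZ ->
  (forall v, v \in Z -> fZ v <= f v) ->
  (forall v, v \in X -> fX v + (deg Z v)%:Z <= f v) ->
  online_choosable e (X :|: Z) f.
Proof.
(* This measure falls when a vertex is coloured as well as when its list shrinks. *)
pose m (V : {set T}) (g : T -> int) := (\sum_(v in V) `|g v|.+1)%N.
have [n] := ubnP (m (X :|: Z) f).
elim: n => // n IH in X Z f fX fZ *; rewrite ltnS => mn XZ oX oZ hZ hX.
have f1 v : v \in X :|: Z -> 1 <= f v.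
  case/setUP=> vV.
    apply: le_trans (hX v vV); apply: le_trans (online_choosable_pos oX vV) _.
    by rewrite lerDl.
  exact: le_trans (online_choosable_pos oZ vV) (hZ v vV).
apply: online_choosable_step => // S SV S0.
have [IZ [IZS iIZ oZ']] := online_choosable_round oZ (subsetIr S Z).
pose SX := [set v in S :&: X | ~~ [exists u, (u \in IZ) && e v u]].
have SXX : SX \subset X by apply/subsetP => v; rewrite !inE => /andP[/andP[_ ->]].
have SXS : SX \subset S by apply/subsetP => v; rewrite !inE => /andP[/andP[-> _]].
have [IX [IXS iIX oX']] := online_choosable_round oX SXX.
have IZ_Z u : u \in IZ -> u \in Z.
  by move=> uI; have := subsetP IZS u uI; rewrite inE => /andP[].
have IZ_S u : u \in IZ -> u \in S.
  by move=> uI; have := subsetP IZS u uI; rewrite inE => /andP[].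
have IX_X u : u \in IX -> u \in X by move=> uI; rewrite (subsetP SXX) ?(subsetP IXS).
have XnZ u : u \in X -> u \in Z = false by move=> uX; exact: (disjointFr XZ uX).
have ZnX u : u \in Z -> u \in X = false by move=> uX; exact: (disjointFl XZ uX).
have nIXIZ x y : x \in IX -> y \in IZ -> ~~ e x y.
  move=> xI yI; apply/negP => exy; have := subsetP IXS x xI.
  by rewrite inE => /andP[_ /negP[]]; apply/existsP; exists y; rewrite yI.
exists (IX :|: IZ); split.
- rewrite subUset (subset_trans IXS SXS) /=; exact: subset_trans IZS (subsetIl _ _).
- move=> x y /setUP[xI|xI] /setUP[yI|yI]; first exact: iIX.
  + exact: nIXIZ.
  + by rewrite e_sym; apply: nIXIZ.
  + exact: iIZ.
have EV : (X :|: Z) :\: (IX :|: IZ) = (X :\: IX) :|: (Z :\: IZ).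
  apply/setP => v; rewrite !inE.
  case: (boolP (v \in X)) => [vX|vX] /=.
    rewrite (XnZ v vX) /= andbF orbF andbT negb_or.
    have -> : v \notin IZ by apply/negP => /IZ_Z; rewrite XnZ.
    by rewrite andbT.
  by rewrite (contraNF (IX_X v) vX).
rewrite EV; apply: IH oX' oZ' _ _.
- rewrite -EV; apply: leq_trans mn.
  have [v0 v0S] := set0Pn _ S0.
  have v0V := subsetP SV v0 v0S.
  set f' := fun v => if v \in S :\: (IX :|: IZ) then f v - 1 else f v.
  have hle v : v \in X :|: Z -> (`|f' v|.+1 <= `|f v|.+1)%N.
    by move=> vV; rewrite /f'; case: ifP => // _; apply: leqW; apply: absz_pred (f1 v vV).
  rewrite /m [X in (_ < X)%N](bigID (mem (IX :|: IZ))) /=.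
  have -> : (\sum_(v in (X :|: Z) :\: (IX :|: IZ)) `|f' v|.+1 =
     \sum_(v in X :|: Z | v \notin IX :|: IZ) `|f' v|.+1)%N.
    by apply: eq_bigl => v; rewrite in_setD andbC.
  have [v0I|v0I] := boolP (v0 \in IX :|: IZ).
    rewrite [X in (_ < X + _)%N](bigD1 v0) /= ?v0V ?v0I // addSn addSn ltnS -addnA.
    apply: leq_trans (leq_addl _ _); apply: leq_trans (leq_addl _ _).
    by apply: leq_sum => v /andP[vV _]; exact: hle.
  apply: leq_trans (leq_addl _ _).
  rewrite (bigD1 v0) ?v0V //= [X in (_ < X)%N](bigD1 v0) ?v0V //=.
  rewrite -addSn leq_add //; last by apply: leq_sum => v /andP[/andP[vV _] _]; exact: hle.
  by rewrite /f' in_setD v0I v0S ltnS absz_pred ?f1.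
- rewrite disjoint_subset; apply/subsetP => v /setDP[vX _].
  by rewrite !inE XnZ // andbF.
- move=> v /setDP[vZ vI]; have vX : v \in IX = false.
    by apply/negP => /IX_X; rewrite ZnX.
  by rewrite !inE vX vZ (negPf vI) andbT /=; case: ifP => _; rewrite ?lerD2r hZ.
move=> v /setDP[vX vI].
have vIZ : v \in IZ = false by apply/negP => /IZ_Z; rewrite XnZ.
rewrite [v \in SX :\: _]in_setD [v \in S :\: _]in_setD in_setU vIZ (negPf vI) /=.
have dle := @deg_le _ _ v (subsetDl Z IZ).
have hv := hX v vX.
have [vS|vS] := boolP (v \in S); last first.
  have -> : v \in SX = false by rewrite !inE (negPf vS).
  by move: dle hv; clear; lia.
rewrite !inE vS vX /=.
case: existsP => [[u /andP[uI evu]]|_] /=; last by move: dle hv; clear; lia.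
have := @deg_lt (Z :\: IZ) Z v u (subsetDl _ _) (IZ_Z u uI) _ evu.
by rewrite inE uI => /(_ isT); move: hv; clear; lia.
Qed.

Definition has_kernel (D : rel T) (S : {set T}) : Prop :=
  exists I : {set T},
    [/\ I \subset S, independent e I &
        forall v, v \in S -> v \notin I -> exists2 u, u \in I & D v u].

(** The painter answers with a kernel of [S]. A refused vertex loses a colour but also an
    out-neighbour, which lay in the kernel, so its outdegree in the remaining graph stays below
    [f]. *)
Lemma online_choosable_kernel (D : rel T) (V : {set T}) (f : T -> int) :
  (forall v, v \in V -> #|[set u in V | D v u]|%:Z < f v) ->
  (forall S : {set T}, S \subset V -> has_kernel D S) ->
  online_choosable e V f.
Proof.
have [n] := ubnP #|V|; elim: n => // n IH in V f *; rewrite ltnS => Vn hf hk.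
apply: online_choosable_step => [v vV|S SV S0].
  by have := hf v vV; clear; lia.
have [I [IS iI kI]] := hk S SV; exists I; split=> //.
have IV := subset_trans IS SV.
apply: IH.
- apply: leq_trans Vn; apply: proper_card; apply/properP; split.
    exact: subsetDl.
  have [v vS] := set0Pn _ S0.
  suff [u uI] : exists u, u \in I.
    by exists u; rewrite ?(subsetP IV) // inE uI.
  have [vI|vI] := boolP (v \in I); first by exists v.
  by have [u uI _] := kI v vS vI; exists u.
- move=> v /setDP[vV vI]; have := hf v vV.
  have sub : [set u in V :\: I | D v u] \subset [set u in V | D v u].
    by apply/subsetP => u; rewrite !inE -andbA => /and3P[_ -> ->].
  have le := subset_leq_card sub; rewrite in_setD vI /=.
  case: ifP => [vS|_]; last by move: le; clear; lia.
  have [u uI Dvu] := kI v vS vI.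
  have : (#|[set u in V :\: I | D v u]| < #|[set u in V | D v u]|)%N.
    apply: proper_card; apply/properP; split=> //; exists u.
      by rewrite !inE Dvu (subsetP IV).
    by rewrite !inE uI.
  by clear; lia.
- by move=> S' S'V; apply: hk; apply: subset_trans S'V (subsetDl _ _).
Qed.

(** All remaining vertices are presented in each round; at most one of them gets coloured, and the
    other lists shrink by one. *)
Lemma clique_not_online_choosable (V : {set T}) (f : T -> int) :
  clique V -> V != set0 -> (forall v, v \in V -> f v < #|V|%:Z) ->
  ~ online_choosable e V f.
Proof.
have [n] := ubnP #|V|; elim: n => // n IH in V f *; rewrite ltnS => Vn cV V0 hf oV.
have [v vV] := set0Pn _ V0.
have f1 := online_choosable_pos oV.
have [I [IV iI oI]] := online_choosable_round oV (subxx V).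
have I1 : (#|I| <= 1)%N.
  apply/card_le1_eqP => x y xI yI; apply/eqP/negPn/negP => xy.
  by case/negP: (iI y x yI xI); exact: (cV y x (subsetP IV y yI) (subsetP IV x xI) xy).
have cD := cardsD V I; rewrite (setIidPr IV) in cD.
have V2 : (1 < #|V|)%N by have := hf v vV; have := f1 v vV; clear; lia.
(* If the painter colours nothing, an arbitrary vertex is discarded, so that exactly one vertex
   leaves per round. *)
pose w := if [pick x in I] is Some x then x else v.
pose J := [set w].
have wV : w \in V by rewrite /w; case: pickP => // x xI; exact: (subsetP IV).
have IJ : I \subset J.
  apply/subsetP => x xI; rewrite inE /w; case: pickP => [y yI|/(_ x)]; last by rewrite xI.
  by apply/eqP; move/card_le1_eqP: I1; apply.
have wVI : V :\: J \subset V :\: I by apply: setDS.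
have cJ : #|V :\: J| = #|V|.-1.
  by rewrite cardsD (setIidPr _) ?sub1set // cards1 subn1.
have oJ : online_choosable e (V :\: J) (fun u => if u \in V :\: I then f u - 1 else f u).
  have HH (A B : {set T}) g : B \subset A -> online_choosable e A g -> online_choosable e B g.
    move=> BA oA; move: B BA.
    elim/online_choosable_rect: oA => {A g} [g B|A g g1 st B BA].
      by rewrite subset0 => /eqP ->; apply: online_choosable_empty.
    apply: online_choosable_step => [x xB|S SB S0].
      by apply: g1; apply: (subsetP BA).
    have [K [KS iK oK]] := st S (subset_trans SB BA) S0.
    by exists K; split=> //; apply: oK; apply: setSD.
  exact: HH wVI oI.
apply: IH oJ => //.
- by rewrite cJ; move: Vn V2; clear; lia.
- by move=> x y /setDP[xV _] /setDP[yV _]; apply: cV.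
- by rewrite -cards_eq0 cJ; move: V2; clear; lia.
move=> x xVJ; rewrite (subsetP wVI x xVJ) cJ.
by case/setDP: xVJ => xV _; have := hf x xV; move: V2; clear; lia.
Qed.

End OnlineChoosability.

(** * Orientations *)

Section Orientation.

Local Open Scope nat_scope.
Variable T : finType.
Implicit Types (E : {set T * T}) (n : T -> nat) (V A : {set T}).

(* Rado's proof of Hall's theorem: the edges of [F] are already oriented by [h],
   and if both orientations of a further edge violated Hall's condition,
   submodularity would be contradicted. *)
Lemma hall_orientation_rec E V n (F : {set T * T}) (h : T * T -> T) :
  let touch (p : T * T) A :=
    if p \in F then h p \in A else (p.1 \in A) || (p.2 \in A) in
  (forall p, p \in F -> h p = p.1 \/ h p = p.2) ->
  (forall A, A \subset V -> \sum_(v in A) n v <= \sum_(p in E) touch p A) ->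
  exists hd : T * T -> T, (forall p, hd p = p.1 \/ hd p = p.2) /\
    forall v, v \in V -> n v <= #|[set p in E | hd p == v]|.
Proof.
have [m] := ubnP #|E :\: F|; elim: m F h => // m IH F h; rewrite ltnS => Em touch hF hall.
have [EF|/subsetPn[p0 p0E p0F]] := boolP (E \subset F).
  exists (fun p => if p \in F then h p else p.1); split.
    by move=> p; case: ifP => [/hF//|_]; left.
  move=> v vV; have := hall [set v]; rewrite sub1set vV big_set1 => /(_ isT) /leq_trans; apply.
  rewrite -sum1_card [X in _ <= X](eq_bigl (fun p => (p \in E) && ((if p \in F then h p else p.1) == v))); last first.
    by move=> p; rewrite inE.
  rewrite big_mkcondr /=; apply: leq_sum => p pE.
  by rewrite /touch (subsetP EF p pE) inE; case: eqP.
pose F' := p0 |: F.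
pose h' u p := if p == p0 then u else h p.
have EF' : #|E :\: F'| < m.
  apply: leq_trans Em; apply: proper_card; apply/properP; split.
    by apply/subsetP => p; rewrite !inE negb_or -andbA => /and3P[_ -> ->].
  by exists p0; rewrite !inE ?p0E ?(negPf p0F) ?eqxx.
have hF' u : u = p0.1 \/ u = p0.2 ->
    forall p, p \in F' -> h' u p = p.1 \/ h' u p = p.2.
  move=> hu p; rewrite /h' /F' !inE; case: eqP => [->//|_] /=; exact: hF.
pose touch' u (p : T * T) A := if p \in F' then h' u p \in A else (p.1 \in A) || (p.2 \in A).
have touchE u p A : p != p0 -> touch' u p A = touch p A.
  by move=> pp0; rewrite /touch' /touch /h' !inE (negPf pp0).
have touch0 u A : touch' u p0 A = (u \in A) by rewrite /touch' /h' !inE eqxx.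
have touch0' A : touch p0 A = (p0.1 \in A) || (p0.2 \in A).
  by rewrite /touch (negPf p0F).
pose ok u := [forall A : {set T}, (A \subset V) ==> (\sum_(v in A) n v <= \sum_(p in E) touch' u p A)].
have good u : u = p0.1 \/ u = p0.2 -> ok u -> exists hd : T * T -> T,
    (forall p, hd p = p.1 \/ hd p = p.2) /\
    forall v, v \in V -> n v <= #|[set p in E | hd p == v]|.
  move=> hu /forallP ku; apply: (IH F' (h' u)) => //; first exact: hF'.
  by move=> A AV; have := ku A; rewrite AV.
have [/good|k1] := boolP (ok p0.1); first by apply; left.
have [/good|k2] := boolP (ok p0.2); first by apply; right.
case/forallPn: k1 => A1; rewrite negb_imply -ltnNge => /andP[A1V lt1].
case/forallPn: k2 => A2; rewrite negb_imply -ltnNge => /andP[A2V lt2].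
have sumE A : \sum_(p in E) touch p A = touch p0 A + \sum_(p in E | p != p0) touch p A.
  by rewrite (bigD1 p0).
have sumE' u A : \sum_(p in E) touch' u p A = (u \in A) + \sum_(p in E | p != p0) touch p A.
  rewrite (bigD1 p0) //= touch0; congr (_ + _).
  by apply: eq_bigr => p /andP[_ pp0]; rewrite touchE.
have h1 := hall A1 A1V; have h2 := hall A2 A2V.
have hU := hall (A1 :|: A2) _; have hI := hall (A1 :&: A2) _.
rewrite subUset A1V A2V in hU; have {}hU := hU isT.
rewrite (subset_trans (subsetIl _ _) A1V) in hI; have {}hI := hI isT.
have sumn : \sum_(v in A1 :|: A2) n v + \sum_(v in A1 :&: A2) n v =
            \sum_(v in A1) n v + \sum_(v in A2) n v.
  rewrite !(big_mkcond (fun v => v \in _)) /= -!big_split /=; apply: eq_bigr => v _.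
  by rewrite !inE; case: (v \in A1); case: (v \in A2) => //=; rewrite addn0.
have sub : \sum_(p in E | p != p0) touch p (A1 :|: A2) +
           \sum_(p in E | p != p0) touch p (A1 :&: A2) <=
           \sum_(p in E | p != p0) touch p A1 + \sum_(p in E | p != p0) touch p A2.
  rewrite -!big_split /=; apply: leq_sum => p _; rewrite /touch.
  case: ifP => _; rewrite !inE.
    by case: (_ \in A1); case: (_ \in A2).
  by case: (p.1 \in A1); case: (p.1 \in A2); case: (p.2 \in A1); case: (p.2 \in A2).
move: h1 h2 hU hI lt1 lt2; rewrite !sumE !sumE' !touch0' !inE; move: sumn sub; clear.
case: (p0.1 \in A1); case: (p0.1 \in A2); case: (p0.2 \in A1); case: (p0.2 \in A2) => /=; lia.
Qed.

Lemma hall_orientation E V n :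
  (forall A, A \subset V ->
     \sum_(v in A) n v <= #|[set p in E | (p.1 \in A) || (p.2 \in A)]|) ->
  exists hd : T * T -> T, (forall p, hd p = p.1 \/ hd p = p.2) /\
    forall v, v \in V -> n v <= #|[set p in E | hd p == v]|.
Proof.
move=> hall; apply: (@hall_orientation_rec E V n set0 fst) => [p|A AV]; first by rewrite inE.
apply: leq_trans (hall A AV) _; rewrite -sum1_card.
rewrite (eq_bigl (fun p => (p \in E) && ((p.1 \in A) || (p.2 \in A)))); last first.
  by move=> p; rewrite inE.
by rewrite big_mkcondr /=; apply: leq_sum => p pE; rewrite inE; case: (_ || _).
Qed.

Definition edges_in E V : {set T * T} := [set p in E | (p.1 \in V) && (p.2 \in V)].

(** A minimal [V] with enough edges satisfies Hall's condition: by minimality [V :\: A] contains too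
    few edges, and all other edges of [V] touch [A]. *)
Lemma orientation_of_dense E V n :
  V != set0 -> \sum_(v in V) n v <= #|edges_in E V| ->
  exists (V' : {set T}) (hd : T * T -> T),
    [/\ V' != set0, V' \subset V, forall p, hd p = p.1 \/ hd p = p.2 &
        forall v, v \in V' -> n v <= #|[set p in edges_in E V' | hd p == v]|].
Proof.
have [m] := ubnP #|V|; elim: m V => // m IH V; rewrite ltnS => Vm V0 hV.
have [|/existsPn none] := boolP [exists V1 : {set T},
    [&& V1 \proper V, V1 != set0 & \sum_(v in V1) n v <= #|edges_in E V1|]].
  case/existsP=> V1 /and3P[V1V V10 h1].
  have [|V' [hd [V'0 V'V1 hhd dV']]] := IH V1 _ V10 h1.
    by apply: leq_trans Vm; apply: proper_card.
  by exists V', hd; split=> //; apply: subset_trans V'V1 (proper_sub V1V).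
have [A AV|hd [hhd dV]] := @hall_orientation (edges_in E V) V n; last by exists V, hd.
have split : #|edges_in E V| =
    #|[set p in edges_in E V | (p.1 \in A) || (p.2 \in A)]| + #|edges_in E (V :\: A)|.
  rewrite -(cardsID [set p | (p.1 \in A) || (p.2 \in A)]); congr (_ + _);
    apply: eq_card => p; rewrite !inE //.
  by rewrite negb_or; case: (_ \in E); case: (p.1 \in V); case: (p.2 \in V);
    rewrite /= ?andbF ?andbT.
have sumA : \sum_(v in V) n v = \sum_(v in A) n v + \sum_(v in V :\: A) n v.
  rewrite (bigID (mem A)) /=; congr (_ + _); apply: eq_bigl => v.
    by have [/(subsetP AV)->|] := boolP (v \in A); rewrite ?andbF.
  by rewrite inE andbC.
have [VA|VA] := eqVneq (V :\: A) set0.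
  move: sumA hV split; rewrite VA big_set0.
  have -> : edges_in E set0 = set0 by apply/setP => p; rewrite !inE !andbF.
  by rewrite cards0; clear; lia.
have [->|A0] := eqVneq A set0; first by rewrite big_set0.
have VAV : V :\: A \proper V.
  apply/properP; split; first exact: subsetDl.
  by have [v vA] := set0Pn _ A0; exists v; rewrite ?(subsetP AV) // inE vA.
have := none (V :\: A); rewrite VAV VA /= -ltnNge.
move=> lt; rewrite -(leq_add2r (\sum_(v in V :\: A) n v)) -sumA; apply: leq_trans hV _.
by rewrite split leq_add2l ltnW.
Qed.

End Orientation.

(** * Digraphs with kernels *)

Section Kernels.

Variables (T : finType) (e : rel T) (D : rel T).
Hypothesis e_sym : symmetric e.
Hypothesis e_irr : irreflexive e.
Implicit Types S : {set T}.

(** A vertex to which all its neighbours point can be taken into the kernel; the neighbours are then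
    absorbed, and only its non-neighbours remain. *)
Lemma has_kernel_peel S v :
  v \in S -> (forall u, u \in S -> e v u -> D u v) ->
  has_kernel e D [set u in S | (u != v) && ~~ e v u] -> has_kernel e D S.
Proof.
move=> vS vD [I [IS iI kI]].
have I_n u : u \in I -> [&& u \in S, u != v & ~~ e v u].
  by move=> uI; have := subsetP IS u uI; rewrite inE.
exists (v |: I); split.
- by rewrite subUset sub1set vS; apply/subsetP => u /I_n /and3P[].
- move=> x y /setU1P[->|xI] /setU1P[->|yI].
  + by rewrite e_irr.
  + by case/and3P: (I_n y yI).
  + by rewrite e_sym; case/and3P: (I_n x xI).
  + exact: iI.
move=> u uS; rewrite !inE negb_or => /andP[uv uI].
have [evu|nevu] := boolP (e v u); first by exists v; rewrite ?setU11 ?vD.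
have [|w wI Duw] := kI u _ uI; first by rewrite inE uS uv nevu.
by exists w; rewrite // setU1r.
Qed.

(** An arc that is not reversed goes to larger [r], hence a vertex of maximal [r] receives arcs from
    all its neighbours and can be peeled off. *)
Lemma has_kernel_ranked S (r : T -> nat) :
  {in S &, forall u v, e u v -> ~~ D v u -> D u v && (r u < r v)%N} ->
  has_kernel e D S.
Proof.
have [m] := ubnP #|S|; elim: m S => // m IH S; rewrite ltnS => Sm hS.
have [->|/set0Pn[v0 v0S]] := eqVneq S set0.
  exists set0; split; [exact: sub0set|exact: independent0|by move=> v; rewrite inE].
case: (arg_maxnP r v0S) => v vS vmax.
apply: (has_kernel_peel vS).
  move=> u uS evu; apply/negPn/negP => nD.
  by have /andP[_] := hS v u vS uS evu nD; rewrite ltnNge (vmax u uS : r u <= r v)%N.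
apply: IH => [|x y].
  apply: leq_trans Sm; apply: proper_card; apply/properP; split.
    by apply/subsetP => u; rewrite inE => /andP[].
  by exists v; rewrite // inE eqxx andbF.
by rewrite !inE => /andP[xS _] /andP[yS _]; apply: hS.
Qed.

(** If every vertex of [S] outside [A] has an out-neighbour in [S :&: A], that intersection is the
    kernel. Otherwise a vertex without one receives arcs from all its neighbours and is peeled
    off. *)
Lemma has_kernel_semibipartite (A S : {set T}) :
  independent e A ->
  (forall u v, u \notin A -> v \notin A -> e u v -> D u v) ->
  (forall a b, a \in A -> b \notin A -> e a b -> D a b || D b a) ->
  has_kernel e D S.
Proof.
move=> iA hB hAB; have [m] := ubnP #|S|; elim: m S => // m IH S; rewrite ltnS => Sm.
have [/existsP[v]|/existsPn none] :=
    boolP [exists v, [&& v \in S, v \notin A & ~~ [exists a, [&& a \in S, a \in A & D v a]]]].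
  case/and3P=> vS vA /existsPn va; apply: (has_kernel_peel vS).
    move=> u uS evu; have [uA|uA] := boolP (u \in A).
      have := hAB u v uA vA; rewrite e_sym => /(_ evu).
      by have := va u; rewrite uS uA /= => /negPf ->; rewrite orbF.
    by apply: hB => //; rewrite e_sym.
  apply: IH; apply: leq_trans Sm; apply: proper_card; apply/properP; split.
    by apply/subsetP => u; rewrite inE => /andP[].
  by exists v; rewrite // inE eqxx andbF.
exists (S :&: A); split; first exact: subsetIl.
  by move=> x y /setIP[_ xA] /setIP[_ yA]; apply: iA.
move=> v vS; rewrite inE vS /= => vA; have := none v.
rewrite vS vA /= negbK => /existsP[a /and3P[aS aA Dva]].
by exists a; rewrite // inE aS.
Qed.

End Kernels.

(** * Reducibility in a critical graph *)

Section Critical.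

Variables (T : finType) (e : rel T) (k : nat).
Hypothesis e_sym : symmetric e.
Hypothesis e_irr : irreflexive e.
Hypothesis e_crit : online_list_critical e k.
Hypothesis e_ncomplete : ~ complete_graph e.
Hypothesis k_gt0 : (0 < k)%N.

Local Notation dg v := (deg e [set: T] v).

Lemma induced_proper (X : {set T}) : X != set0 ->
  online_choosable e (~: X) (fun=> k%:Z - 1).
Proof.
move=> X0; pose e' x y := [&& e x y, x \in ~: X & y \in ~: X].
apply: (@online_choosable_eqrel _ e').
  by move=> x y xX yX; rewrite /e' xX yX !andbT.
apply: e_crit.2; split=> //.
- by move=> x y; rewrite /e' e_sym [(x \in _) && _]andbC.
- left; apply: contraNneq X0 => /(congr1 (@setC T)); by rewrite setCK setCT => ->.
Qed.

(** The rest of the graph, a proper subgraph, is answered first; [v] loses at most one colour for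
    each neighbour outside [X], and the stated number is what remains of [k - 1]. *)
Lemma critical_irreducible (X : {set T}) : X != set0 ->
  ~ online_choosable e X (fun v => k%:Z - 1 - (dg v)%:Z + (deg e X v)%:Z).
Proof.
move=> X0 oX; apply: e_crit.1; rewrite /online_nchoosable.
have -> : [set: T] = X :|: ~: X by rewrite setUCr.
have dis : [disjoint X & ~: X] by rewrite disjoints_subset setCK.
apply: (online_choosable_setU e_sym dis oX (induced_proper X0)) => // v vX.
have -> : dg v = (deg e X v + deg e (~: X) v)%N by rewrite -deg_setU // setUCr.
by clear; lia.
Qed.

(** Otherwise the vertex alone, with no arcs, would be reducible. *)
Lemma min_degree v : (k <= (dg v).+1)%N.
Proof.
rewrite leqNgt; apply/negP => dv.
have v0 : [set v] != set0 :> {set T} by rewrite -cards_eq0 cards1.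
apply: (critical_irreducible v0); apply: (@online_choosable_kernel _ _ (fun _ _ => false)).
  move=> u /set1P->; rewrite (_ : [set _ in _ | _] = set0) ?cards0; first by move: dv; clear; lia.
  by apply/setP => w; rewrite !inE andbF.
move=> S Sv; exists S; split=> //; last by move=> u ->.
by move=> x y /(subsetP Sv)/set1P-> /(subsetP Sv)/set1P->; rewrite e_irr.
Qed.

(** [K_k] is not online [(k-1)]-choosable, so criticality would make it the whole graph, which is
    not complete. *)
Lemma no_big_clique (X : {set T}) : clique e X -> #|X| <> k.
Proof.
move=> cX Xk; have X0 : X != set0 by rewrite -cards_eq0 Xk; case: k k_gt0.
have ncX : ~ online_choosable e X (fun=> k%:Z - 1).
  apply: clique_not_online_choosable => // v _; rewrite Xk; clear; lia.
have [C0|C0] := eqVneq (~: X) set0.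
  apply: e_ncomplete => x y; apply: cX.
  - by have := in_set0 x; rewrite -C0 inE => /negbFE.
  - by have := in_set0 y; rewrite -C0 inE => /negbFE.
by apply: ncX; have := induced_proper C0; rewrite setCK.
Qed.

Lemma sum_deg_card (A X : {set T}) :
  (\sum_(a in A) deg e X a = #|[set p : T * T | [&& p.1 \in A, p.2 \in X & e p.1 p.2]]|)%N.
Proof.
rewrite -sum1_card (eq_bigl (fun p : T * T => (p.1 \in A) && ((p.2 \in X) && e p.1 p.2))); last first.
  by move=> p; rewrite inE.
rewrite -(pair_big_dep (fun a => a \in A) (fun a b => (b \in X) && e a b) (fun _ _ => 1%N)) /=.
by apply: eq_bigr => a _; rewrite sum1_card /deg; apply: eq_card => b; rewrite !inE.
Qed.

(* The kernel lemma for the digraph in which [X :\: A] is bidirected and the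
   edges between [A] and [X :\: A] are oriented. *)
Lemma independent_edge_bound (A X : {set T}) :
  X != set0 -> A \subset X -> independent e A ->
  (\sum_(a in A) deg e X a < \sum_(v in X) ((dg v).+2 - k))%N.
Proof.
move=> X0 AX iA; rewrite ltnNge; apply/negP => hle.
(* Each edge at [A] occurs once, written from its end in [A], because [A] is independent. *)
pose E := [set p : T * T | [&& p.1 \in A, p.2 \in X & e p.1 p.2]].
have EX : edges_in E X = E.
  apply/setP => p; rewrite !inE; have [pA|//] := boolP (p.1 \in A).
  by rewrite (subsetP AX _ pA); case: (p.2 \in X); rewrite /= ?andbT ?andbF.
(* With [d_G + 2 - k] edges directed to it, a vertex of [V] has outdegree below [k - 1 - d_G + d_V],
   as the kernel lemma demands. *)
have [|V [hd [V0 VX hhd dV]]] := orientation_of_dense X0 (E := E) (n := fun v => ((dg v).+2 - k)%N).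
  by rewrite EX; apply: leq_trans hle _; rewrite sum_deg_card.
apply: (critical_irreducible V0).
pose D u v := e u v && (if u \in A then hd (u, v) == v else if v \in A then hd (v, u) == v else true).
apply: (@online_choosable_kernel _ _ D) => [u uV|S SV]; last first.
  apply: (has_kernel_semibipartite e_sym e_irr _ iA).
    by move=> x y xA yA exy; rewrite /D exy (negPf xA) (negPf yA).
  move=> a b aA bA eab; rewrite /D (e_sym b a) eab aA (negPf bA) /=.
  by case: (hhd (a, b)) => /= ->; rewrite eqxx ?orbT.
have nA x y : x \in A -> e x y -> y \notin A.
  by move=> xA exy; apply/negP => yA; case/negP: (iA x y xA yA).
have := dV u uV; set IN := [set p in _ | _] => hIN.
suff : (#|[set v in V | D u v]| + #|IN| <= deg e V u)%N.
  by have := min_degree u; move: hIN; clear; lia.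
(* The edges directed to [u] are counted by their other ends, which are neighbours of [u] that
   receive no arc from it. *)
pose oth (p : T * T) := if u \in A then p.2 else p.1.
have INP p : p \in IN -> [/\ p.1 \in A, p.2 \in V, p.1 \in V, e p.1 p.2 & hd p = u].
  by rewrite !inE => /andP[/andP[/and3P[-> _ ->] /andP[-> ->]] /eqP ->].
have pu p : p \in IN -> if u \in A then p.1 = u else p.2 = u.
  move=> pI; have [pA pV _ ep hdp] := INP p pI.
  have p2A := nA _ _ pA ep.
  have [uA|uA] := boolP (u \in A); case: (hhd p) => hp; rewrite hdp in hp => //.
  - by rewrite hp (negPf p2A) in uA.
  - by rewrite hp pA in uA.
have inj : {in IN &, injective oth}.
  move=> [p1 p2] [q1 q2] pI qI; have := pu _ pI; have := pu _ qI; rewrite /oth.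
  by case: (u \in A) => /= -> -> ->.
rewrite -(card_in_imset inj).
rewrite -cardsUI [X in (_ + X)%N](_ : _ = 0%N) ?addn0.
  apply: subset_leq_card; apply/subsetP => v /setUP[|/imsetP[p pI ->]].
    by rewrite !inE /D => /andP[-> /andP[->]].
  have [pA p2V p1V ep hdp] := INP p pI; rewrite inE.
  have := pu p pI; rewrite /oth; case: ifP => uA pE; rewrite ?p2V ?p1V /= -pE //.
  by rewrite e_sym.
apply/eqP; rewrite cards_eq0 -subset0; apply/subsetP => v /setIP[].
rewrite inE => /andP[vV Duv] /imsetP[p pI vp]; exfalso; move: Duv.
have [pA p2V p1V ep hdp] := INP p pI.
have := pu p pI; rewrite vp /D /oth; case: ifP => uA pE.
  rewrite -{2}pE -surjective_pairing hdp => /andP[euv /eqP uv].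
  by rewrite -uv e_irr in euv.
rewrite pA -{2}pE -surjective_pairing hdp.
by move=> /andP[euv /eqP uv]; rewrite -uv e_irr in euv.
Qed.

End Critical.

Local Close Scope ring_scope.

(** * The subgraph of low vertices *)

Section Walks.

Variables (T : finType) (e : rel T).
Hypothesis e_sym : symmetric e.
Implicit Types (Z C : {set T}) (p : nat -> T).

Definition closed_in Z C : Prop :=
  C \subset Z /\ forall x y, x \in C -> y \in Z -> e x y -> y \in C.

(** In this form the empty set is connected, so deleting the only vertex of a block does no harm. *)
Definition conn Z : Prop := forall C, closed_in Z C -> C != set0 -> C = Z.

Definition walk Z p l : Prop :=
  (forall i, i <= l -> p i \in Z) /\ (forall i, i < l -> e (p i) (p i.+1)).

Definition link Z : rel T := connect [rel x y | [&& e x y, x \in Z & y \in Z]].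

Lemma link_conn Z x y : conn Z -> x \in Z -> y \in Z -> link Z x y.
Proof.
move=> cZ xZ yZ; pose C := [set z in Z | link Z x z].
suff: y \in C by rewrite inE => /andP[].
rewrite (cZ C) //; last by apply/set0Pn; exists x; rewrite inE xZ /link connect0.
split; first by apply/subsetP => z; rewrite inE => /andP[].
move=> u w; rewrite !inE => /andP[uZ xu] wZ euw; rewrite wZ.
by apply: connect_trans xu _; apply: connect1; rewrite /= euw uZ.
Qed.

Lemma link_walk Z x y : x \in Z -> link Z x y ->
  exists l p, [/\ walk Z p l, p 0 = x & p l = y].
Proof.
move=> xZ /connectP[s ps ->]; exists (size s), (nth x (x :: s)); split=> //; last first.
  by rewrite nth_last.
have pz := pathP x ps; split=> [[|i]|i] //= hi.
  by have /and3P[] := pz i hi.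
by have /and3P[] := pz i hi.
Qed.

Lemma walk_shortest Z (C : rel T) l p :
  walk Z p l -> C (p 0) (p l) ->
  exists l p, [/\ walk Z p l, C (p 0) (p l) &
    forall l' p', walk Z p' l' -> C (p' 0) (p' l') -> l <= l'].
Proof.
move=> wp Cp.
(* Searching finitely many tuples makes the existence of a walk of length [l] decidable, so that a
   least length exists. *)
pose Q l := [exists x, exists t : l.-tuple T,
   [&& path e x t, all (mem Z) (x :: t) & C x (last x t)]].
have walkQ l' p' : walk Z p' l' -> C (p' 0) (p' l') -> Q l'.
  move=> [pZ pe] C'; apply/existsP; exists (p' 0).
  have st : size (mkseq (fun i => p' i.+1) l') == l' by rewrite size_mkseq.
  have nthE i : i <= l' -> nth (p' 0) (p' 0 :: mkseq (fun i => p' i.+1) l') i = p' i.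
    by case: i => //= i hi; rewrite nth_mkseq.
  apply/existsP; exists (Tuple st); apply/and3P; split.
  - apply/(pathP (p' 0)) => i /=; rewrite size_mkseq => hi.
    by rewrite nthE 1?ltnW // nth_mkseq //; apply: pe.
  - apply/(all_nthP (p' 0)) => i /=; rewrite size_mkseq => hi.
    by rewrite nthE //; apply: pZ.
  - by rewrite (last_nth (p' 0)) size_mkseq nthE.
have exQ : exists l, Q l by exists l; apply: walkQ wp Cp.
case: (ex_minnP exQ) => m /existsP[z /existsP[t /and3P[pt /allP aZ Ct]]] mmin.
exists m, (nth z (z :: t)); split.
- split=> i hi; first by apply: aZ; rewrite mem_nth //= size_tuple ltnS.
  by apply: (pathP z pt); rewrite size_tuple.
- by move: Ct; rewrite (last_nth z) size_tuple.
- by move=> l' p' w' C'; apply: mmin; apply: walkQ w' C'.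
Qed.

Lemma walk_shortcut Z p l i j :
  walk Z p l -> i < j <= l -> e (p i) (p j) ->
  exists q, [/\ walk Z q (l - (j - i).-1), q 0 = p 0 & q (l - (j - i).-1) = p l].
Proof.
move=> [pZ pe] /andP[ij jl] eij.
exists (fun n => if n <= i then p n else p (n + (j - i).-1)); set q := (fun n => _).
split=> //.
- split=> n hn; rewrite /q; first by case: ifP => hi; apply: pZ; lia.
  have [ni|ni] := ltnP n i.
    by rewrite (ltnW ni); apply: pe; lia.
  case: ifP => ni'.
    have -> : n = i by lia.
    by have -> : i.+1 + (j - i).-1 = j by lia.
  by rewrite addSn; apply: pe; lia.
- by rewrite /q; case: ifP => h; congr p; lia.
Qed.

Lemma walk_splice Z p l i j :
  walk Z p l -> i < j <= l -> p i = p j ->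
  exists q, [/\ walk Z q (l - (j - i)), q 0 = p 0 & q (l - (j - i)) = p l].
Proof.
move=> [pZ pe] /andP[ij jl] eij.
exists (fun n => if n <= i then p n else p (n + (j - i))); set q := (fun n => _).
split=> //.
- split=> n hn; rewrite /q; first by case: ifP => hi; apply: pZ; lia.
  have [ni|ni] := ltnP n i.
    by rewrite (ltnW ni); apply: pe; lia.
  case: ifP => ni'.
    have -> : n = i by lia.
    rewrite eij (_ : i.+1 + (j - i) = j.+1); last lia.
    by apply: pe; lia.
  by rewrite addSn; apply: pe; lia.
- rewrite /q; case: ifP => h; last by congr p; lia.
  have E : l - (j - i) = i by lia.
  by rewrite E eij; congr p; lia.
Qed.

Lemma walk_prefix Z p l i : walk Z p l -> i <= l -> walk Z p i.
Proof. by move=> [pZ pe] il; split=> n hn; [apply: pZ|apply: pe]; lia. Qed.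

Lemma walk_suffix Z p l i : walk Z p l -> i <= l -> walk Z (fun n => p (n + i)) (l - i).
Proof. by move=> [pZ pe] il; split=> n hn; [apply: pZ|rewrite addSn; apply: pe]; lia. Qed.

Section Minimal.

Variables (Z : {set T}) (C : rel T) (p : nat -> T) (l : nat).
Hypotheses (wp : walk Z p l) (Cp : C (p 0) (p l)).
Hypothesis pmin : forall l' p', walk Z p' l' -> C (p' 0) (p' l') -> l <= l'.

Lemma min_walk_inj i j : i <= l -> j <= l -> p i = p j -> i = j.
Proof.
wlog ij : i j / i <= j => [H hi hj E|hi hj E].
  by case/orP: (leq_total i j) => h; [|apply/esym]; apply: H.
have [//|ij'] := eqVneq i j; have {}ij' : i < j <= l by lia.
have [q [wq q0 ql]] := walk_splice wp ij' E.
by have := pmin wq; rewrite q0 ql => /(_ Cp); lia.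
Qed.

Lemma min_walk_induced i j : i <= l -> j <= l -> e (p i) (p j) -> i <= j.+1 /\ j <= i.+1.
Proof.
wlog ij : i j / i <= j => [H hi hj E|hi hj E].
  case/orP: (leq_total i j) => h; first exact: H.
  by have [|||H1 H2] := H j i h => //; rewrite e_sym.
split; first lia.
rewrite leqNgt; apply/negP => lt; have ij' : i < j <= l by lia.
have [q [wq q0 ql]] := walk_shortcut wp ij' E.
by have := pmin wq; rewrite q0 ql => /(_ Cp); lia.
Qed.

Lemma min_walk_prefix i : i <= l -> C (p 0) (p i) -> i = l.
Proof. by move=> il Ci; have := pmin (walk_prefix wp il) Ci; lia. Qed.

Lemma min_walk_suffix i : i <= l -> C (p i) (p l) -> i = 0.
Proof.
move=> il Ci; have := pmin (walk_suffix wp il); rewrite add0n subnK // => /(_ Ci).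
lia.
Qed.

End Minimal.

End Walks.

(** * Even cycles and theta graphs *)

Section LowGraph.

Variables (T : finType) (e : rel T) (L : {set T}).
Hypothesis e_sym : symmetric e.
Hypothesis e_irr : irreflexive e.

(* Every bipartite graph of the edges leaving an independent set of [L] is a forest. *)
Hypothesis forestL : forall A X : {set T}, X != set0 -> X \subset L -> A \subset X ->
  independent e A -> \sum_(a in A) deg e X a < #|X|.

(** An independent alternate class has [n] vertices, each with at least two edges to the [n.*2]
    vertices of the cycle, against the forest condition. Only chords inside that class have to be
    excluded. *)
Lemma no_alternating_cycle (c : nat -> T) n b :
  1 < n -> (forall i, i < n.*2 -> c i \in L) ->
  (forall i j, i < n.*2 -> j < n.*2 -> c i = c j -> i = j) ->
  (forall i, i.+1 < n.*2 -> e (c i) (c i.+1)) -> e (c n.*2.-1) (c 0) ->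
  (forall i j, i < n.*2 -> j < n.*2 -> odd i = b -> odd j = b -> ~~ e (c i) (c j)) ->
  False.
Proof.
move=> n1 cL cI ce cl cA.
pose X := [set c i | i : 'I_(n.*2)]; pose A := [set c (i.*2 + b) | i : 'I_n].
have ib (i : 'I_n) : i.*2 + b < n.*2 by have := ltn_ord i; case: b {cA A} => /=; lia.
have cX i : i < n.*2 -> c i \in X by move=> hi; apply/imsetP; exists (Ordinal hi).
have X0 : X != set0 by apply/set0Pn; exists (c 0); apply: cX; lia.
have XL : X \subset L by apply/subsetP => x /imsetP[i _ ->]; apply: cL.
have AX : A \subset X by apply/subsetP => x /imsetP[i _ ->]; apply: cX.
have iA : independent e A.
  move=> x y /imsetP[i _ ->] /imsetP[j _ ->]; apply: cA => //;
    by rewrite oddD odd_double; case: (b).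
have Xn : #|X| = n.*2.
  by rewrite card_imset ?card_ord // => i j /cI E; apply/val_inj/E.
have An : #|A| = n.
  rewrite card_imset ?card_ord // => i j /cI E; apply/val_inj.
  by have := E (ib i) (ib j) => /addIn /double_inj.
have := forestL X0 XL AX iA; rewrite Xn ltnNge => /negP[].
rewrite -addnn -An -[X in X + _]muln1 -[X in _ + X]muln1 -mulnDr -sum_nat_const.
apply: leq_sum => a /imsetP[i _ ->]; set j := i.*2 + b.
have jn : j < n.*2 := ib i.
pose nx := if j.+1 < n.*2 then j.+1 else 0.
pose pv := if j == 0 then n.*2.-1 else j.-1.
have nxn : nx < n.*2 by rewrite /nx; case: ifP => //; lia.
have pvn : pv < n.*2 by rewrite /pv; case: ifP => //; lia.
have enx : e (c j) (c nx).
  rewrite /nx; case: ifP => h; first exact: ce.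
  by have -> : j = n.*2.-1 by lia.
have epv : e (c j) (c pv).
  rewrite e_sym /pv; case: eqP => h; first by rewrite h.
  by have := @ce j.-1; rewrite prednK ?lt0n; [apply; lia|apply/eqP].
have npv : c nx != c pv.
  apply/eqP => /(cI _ _ nxn pvn); rewrite /nx /pv; move: n1 jn; clear; do 2 case: ifP; lia.
apply: (@leq_trans #|[set c nx; c pv]|); first by rewrite cards2 npv.
apply: subset_leq_card; apply/subsetP => x; rewrite !inE.
by case/orP => /eqP ->; rewrite cX // ?enx ?epv.
Qed.

(** The four vertices form a cycle in which [x] and [y] are an independent class, whether or not [u]
    and [w] are adjacent. *)
Lemma unique_common_neighbour x y u w :
  x \in L -> y \in L -> u \in L -> w \in L -> x != y -> ~~ e x y -> u != w ->
  e x u -> e x w -> e y u -> e y w -> False.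
Proof.
move=> xL yL uL wL xy nxy uw xu xw yu yw.
have ne a b : e a b -> a != b by apply: contraTneq => ->; rewrite e_irr.
apply: (@no_alternating_cycle (nth x [:: x; u; y; w]) 2 false) => //.
- by case=> [|[|[|[|]]]].
- have : uniq [:: x; u; y; w].
    rewrite /= !inE !negb_or xy uw (ne _ _ xu) (ne _ _ xw) (eq_sym u y) (ne _ _ yu).
    by rewrite (ne _ _ yw).
  by move=> U i j hi hj /eqP; rewrite nth_uniq // => /eqP.
- by case=> [|[|[|[|]]]] //= _; rewrite e_sym.
- by rewrite e_sym.
- by case=> [|[|[|[|]]]] // [|[|[|[|]]]] //= _ _ _ _; rewrite ?e_irr // e_sym.
Qed.

(* Theta graph: the cycle runs from [v] along [r] and back along [p]; the
   alternating class avoids [r s] unless [p j] is its only neighbour on [p]. *)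
Lemma no_theta v (p r : nat -> T) l s j :
  odd l -> v \in L -> (forall i, i <= l -> p i \in L) -> (forall i, i <= s -> r i \in L) ->
  (forall i, i <= l -> v != p i) -> (forall i, i <= s -> v != r i) ->
  (forall i i', i <= l -> i' <= s -> p i != r i') ->
  (forall i i', i <= l -> i' <= l -> p i = p i' -> i = i') ->
  (forall i i', i <= s -> i' <= s -> r i = r i' -> i = i') ->
  e v (p 0) -> e v (r 0) ->
  (forall i, i < l -> e (p i) (p i.+1)) -> (forall i, i < s -> e (r i) (r i.+1)) ->
  (forall i i', i <= l -> i' <= l -> e (p i) (p i') -> i <= i'.+1 /\ i' <= i.+1) ->
  (forall i i', i <= s -> i' <= s -> e (r i) (r i') -> i <= i'.+1 /\ i' <= i.+1) ->
  (forall i, i <= l -> e v (p i) -> i = 0 \/ i = l) ->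
  (forall i, i <= s -> e v (r i) -> i = 0) ->
  (forall i i', i <= s -> i' <= l -> e (r i) (p i') -> i = s) ->
  j <= l -> e (r s) (p j) -> odd j = odd s.+1 ->
  j < l \/ (forall i, i <= l -> e (r s) (p i) -> i = j) -> False.
Proof.
move=> ol vL pL rL vp vr pr pI rI vp0 vr0 pe re pn rn vpn vrn rpn jl rj oj hj.
(* Position [s.+1] of the cycle is [r s]. For [j < l] the class of parity [odd s] avoids it. For
   [j = l] the class contains it but not [v], whose second neighbour [p l] is then on the cycle. *)
pose b := if j < l then odd s else odd s.+1.
pose c n := if n is n'.+1 then if n' <= s then r n' else p (j - (n' - s.+1)) else v.
have [h hE] : exists h, h.*2 = s + j + 3.
  exists (s + j + 3)./2; apply: even_halfK.
  by rewrite !oddD oj /=; case: (odd s).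
have cv n : n < h.*2 -> [\/ n = 0 /\ c n = v, [/\ 0 < n, n.-1 <= s & c n = r n.-1] |
    [/\ s + 2 <= n, j - (n - (s + 2)) <= j, n = s + 2 + (j - (j - (n - (s + 2)))) & c n = p (j - (n - (s + 2)))]].
  case: n => [|n] hn; first by constructor 1.
  rewrite /c; case: ifP => hns; first by constructor 2.
  constructor 3; move: hn hns hE; clear -n s j h => hn hns hE; split; [lia|lia|lia|congr p; lia].
have sE : s + 2 = s.+2 by rewrite addn2.
apply: (@no_alternating_cycle c h b).
- lia.
- move=> n /cv[[_ ->]|[_ h1 ->]|[_ h1 _ ->]] //; [exact: rL|apply: pL; lia].
- move=> n m /cv[[n0 ->]|[n0 h1 ->]|[n0 h1 h1' ->]] /cv[[m0 ->]|[m0 h2 ->]|[m0 h2 h2' ->]].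
  + by move=> _; rewrite n0 m0.
  + by move=> E; have := vr _ h2; rewrite E eqxx.
  + by move=> E; have := vp _ (leq_trans h2 jl); rewrite E eqxx.
  + by move=> E; have := vr _ h1; rewrite E eqxx.
  + by move/(rI _ _ h1 h2); lia.
  + by move=> E; have := pr _ _ (leq_trans h2 jl) h1; rewrite E eqxx.
  + by move=> E; have := vp _ (leq_trans h1 jl); rewrite E eqxx.
  + by move=> E; have := pr _ _ (leq_trans h1 jl) h2; rewrite E eqxx.
  + by move/(pI _ _ (leq_trans h1 jl) (leq_trans h2 jl)); move: n0 m0 h1' h2'; clear; lia.
- case=> [|n] hn; first by rewrite /c /=.
  rewrite /c; case: (ltngtP n s) => hns.
  + exact: re.
  + rewrite e_sym (_ : j - (n - s.+1) = (j - (n.+1 - s.+1)).+1); last by lia.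
    by apply: pe; lia.
  + by rewrite hns subnn subn0.
- rewrite e_sym /c hE; have -> : (s + j + 3).-1 = (s + j + 1).+1 by lia.
  have -> : s + j + 1 <= s = false by lia.
  by have -> : j - (s + j + 1 - s.+1) = 0 by lia.
have pp i i' : i <= j -> i' <= j -> odd i = odd i' -> ~~ e (p i) (p i').
  move=> hi hi' oi; apply/negP => E.
  have [h1 h2] := pn i i' (leq_trans hi jl) (leq_trans hi' jl) E.
  have [ii|] := eqVneq i i'; first by rewrite ii e_irr in E.
  by move=> ni; have : odd i' = odd i by []; lia.
have rr i i' : i <= s -> i' <= s -> odd i = odd i' -> ~~ e (r i) (r i').
  move=> hi hi' oi; apply/negP => E.
  have [h1 h2] := rn i i' hi hi' E.
  have [ii|] := eqVneq i i'; first by rewrite ii e_irr in E.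
  by move=> ni; have : odd i' = odd i by []; lia.
have vvr n : 0 < n -> n.-1 <= s -> odd n = odd 0 -> ~~ e v (r n.-1).
  by move=> n0 hn on; apply/negP => /(vrn _ hn); case: n n0 hn on => [|[|]].
have vvp n : s + 2 <= n -> n < h.*2 -> b = false -> odd n = b ->
    ~~ e v (p (j - (n - (s + 2)))).
  move=> h1 h2 bf on; apply/negP => /vpn[]; [lia| |].
  - move=> E; have E' : n = s + 2 + j by lia.
    by move: on; rewrite bf E' !oddD oj /=; case: (odd s).
  - move=> E; have jE : j = l by lia.
    have nE : n = s + 2 by lia.
    move: bf on oj; rewrite /b jE ltnn ol /= => bf; rewrite bf nE addn2 /=.
    by rewrite bf.
have rrp n m : 0 < n -> n.-1 <= s -> s + 2 <= m -> m < h.*2 -> odd n = b -> odd m = b ->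
    ~~ e (r n.-1) (p (j - (m - (s + 2)))).
  move=> n0 ns m0 mh on om; apply/negP => E.
  have Es := rpn _ _ ns (leq_trans (leq_subr _ _) jl) E.
  have nE : n = s.+1 by move: n0 Es; clear; lia.
  move: on om; rewrite /b nE; case: hj => hj; first by rewrite hj /=; case: (odd s).
  rewrite Es in E; have Ej := hj _ (leq_trans (leq_subr _ _) jl) E.
  have -> : m = s + 2 by lia.
  by rewrite addn2 /=; case: ifP; case: (odd s).
move=> n m nh mh; case: (cv n nh) => [[n0 ->]|[n0 h1 ->]|[n0 h1 h1' ->]];
  case: (cv m mh) => [[m0 ->]|[m0 h2 ->]|[m0 h2 h2' ->]] on om.
- by rewrite e_irr.
- by apply: vvr => //; rewrite om -on n0.
- by apply: vvp => //; rewrite -on n0.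
- by rewrite e_sym; apply: vvr => //; rewrite on -om m0.
- by apply: rr => //; lia.
- exact: rrp.
- by rewrite e_sym; apply: vvp => //; rewrite -om m0.
- by rewrite e_sym; apply: rrp.
- by apply: pp => //; move: n0 m0 h1' h2' on om; clear; move: b => b; lia.
Qed.

End LowGraph.

Section GallaiBlocks.

Variables (T : finType) (e : rel T) (L : {set T}).
Hypothesis e_sym : symmetric e.
Hypothesis e_irr : irreflexive e.
Hypothesis forestL : forall A X : {set T}, X != set0 -> X \subset L -> A \subset X ->
  independent e A -> \sum_(a in A) deg e X a < #|X|.

(** A shortest path [p] in [Z] between two nonadjacent neighbours of [v] closes to an induced cycle
    through [v], which must be odd. A third neighbour reaches [p] by a path [r]; of the two ways
    round the odd cycle one completes [r] to an even cycle, which [no_theta] forbids. *)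
Lemma deg_conn_nonadjacent (Z : {set T}) v a b :
  Z \subset L -> conn e Z -> v \in L -> v \notin Z -> a \in Z -> b \in Z ->
  e v a -> e v b -> a != b -> ~~ e a b -> deg e Z v <= 2.
Proof.
move=> ZL cZ vL vZ aZ bZ va vb ab nab; rewrite leqNgt; apply/negP => d3.
have CN := unique_common_neighbour e_sym e_irr forestL.
pose C x y := [&& e v x, e v y, x != y & ~~ e x y].
have [l0 [p0 [w0 p0a p0b]]] := link_walk aZ (link_conn cZ aZ bZ).
have C0 : C (p0 0) (p0 l0) by rewrite /C p0a p0b va vb ab.
have {l0 p0 w0 p0a p0b C0 a b aZ bZ va vb ab nab} [l [p [wp Cp pmin]]] := walk_shortest w0 C0.
have [pZ pe] := wp; have [va vb ab nab] := and4P Cp.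
have pI := min_walk_inj wp Cp pmin.
have pn := min_walk_induced e_sym wp Cp pmin.
have pL i : i <= l -> p i \in L by move=> hi; apply: (subsetP ZL); apply: pZ.
have vneq x : x \in Z -> v != x by apply: contraTneq => <-.
have ieq i : i <= l -> e v (p i) -> i = 0 \/ i = l.
  move=> il vi; have [->|i0] := eqVneq i 0; first by left.
  have [->|inl] := eqVneq i l; first by right.
  (* By minimality of [p], an inner neighbour of [v] is adjacent to both ends of [p], which then
     have it and [v] as common neighbours. *)
  exfalso; have [ai|nai] := boolP (e (p 0) (p i)); last first.
    have ai : p 0 != p i by apply/eqP => /(pI _ _ (leq0n l) il)/esym; apply/eqP.

    by move/eqP: inl; apply; apply: (min_walk_prefix wp Cp pmin il); rewrite /C va vi ai.
  have [ib|nib] := boolP (e (p i) (p l)); last first.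
    have ib : p i != p l by apply/eqP => /(pI _ _ il (leqnn l)); apply/eqP.
    by move/eqP: i0; apply; apply: (min_walk_suffix wp Cp pmin il); rewrite /C vb vi ib.
  apply: (@CN (p 0) (p l) v (p i)); rewrite ?pL ?vneq ?pZ //.
  - by rewrite e_sym.
  - by rewrite e_sym.
  - by rewrite e_sym.
have l2 : 1 < l.
  case: l {pmin pI pn pL ieq pZ wp Cp} vb ab nab pe => [|[|l]] // _; first by rewrite eqxx.
  by move=> _ /negP nab /(_ 0 isT).
have ol : odd l.
  apply/negPn/negP => el.
  pose c n := if n is n'.+1 then p n' else v.
  have [h hE] : exists h, h.*2 = l.+2.
    by exists (l.+2)./2; apply: even_halfK; rewrite /= negbK.
  apply: (@no_alternating_cycle _ _ _ e_sym forestL c h true).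
  - by move: hE l2; clear; lia.
  - by case=> [|n] //=; rewrite hE ltnS => hn; apply: pL.
  - rewrite hE; case=> [|n] [|m] //= hn hm E.
    + by have := vneq (p m) (pZ m hm); rewrite E eqxx.
    + by have := vneq (p n) (pZ n hn); rewrite E eqxx.
    + by congr S; apply: pI.
  - rewrite hE; case=> [|n] //= hn; exact: pe.
  - by rewrite hE /= e_sym.
  rewrite hE => -[|n] [|m] //= hn hm on om; apply/negP => E.
  have [h1 h2] := pn _ _ hn hm E.
  have nm : n = m by move: h1 h2 on om; clear; lia.
  by rewrite nm e_irr in E.
pose onP x := [exists i : 'I_l.+1, p i == x].
have onPP i : i <= l -> onP (p i).
  by move=> il; apply/existsP; exists (inord i); rewrite inordK.
have onPE x : onP x -> exists2 i, i <= l & x = p i.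
  by case/existsP=> i /eqP <-; exists i; rewrite // -ltnS.
have [c [cZ' vc c0 cl]] : exists c, [/\ c \in Z, e v c, c != p 0 & c != p l].
  have /subsetPn[c] : ~~ ([set u in Z | e v u] \subset [set p 0; p l]).
    by apply/negP => /subset_leq_card; rewrite cards2 ab leqNgt d3.
  by rewrite !inE negb_or => /andP[h1 h2] /andP[h3 h4]; exists c.
pose Z' := [set x in Z | ~~ onP x].
(* The path [r] shall start at a further neighbour of [v], avoid [p] and end next to it; being
   shortest, it touches [v] only at its start and [p] only at its end. *)
pose CR x y := [&& e v x, x != p 0, x != p l & [exists i : 'I_l.+1, e y (p i)]].
have [l1 [w1 [[w1Z w1e] w1c w1p]]] := link_walk cZ' (link_conn cZ cZ' (pZ 0 isT)).
have exi : exists i, (i <= l1) && onP (w1 i) by exists l1; rewrite leqnn w1p onPP.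
case: (ex_minnP exi) => i0 /andP[i0l oi0] i0min.
have i0p : 0 < i0.
  rewrite lt0n; apply: contraTneq oi0 => ->; rewrite w1c; apply/negP => /onPE[i il ci].
  have := ieq i il; rewrite -ci => /(_ vc) [E|E].
    by rewrite ci E eqxx in c0.
  by rewrite ci E eqxx in cl.
have wR0 : walk e Z' w1 i0.-1.
  split=> i hi; last by apply: w1e; move: hi i0l; clear; lia.
  rewrite inE w1Z ?andTb; last by move: hi i0l; clear; lia.
  apply/negP => oi; have : i0 <= i by apply: i0min; rewrite oi andbT; move: hi i0l; clear; lia.
  by move: hi i0p; clear; lia.
have CR0 : CR (w1 0) (w1 i0.-1).
  rewrite /CR w1c vc c0 cl /=; have [i il ei] := onPE _ oi0.
  apply/existsP; exists (inord i); rewrite inordK // -ei.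
  by have := @w1e i0.-1; rewrite prednK //; apply; move: i0p i0l; clear; lia.
have [s [r [wr Cr rmin]]] := walk_shortest wR0 CR0.
have [rZ' re] := wr; have [vr0 r00 r0l /existsP[j0 rj0]] := and4P Cr.
have rI := min_walk_inj wr Cr rmin.
have rn := min_walk_induced e_sym wr Cr rmin.
have rZ i : i <= s -> r i \in Z by move=> /rZ'; rewrite inE => /andP[].
have rL i : i <= s -> r i \in L by move=> hi; apply: (subsetP ZL); apply: rZ.
have rP i i' : i <= l -> i' <= s -> p i != r i'.
  move=> hi hi'; apply/negP => /eqP E; have := rZ' i' hi'.
  by rewrite inE -E onPP ?andbF.
have vrn i : i <= s -> e v (r i) -> i = 0.
  move=> hi vi; apply: (min_walk_suffix wr Cr rmin hi).
  rewrite /CR vi !(eq_sym (r i)) !rP //=; apply/existsP; by exists j0.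
have rpn i i' : i <= s -> i' <= l -> e (r i) (p i') -> i = s.
  move=> hi hi' E; apply: (min_walk_prefix wr Cr rmin hi).
  by rewrite /CR vr0 r00 r0l; apply/existsP; exists (inord i'); rewrite inordK.
have vp i : i <= l -> v != p i by move=> hi; apply/vneq/pZ.
have vr i : i <= s -> v != r i by move=> hi; apply/vneq/rZ.
have theta := no_theta e_sym e_irr forestL ol vL.
have thetaP := theta p r s _ pL rL vp vr rP pI rI va vr0 pe re pn rn ieq vrn rpn.
(* As [l] is odd, reversing [p] changes the parity of every position, so an attachment of the wrong
   parity on [p] has the right one on [p']. *)
pose p' i := p (l - i).
have thetaP' j : j <= l -> e (r s) (p' j) -> odd j = odd s.+1 ->
    j < l \/ (forall i, i <= l -> e (r s) (p' i) -> i = j) -> False.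
  apply: (theta p' r s) => //.
  - by move=> i hi; apply: pL; rewrite leq_subr.
  - by move=> i hi; apply: vp; rewrite leq_subr.
  - by move=> i i' hi hi'; apply: rP; rewrite ?leq_subr.
  - move=> i i' hi hi' /pI; rewrite !leq_subr => /(_ isT isT).
    by move: hi hi'; clear; lia.
  - by rewrite /p' subn0.
  - move=> i hi; rewrite /p' e_sym.
    have -> : l - i = (l - i.+1).+1 by move: hi; clear; lia.
    by apply: pe; move: hi; clear; lia.
  - move=> i i' hi hi' /pn; rewrite !leq_subr => /(_ isT isT).
    by move: hi hi'; clear; lia.
  - move=> i hi /ieq; rewrite leq_subr => /(_ isT).
    by move: hi; clear; lia.
  - by move=> i i' hi hi'; apply: rpn => //; rewrite leq_subr.
have ends j : j <= l -> e (r s) (p j) -> j = 0 \/ j = l.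
  move=> jl ej; have [->|j0'] := eqVneq j 0; first by left.
  have [->|jl'] := eqVneq j l; first by right.
  exfalso; have [oj|oj] := eqVneq (odd j) (odd s.+1).
    by apply: (thetaP j) => //; left; rewrite ltn_neqAle jl'.
  apply: (thetaP' (l - j)); rewrite ?leq_subr //.
  - by rewrite /p' subKn.
  - by rewrite oddB // ol; move: oj; case: (odd j); case: (odd s.+1).
  - by left; move: j0' jl; clear; lia.
(* Otherwise the nonadjacent ends of [p] would have the common neighbours [v] and [r s]. *)
have both : e (r s) (p 0) -> e (r s) (p l) -> False.
  move=> h0 hl; apply: (@CN (p 0) (p l) v (r s)); rewrite ?pL ?rL ?vr //.
  - by rewrite e_sym.
  - by rewrite e_sym.
  - by rewrite e_sym.
  - by rewrite e_sym.
have jl0 : j0 <= l by rewrite -ltnS.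
have [j00|j0l] := ends j0 jl0 rj0.
  rewrite j00 in rj0; have [oj|oj] := eqVneq (odd 0) (odd s.+1).
    by apply: (thetaP 0) => //; left; apply: ltnW.
  apply: (thetaP' l) => //; first by rewrite /p' subnn.
    by rewrite ol; move: oj => /=; case: (odd s).
  right=> i hi E; have [E0|E0] := ends _ (leq_subr _ _) E.
    by move: E0 hi; clear; lia.
  by case: (both rj0); rewrite /p' E0 in E.
rewrite j0l in rj0; have [oj|oj] := eqVneq (odd l) (odd s.+1).
  apply: (thetaP l) => //; right=> i hi E; have [E0|//] := ends _ hi E.
  by rewrite E0 in E; case: (both E rj0).
apply: (thetaP' 0) => //; first by rewrite /p' subn0.
  by move: oj; rewrite ol /=; case: (odd s).
by left; apply: ltnW.
Qed.

End GallaiBlocks.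

(** * Blocks *)

Section Connectivity.

Variables (T : finType) (e : rel T).
Hypothesis e_sym : symmetric e.
Hypothesis e_irr : irreflexive e.
Implicit Types X Y Z B C : {set T}.

Definition closedb Z C := (C \subset Z) && [forall x in C, forall y in Z, e x y ==> (y \in C)].

Lemma closedP Z C : reflect (closed_in e Z C) (closedb Z C).
Proof.
apply: (iffP andP) => -[CZ hC]; split=> //.
  move=> x y xC yZ exy; move/forall_inP: hC => /(_ x xC) /forall_inP /(_ y yZ) /implyP.
  exact.
by apply/forall_inP => x xC; apply/forall_inP => y yZ; apply/implyP; apply: hC.
Qed.

Definition connb Z := [forall C, (closedb Z C && (C != set0)) ==> (C == Z)].

Lemma connP Z : reflect (conn e Z) (connb Z).
Proof.
apply: (iffP forallP) => [h C /closedP cC C0|h C].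
  by have := h C; rewrite cC C0 => /eqP.
by apply/implyP => /andP[/closedP cC C0]; apply/eqP; apply: h.
Qed.

Lemma closed_compl Z C : closed_in e Z C -> closed_in e Z (Z :\: C).
Proof.
move=> [CZ hC]; split; first exact: subsetDl.
move=> x y /setDP[xZ xC] yZ exy; rewrite inE yZ andbT; apply: contraNN xC => yC.
by apply: (hC y) => //; rewrite e_sym.
Qed.

Lemma closed_sub Z Y C : closed_in e Z C -> Y \subset Z -> closed_in e Y (C :&: Y).
Proof.
move=> [CZ hC] YZ; split; first exact: subsetIr.
move=> x y /setIP[xC _] yY exy; rewrite inE yY andbT; apply: (hC x) => //.
exact: (subsetP YZ).
Qed.

Lemma conn_meet Y Z C : conn e Y -> Y \subset Z -> closed_in e Z C ->
  forall x, x \in Y -> x \in C -> Y \subset C.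
Proof.
move=> cY YZ cC x xY xC; have := cY _ (closed_sub cC YZ) => <-; first exact: subsetIl.
by apply/set0Pn; exists x; rewrite inE xC.
Qed.

Lemma conn_setU Y Z x : conn e Y -> conn e Z -> x \in Y -> x \in Z -> conn e (Y :|: Z).
Proof.
move=> cY cZ xY xZ C cC /set0Pn[u uC]; have [CYZ _] := cC.
apply/eqP; rewrite eqEsubset CYZ subUset /=.
have /setUP[uY|uZ] := subsetP CYZ u uC.
  have YC := conn_meet cY (subsetUl _ _) cC uY uC; rewrite YC.
  exact: (conn_meet cZ (subsetUr _ _) cC xZ (subsetP YC x xY)).
have ZC := conn_meet cZ (subsetUr _ _) cC uZ uC; rewrite ZC andbT.
exact: (conn_meet cY (subsetUl _ _) cC xY (subsetP ZC x xZ)).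
Qed.

Lemma clique_conn Q : clique e Q -> conn e Q.
Proof.
move=> cQ C [CQ hC] /set0Pn[x xC]; apply/eqP; rewrite eqEsubset CQ /=.
apply/subsetP => y yQ; have [<-//|xy] := eqVneq x y.
by apply: (hC x) => //; apply: cQ => //; apply: (subsetP CQ).
Qed.

(** A closed part of [X :\: B] that misses [y] is closed in [X] already; one that contains [y]
    becomes closed in [X] once [X :&: B] is added. *)
Lemma conn_setD X B y : conn e X -> 
  (forall u w, u \in B -> w \in X :\: B -> e u w -> w = y) -> conn e (X :\: B).
Proof.
move=> cX hB C [CX hC] C0.
have CsX : C \subset X := subset_trans CX (subsetDl _ _).
have [yC|yC] := boolP (y \in C).
  have cl : closed_in e X (C :|: (X :&: B)).
    split; first by rewrite subUset CsX subsetIl.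
    move=> u w uCB wX euw; rewrite !inE wX /=; have [//|wB] := boolP (w \in B).
      by rewrite orbT.
    rewrite orbF; case/setUP: uCB => [uC|/setIP[_ uB]].
      by apply: (hC u) => //; rewrite inE wB.
    by rewrite (hB u w) // inE wB.
  have /setP E : C :|: (X :&: B) = X.
    by apply: cX => //; apply: contraNneq C0 => /eqP; rewrite setU_eq0 => /andP[].
  apply/eqP; rewrite eqEsubset CX /=; apply/subsetP => w /setDP[wX wB].
  by have := E w; rewrite !inE wX (negPf wB) orbF.
have cl : closed_in e X C.
  split=> // u w uC wX euw; have [wB|wB] := boolP (w \in B); last first.
    by apply: (hC u) => //; rewrite inE wB.
  have uXB := subsetP CX u uC.
  by rewrite e_sym in euw; rewrite -(hB w u wB uXB euw) uC in yC.
have E := cX C cl C0; apply/eqP; rewrite eqEsubset CX /= E.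
exact: subsetDl.
Qed.

(** This describes an end block [x |: C] with cut vertex [x]; the root [rho] may be [x] itself. *)
Definition end_sep X rho x C : Prop :=
  [/\ x \in X, C \subset X :\ x, C != set0, C != X :\ x & closed_in e (X :\ x) C] /\
  [/\ rho \notin C, conn e C & forall y, y \in x |: C -> conn e ((x |: C) :\ y)].

(** Among all cut vertices with a side avoiding [rho], a side of minimal size gives an end block: a
    separation inside it would cut off a smaller side. *)
Lemma block_or_end_sep X rho : conn e X ->
  (forall y, y \in X -> conn e (X :\ y)) \/ exists x C, end_sep X rho x C.
Proof.
move=> cX.
pose sepb (xC : T * {set T}) := [&& xC.1 \in X, closedb (X :\ xC.1) xC.2, xC.2 != set0,
   xC.2 != X :\ xC.1 & rho \notin xC.2].
have [/existsP[s0 s0P]|/existsPn none] := boolP [exists s, sepb s]; last first.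
  left=> y yX; apply/connP/forallP => C; apply/implyP => /andP[cC C0].
  apply/negPn/negP => CX.
  (* Of the two sides of a separation at least one avoids [rho]. *)
  have [rC|rC] := boolP (rho \in C); last by have := none (y, C); rewrite /sepb /= yX cC C0 CX rC.
  have := none (y, (X :\ y) :\: C); rewrite /sepb /= yX !inE rC /=.
  move/closedP: cC => cC; have /closedP -> := closed_compl cC; rewrite andbT /=.
  have [CX' _] := cC.
  have -> : (X :\ y) :\: C != set0.
    by apply: contraNneq CX => E; rewrite eqEsubset CX' -setD_eq0 E eqxx.
  have -> // : (X :\ y) :\: C != X :\ y.
  have [z zC] := set0Pn _ C0; apply/eqP => /setP/(_ z); rewrite inE zC.
  by rewrite (subsetP CX' z zC).
right; case: (arg_minnP (fun s : T * {set T} => #|s.2|) s0P) => -[x C] /=.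
case/and5P=> /= xX /closedP cC C0 CX rC min.
have [CX' hC] := cC.
have sub y C' : y \in X -> closed_in e (X :\ y) C' -> C' != set0 -> C' != X :\ y ->
    C' \proper C -> False.
  move=> yX cC' C'0 C'X C'C.
  have rC' : rho \notin C' by apply: contraNN rC; apply: (subsetP (proper_sub C'C)).
  have := min (y, C'); rewrite /sepb /= yX C'0 C'X rC' !andbT.
  by move/closedP: cC' => -> /(_ isT); rewrite leqNgt (proper_card C'C).
have xC : x \notin C by apply/negP => /(subsetP CX'); rewrite !inE eqxx.
have cCC : conn e C.
  move=> C' [C'C hC'] C'0; apply/eqP/negPn/negP => ne.
  apply: (sub x C') => //.
  - split; first exact: subset_trans C'C CX'.
    move=> u w uC' wX euw; apply: (hC' u) => //.
    by apply: (hC u) => //; apply: (subsetP C'C).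
  - by apply: contraNneq CX => E; rewrite eqEsubset CX' -E.
  - by rewrite properEneq ne.
exists x, C; split=> //; split=> // y; rewrite !inE => /orP[/eqP ->|yC].
  by rewrite setU1K.
have xy : x != y by apply: contraNneq xC => ->.
have yX : y \in X by have := subsetP CX' y yC; rewrite inE => /andP[].
(* After the deletion of [y], a part that misses [x] would be a smaller side cut off by [y]. *)
have side C' : closed_in e ((x |: C) :\ y) C' -> C' != set0 -> x \notin C' -> False.
  move=> [C'B hC'] C'0 xC'.
  have C'C : C' \subset C.
    apply/subsetP => u uC'; have := subsetP C'B u uC'; rewrite !inE => /andP[_].
    by case: eqP => // E; rewrite -E uC' in xC'.
  apply: (sub y C') => //.
  - split.
      apply/subsetP => u uC'; have := subsetP C'B u uC'; rewrite !inE => /andP[-> _] /=.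
      by have := subsetP CX' u (subsetP C'C u uC'); rewrite inE => /andP[].
    move=> u w uC'; rewrite !inE => /andP[wy wX] euw; apply: (hC' u) => //.
    rewrite !inE wy /=; have [//|wx] := eqVneq w x.
    by apply: (hC u) => //; [apply: (subsetP C'C)|rewrite !inE wx].
  - by apply: contraNneq xC' => ->; rewrite !inE xy.
  - apply/properP; split=> //; exists y => //; apply/negP => /(subsetP C'B).
    by rewrite !inE eqxx.
move=> C' cC' C'0; apply/eqP/negPn/negP => ne.
have [xC'|xC'] := boolP (x \in C'); last exact: (side C').
apply: (side _ (closed_compl cC')).
- by apply: contraNneq ne => E; rewrite eqEsubset (proj1 cC') -setD_eq0 E eqxx /=.
- by rewrite inE xC'.
Qed.

End Connectivity.

Section Blocks.

Variables (T : finType) (e : rel T) (L : {set T}).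
Hypothesis e_sym : symmetric e.
Hypothesis e_irr : irreflexive e.
Hypothesis forestL : forall A X : {set T}, X != set0 -> X \subset L -> A \subset X ->
  independent e A -> \sum_(a in A) deg e X a < #|X|.

Lemma deg_setD1 (X : {set T}) v : deg e (X :\ v) v = deg e X v.
Proof.
apply: eq_card => u; rewrite !inE; have [->|] := eqVneq u v; last by [].
by rewrite e_irr !andbF.
Qed.

Lemma block_clique_or_cycle (B : {set T}) : B \subset L -> conn e B ->
  (forall y, y \in B -> conn e (B :\ y)) ->
  clique e B \/ forall v, v \in B -> deg e B v <= 2.
Proof.
move=> BL cB cBy.
have [/existsP[v /andP[vB dv]]|/existsPn none] :=
  boolP [exists v, (v \in B) && (2 < deg e B v)]; last first.
  by right=> v vB; have := none v; rewrite vB -leqNgt.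
left; pose N := [set u in B | e v u].
have V w a b : w \in B -> a \in B -> b \in B -> e w a -> e w b -> a != b -> ~~ e a b ->
    deg e B w <= 2.
  move=> wB aB bB wa wb ab nab; rewrite -deg_setD1.
  have ne x : e w x -> x != w by apply: contraTneq => ->; rewrite e_irr.
  apply: (deg_conn_nonadjacent e_sym e_irr forestL _ (cBy w wB) _ _ _ _ wa wb ab nab).
  - exact: subset_trans (subsetDl _ _) BL.
  - exact: (subsetP BL).
  - by rewrite !inE eqxx.
  - by rewrite !inE aB ne.
  - by rewrite !inE bB ne.
have cN : clique e N.
  move=> a b; rewrite !inE => /andP[aB va] /andP[bB vb] ab.
  by apply/negPn/negP => nab; have := V v a b vB aB bB va vb ab nab; rewrite leqNgt dv.
have cK : clique e (v |: N).
  move=> a b /setU1P[->|aN] /setU1P[->|bN]; rewrite ?eqxx // => ab; last exact: cN.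
    by move: bN; rewrite inE => /andP[].
  by rewrite e_sym; move: aN; rewrite inE => /andP[].
suff <- : v |: N = B by [].
apply: cB; last by apply/set0Pn; exists v; rewrite setU11.
split; first by rewrite subUset sub1set vB; apply/subsetP => u; rewrite inE => /andP[].
move=> u z uK zB uz; apply/negPn/negP => zK.
have vz : v != z by apply: contraNneq zK => <-; rewrite setU11.
have nvz : ~~ e v z by apply: contraNN zK => E; rewrite !inE zB E orbT.
have uv : u != v by apply: contraNneq nvz => <-.
have uB : u \in B by case/setU1P: uK => [->//|]; rewrite inE => /andP[].
have euv : e u v by apply: cK => //; rewrite setU11.
have := V u v z uB vB zB euv uz vz nvz; rewrite leqNgt => /negP; apply.
apply: leq_trans dv _; rewrite [deg e B v](_ : _ = #|(v |: N) :\ u|); last first.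
  have vN : v \notin N by rewrite inE e_irr andbF.
  by have := cardsD1 u (v |: N); rewrite uK cardsU1 vN => -[].
apply: subset_leq_card; apply/subsetP => w /setD1P[wu wK]; rewrite inE.
rewrite cK // 1?eq_sym // andbT; case/setU1P: wK => [->//|]; rewrite inE => /andP[] //.
Qed.

End Blocks.

(** * Edge counts *)

Section EdgeSums.

Variables (T : finType) (e : rel T).
Hypothesis e_sym : symmetric e.

(** This is twice the number of edges of [G[X]]; keeping the factor two avoids halving. *)
Definition degsum (X : {set T}) : nat := \sum_(v in X) deg e X v.

Definition crossing (X Y : {set T}) : nat := \sum_(v in X) deg e Y v.

Lemma crossingC (X Y : {set T}) : crossing X Y = crossing Y X.
Proof.
rewrite /crossing !sum_deg_card.
have inj : injective (fun p : T * T => (p.2, p.1)) by move=> [a b] [c d] [-> ->].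
rewrite -(card_imset _ inj); apply: eq_card => -[a b]; rewrite !inE /=.
apply/imsetP/and3P => [[[c d]]|[aY bX eab]].
  by rewrite inE /= => /and3P[cX dY ecd] [-> ->]; split=> //; rewrite e_sym.
by exists (b, a); rewrite // inE /= aY bX e_sym eab.
Qed.

Lemma sum_setU (X Y : {set T}) (F : T -> nat) : [disjoint X & Y] ->
  \sum_(v in X :|: Y) F v = \sum_(v in X) F v + \sum_(v in Y) F v.
Proof. by move=> XY; rewrite -bigU //; apply: eq_bigl => v; rewrite !inE. Qed.

Lemma degsum_setU (X Y : {set T}) : [disjoint X & Y] ->
  degsum (X :|: Y) = degsum X + degsum Y + (crossing X Y).*2.
Proof.
move=> XY; have H (Z : {set T}) : \sum_(v in Z) deg e (X :|: Y) v = crossing Z X + crossing Z Y.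
  by rewrite -big_split; apply: eq_bigr => v _; rewrite deg_setU.
have crU Z : crossing (X :|: Y) Z = crossing X Z + crossing Y Z by exact: sum_setU.
have -> : degsum (X :|: Y) = crossing (X :|: Y) X + crossing (X :|: Y) Y by exact: H.
rewrite !crU (crossingC Y X) -/(degsum X) -/(degsum Y).
have -> : crossing X X = degsum X by [].
have -> : crossing Y Y = degsum Y by [].
lia.
Qed.

Lemma crossing1 (X : {set T}) x : crossing [set x] X = deg e X x.
Proof. by rewrite /crossing big_set1. Qed.

End EdgeSums.

(** * The potential *)

Section Potential.

Variables (T : finType) (e : rel T) (L : {set T}) (k : nat).
Hypothesis e_sym : symmetric e.
Hypothesis e_irr : irreflexive e.
Hypothesis forestL : forall A X : {set T}, X != set0 -> X \subset L -> A \subset X ->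
  independent e A -> \sum_(a in A) deg e X a < #|X|.
Hypothesis degL : forall v, v \in L -> deg e L v < k.
Hypothesis no_Kk : forall X : {set T}, clique e X -> #|X| <> k.
Hypothesis k_gt5 : 5 < k.

Local Notation K := (k%:R : rat)%R.

(** [ph_big] gives a component [K_(k-1)] the potential [h], [ph_medium] gives a component [K_(k-2)]
    the potential [2 + h], and [ph_cycle] is the condition under which a triangle can be removed as
    an end block. *)
Variables p h : rat.
Hypothesis ph_big : ((K - 1) * (1 - p) = h * (K - 3))%R.
Hypothesis ph_medium : ((K - 2) * p = 2 + h)%R.
Hypothesis h_gt0 : (0 < h)%R.
Hypothesis h_lt1 : (h < 1)%R.
Hypothesis p_gt0 : (0 < p)%R.
Hypothesis p_lt1 : (p < 1)%R.
Hypothesis ph_cycle : (0 <= 2 * (K - 6) + 2 * p - h)%R.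

Implicit Types X Y Q B C I D : {set T}.

Definition bigclique Q : bool :=
  (#|Q| == k.-1) && [forall x in Q, forall y in Q, (x != y) ==> e x y].

Lemma bigcliqueP Q : reflect (#|Q| = k.-1 /\ clique e Q) (bigclique Q).
Proof.
apply: (iffP andP) => -[/eqP Qk hQ]; split=> //.
  move=> x y xQ yQ xy; move/forall_inP: hQ => /(_ x xQ) /forall_inP /(_ y yQ) /implyP.
  exact.
by apply/forall_inP => x xQ; apply/forall_inP => y yQ; apply/implyP; apply: hQ.
Qed.

Definition bigs X := [set x | [exists Q : {set T}, [&& bigclique Q, Q \subset X & x \in Q]]].

Lemma WP X x : reflect (exists Q, [/\ bigclique Q, Q \subset X & x \in Q]) (x \in bigs X).
Proof.
rewrite inE; apply: (iffP existsP) => -[Q]; first by move/and3P; exists Q.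
by move=> [? ? ?]; exists Q; apply/and3P.
Qed.

Lemma W_sub X : bigs X \subset X.
Proof. by apply/subsetP => x /WP[Q [_ QX xQ]]; apply: (subsetP QX). Qed.

Lemma W_mono X Y : X \subset Y -> bigs X \subset bigs Y.
Proof.
move=> XY; apply/subsetP => x /WP[Q [bQ QX xQ]]; apply/WP; exists Q; split=> //.
exact: subset_trans QX XY.
Qed.

Lemma deg_clique B x : clique e B -> x \in B -> deg e B x = #|B|.-1.
Proof.
move=> cB xB; rewrite (cardsD1 x) xB /=; apply: eq_card => y; rewrite !inE.
have [->|yx] /= := eqVneq y x; first by rewrite e_irr andbF.
by have [yB|//] := boolP (y \in B); rewrite cB // eq_sym.
Qed.

Lemma degsum_clique B : clique e B -> degsum e B = #|B| * #|B|.-1.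
Proof.
move=> cB; rewrite -sum_nat_const; apply: eq_bigr => x xB; exact: deg_clique.
Qed.

Lemma deg_eq0 C w : (forall u, u \in C -> ~~ e w u) -> deg e C w = 0.
Proof.
move=> h0; apply/eqP; rewrite cards_eq0 -subset0; apply/subsetP => u.
by rewrite inE => /andP[/h0/negPf ->].
Qed.

Lemma clique_card_lt B : B \subset L -> clique e B -> #|B| <= k.-1.
Proof.
move=> BL cB; have [->|/set0Pn[x xB]] := eqVneq B set0; first by rewrite cards0.
have := degL (subsetP BL x xB); have := deg_le e x BL; rewrite (deg_clique cB xB).
have := no_Kk cB; clear; lia.
Qed.

Lemma bigclique_deg Q X x : bigclique Q -> Q \subset X -> x \in Q -> k - 2 <= deg e X x.
Proof.
move=> /bigcliqueP[Qk cQ] QX xQ; have := deg_le e x QX; rewrite (deg_clique cQ xQ) Qk.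
by clear; lia.
Qed.

Lemma link_mono X Y x y : X \subset Y -> link e X x y -> link e Y x y.
Proof.
move=> XY; apply: connect_sub => u w /= /and3P[euw uX wX]; apply: connect1 => /=.
by rewrite euw !(subsetP XY).
Qed.

Lemma link1 X x y : x \in X -> y \in X -> e x y -> link e X x y.
Proof. by move=> xX yX exy; apply: connect1; rewrite /= exy xX. Qed.

Lemma link_clique X Q x y : clique e Q -> Q \subset X -> x \in Q -> y \in Q -> link e X x y.
Proof.
move=> cQ QX xQ yQ; have [->|xy] := eqVneq x y; first exact: connect0.
by apply: link1; [apply: (subsetP QX)|apply: (subsetP QX)|apply: cQ].
Qed.

(** For [X \subset L] a vertex of a [K_(k-1)] has at most one neighbour in [X] outside the clique;
    the ends have none. For [X = L] they are the clique vertices with a neighbour in [H]. *)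
Definition ends X : {set T} := [set w in bigs X | deg e X w == k - 2].

Definition full_independent X I : Prop :=
  [/\ I \subset X, independent e I & forall v, v \in I -> deg e X v = k.-1].

(** [D] meets every component of the graph on [bigs X], that is every unit, so [#|D|] bounds the
    number of units. *)
Definition hits X D : Prop :=
  D \subset bigs X /\ forall w, w \in bigs X -> exists2 d, d \in D & link e (bigs X) d w.

Lemma in_ends X w : (w \in ends X) = (w \in bigs X) && (deg e X w == k - 2).
Proof. by rewrite /ends in_set. Qed.

(** A lower bound on [Phi] bounds the edges of [G[X]] from above. The vertices of [I] and the ends
    allow additional edges; the term in [D] later cancels the number of units in the bound for edges
    between units and vertices of degree [k]. *)
Definition Phi X I D : rat :=
  ((K - 3 + p) * #|X|%:R - (degsum e X)%:R + 2 * #|I|%:R + h * (#|ends X|%:R - #|D|%:R))%R.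

Definition good X (c : rat) : Prop :=
  exists I D, [/\ full_independent X I, hits X D & (c <= Phi X I D)%R].

Lemma degX X v : X \subset L -> v \in X -> deg e X v <= k.-1.
Proof.
by move=> XL vX; have := degL (subsetP XL v vX); have := deg_le e v XL; clear; lia.
Qed.

Lemma setDU_disjoint X C : C \subset X -> X :\: C :|: C = X /\ [disjoint X :\: C & C].
Proof.
move=> CX; split; first by rewrite setUC -{1}(setIidPr CX) setID.
by rewrite disjoints_subset; apply/subsetP => u; rewrite !inE => /andP[].
Qed.

Section EndBlock.

Variables (X C : {set T}) (x : T).
Hypotheses (XL : X \subset L) (cX : conn e X).
Hypotheses (xX : x \in X) (CX : C \subset X :\ x) (C0 : C != set0) (CX' : C != X :\ x).
Hypothesis clC : closed_in e (X :\ x) C.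

(** Below, [keep] refers to deleting [C] alone, [drop] to deleting the whole block with its cut
    vertex. *)
Let B := x |: C.

Lemma end_xC : x \notin C.
Proof. by apply/negP => /(subsetP CX); rewrite !inE eqxx. Qed.

Lemma end_CX : C \subset X.
Proof. exact: subset_trans CX (subsetDl _ _). Qed.

Lemma end_BX : B \subset X.
Proof. by rewrite subUset sub1set xX end_CX. Qed.

Lemma end_nbr u w : u \in C -> w \in X -> e u w -> w \in B.
Proof.
move=> uC wX euw; rewrite in_setU1; have [//|wx] := eqVneq w x.
by apply: (clC.2 u) => //; rewrite !inE wx.
Qed.

Lemma end_deg_rest w : w \in X :\: B -> deg e C w = 0.
Proof.
move=> /setDP[wX wB]; apply: deg_eq0 => u uC; apply: contraNN wB => ewu.
by apply: (end_nbr uC) => //; rewrite e_sym.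
Qed.

Lemma end_root_deg : 0 < deg e C x.
Proof.
rewrite lt0n; apply/negP => /eqP d0; have: x \in C; last by rewrite (negPf end_xC).
rewrite (cX _ C0) //; split=> [|u w uC wX euw]; first exact: end_CX.
have := end_nbr uC wX euw; rewrite in_setU1 => /orP[/eqP wx|//].
move/eqP: d0; rewrite cards_eq0 => /eqP/setP/(_ u).
by rewrite !inE uC e_sym -wx euw.
Qed.

Lemma end_rest_neq0 : X :\: B != set0.
Proof.
apply: contraNneq CX' => E; rewrite eqEsubset CX /=.
apply/subsetP => u /setD1P[ux uX]; have : u \in B by move/eqP: E; rewrite setD_eq0 => /subsetP; apply.
by rewrite in_setU1 (negPf ux).
Qed.

Lemma end_outer_deg : 0 < deg e (X :\: B) x.
Proof.
rewrite lt0n; apply/negP => /eqP d0; have [z /setDP[zX /negP zB]] := set0Pn _ end_rest_neq0.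
apply: zB; have -> : B = X; last by [].
apply: cX; last by apply/set0Pn; exists x; rewrite in_setU1 eqxx.
split; first exact: end_BX.
move=> u w /setU1P[->|uC] wX euw; last exact: end_nbr uC wX euw.
apply/negPn/negP => wB; move/eqP: d0; rewrite cards_eq0 => /eqP/setP/(_ w).
by rewrite inE in_setD wB wX euw inE.
Qed.

Lemma end_conn_keep : conn e (X :\: C).
Proof.
apply: (conn_setD e_sym cX (y := x)) => u w uC /setDP[wX wC] euw.
by have := end_nbr uC wX euw; rewrite in_setU1 (negPf wC) orbF => /eqP.
Qed.

Lemma end_keepU : X :\: C = x |: (X :\: B).
Proof.
apply/setP => u; rewrite !inE; have [->|ux] /= := eqVneq u x; last by [].
by rewrite (negPf end_xC) xX.
Qed.

Lemma end_degsum_keep : degsum e X = degsum e (X :\: C) + degsum e B.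
Proof.
have [EX dX] := setDU_disjoint end_CX.
have dB : [disjoint [set x] & C] by rewrite disjoints1 end_xC.
rewrite -{1}EX (degsum_setU e_sym dX) /B (degsum_setU e_sym dB) crossing1.
have -> : degsum e [set x] = 0.
  rewrite /degsum big_set1 deg_eq0 // => u /set1P ->; by rewrite e_irr.
have -> : crossing e (X :\: C) C = deg e C x.
  rewrite end_keepU /crossing big_setU1 /=; last by rewrite !inE eqxx.
  rewrite big1 ?addn0 // => w; exact: end_deg_rest.
by clear; lia.
Qed.

Lemma end_degsum_drop : degsum e X = degsum e (X :\: B) + degsum e B + (deg e (X :\: B) x).*2.
Proof.
rewrite end_degsum_keep end_keepU.
have d1 : [disjoint [set x] & X :\: B] by rewrite disjoints1 !inE eqxx.
rewrite (degsum_setU e_sym d1) crossing1.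
have -> : degsum e [set x] = 0.
  rewrite /degsum big_set1 deg_eq0 // => u /set1P ->; by rewrite e_irr.
by clear; lia.
Qed.

Lemma end_deg v : deg e X v = deg e (X :\: C) v + deg e C v.
Proof. by have [EX dX] := setDU_disjoint end_CX; rewrite -{1}EX deg_setU. Qed.

Lemma end_deg_drop v : deg e X v = deg e (X :\: B) v + deg e B v.
Proof. by have [EX dX] := setDU_disjoint end_BX; rewrite -{1}EX deg_setU. Qed.

Lemma end_card_keep : #|X| = #|X :\: C| + #|C|.
Proof. by rewrite cardsD (setIidPr end_CX) subnK // subset_leq_card ?end_CX. Qed.

Lemma end_card_drop : #|X| = #|X :\: B| + #|B|.
Proof. by rewrite cardsD (setIidPr end_BX) subnK // subset_leq_card ?end_BX. Qed.

Lemma end_card_block : #|B| = #|C|.+1.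
Proof. by rewrite cardsU1 end_xC. Qed.

Lemma end_bigclique Q u : bigclique Q -> Q \subset X -> u \in Q -> u \in C -> Q \subset B.
Proof.
move=> /bigcliqueP[_ cQ] QX uQ uC; apply/subsetP => w wQ.
have [<-|uw] := eqVneq u w; first by rewrite in_setU1 uC orbT.
by apply: (end_nbr uC (subsetP QX w wQ)); apply: cQ.
Qed.

(** Outside [C] only the degree of [x] changes, so at most [x] stops being an end, at cost [h]. No
    vertex of [I] is affected, since the degree of [x] in the rest is below [k - 1]. *)
Lemma step_small (c : rat) :
  (forall Q, bigclique Q -> ~~ (Q \subset B)) ->
  ((degsum e B)%:R + h <= (K - 3 + p) * #|C|%:R)%R ->
  good (X :\: C) c -> good X c.
Proof.
move=> noQ hB [I [D [[IX iI fI] [DW hD] cP]]]; set X' := X :\: C in IX fI DW hD cP *.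
have X'X : X' \subset X by apply: subsetDl.
have WE : bigs X = bigs X'.
  apply/eqP; rewrite eqEsubset (W_mono X'X) andbT; apply/subsetP => w /WP[Q [bQ QX wQ]].
  apply/WP; exists Q; split=> //; apply/subsetP => u uQ; rewrite inE (subsetP QX) // andbT.
  by apply/negP => uC; have := noQ Q bQ; rewrite (end_bigclique bQ QX uQ uC).
have degE v : v \in X' -> v != x -> deg e X v = deg e X' v.
  move=> vX' vx; rewrite end_deg end_deg_rest ?addn0 //.
  by move: vX'; rewrite /X' end_keepU in_setU1 (negPf vx).
have degx : deg e X' x < deg e X x by rewrite end_deg -/X'; have := end_root_deg; clear; lia.
exists I, D; split.
- split=> //; first exact: subset_trans IX X'X.
  move=> v vI; rewrite degE ?fI ?(subsetP IX) //; apply/eqP => vx.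
  by have := degX XL xX; have := fI v vI; rewrite vx; move: degx k_gt5; clear; lia.
- by split=> [|w]; rewrite WE //; apply: hD.
apply: le_trans cP _; rewrite /Phi end_degsum_keep end_card_keep -/X'.
have qle : #|ends X'| <= #|ends X|.+1.
  rewrite (cardsD1 x); apply: (@leq_trans (1 + #|ends X|)); last by clear; lia.
  apply: leq_add; first by case: (_ \in _).
  apply: subset_leq_card; apply/subsetP => w; rewrite !inE -/(bigs _) => /and3P[wx wW dw].
  have wX' : w \in X' by apply: (subsetP (W_sub _)); rewrite inE.
  have := WE; move/setP/(_ w); rewrite inE => ->; rewrite inE wW degE //.
have : (#|ends X'|%:R <= #|ends X|%:R + 1 :> rat)%R by rewrite natr1 ler_nat.
rewrite -subr_ge0 => /(mulr_ge0 (ltW h_gt0)); move: hB; rewrite !natrD.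
by lra.
Qed.

Lemma end_deg_inner u : u \in C -> deg e X u = deg e B u.
Proof.
move=> uC; rewrite end_deg_drop (@deg_eq0 (X :\: B)) // => w /setDP[wX wB].
by apply: contraNN wB; apply: end_nbr uC wX.
Qed.

Lemma end_deg_outer v : v \in X :\: B -> deg e X v = deg e (X :\: B) v + e x v.
Proof.
move=> vX; rewrite end_deg_drop; congr (_ + _).
have dB : [disjoint [set x] & C] by rewrite disjoints1 end_xC.
rewrite /B (deg_setU _ _ dB) end_deg_rest // addn0 e_sym.
case: (boolP (e v x)) => evx; last by rewrite deg_eq0 // => u /set1P ->.
rewrite /deg (_ : [set _ in _ | _] = [set x]) ?cards1 //.
by apply/setP => u; rewrite !inE; case: eqP => // ->.
Qed.

(** A [K_(k-1)] through [x] that avoids [C] would need [k - 2 > 2] neighbours of [x] outside the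
    block. *)
Lemma end_block_meets Q u : deg e (X :\: B) x <= 2 ->
  bigclique Q -> Q \subset X -> u \in Q -> u \in B -> Q \subset B.
Proof.
move=> d2 bQ QX uQ uB; have [/exists_inP[w wQ wC]|/exists_inPn none] := boolP [exists w in Q, w \in C].
  exact: end_bigclique bQ QX wQ wC.
have /bigcliqueP[Qk cQ] := bQ.
have ux : u = x by case/setU1P: uB => // uC; have := none u uQ; rewrite uC.
have := subset_leq_card (_ : Q :\ x \subset [set w in X :\: B | e x w]).
rewrite -/(deg _ _ _) => H; exfalso.
have : #|Q :\ x| <= 2.
  apply: leq_trans (H _) d2; apply/subsetP => w /setD1P[wx wQ].
  rewrite inE in_setD in_setU1 (negPf wx) (none w wQ) (subsetP QX) //=.
  by rewrite -ux; apply: cQ => //; rewrite ux eq_sym.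
by have := cardsD1 x Q; rewrite -ux uQ Qk; move: k_gt5; clear; lia.
Qed.

(** A vertex with [k - 1] neighbours in the rest has no room for an edge to [x]. *)
Lemma end_full I : full_independent (X :\: B) I ->
  full_independent X I /\ forall v, v \in I -> ~~ e x v.
Proof.
move=> [IX iI fI].
have nx v : v \in I -> ~~ e x v.
  move=> vI; have vX := subsetP IX v vI; apply/negP => exv.
  have := end_deg_outer vX; rewrite exv fI //.
  have := degX XL (subsetP (subsetDl _ _) v vX); by move: k_gt5; clear; lia.
split=> //; split=> //; first exact: subset_trans IX (subsetDl _ _).
by move=> v vI; rewrite end_deg_outer ?(subsetP IX) // fI // (negPf (nx v vI)) addn0.
Qed.

Lemma end_full_root I : deg e X x = k.-1 -> full_independent (X :\: B) I ->
  full_independent X (x |: I) /\ #|x |: I| = #|I|.+1.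
Proof.
move=> dx fI; have [IX _ _] := fI; have [[IX' iI fI'] nx] := end_full fI.
split; last first.
  by rewrite cardsU1 (_ : x \notin I) //; apply/negP => /(subsetP IX); rewrite !inE eqxx.
split.
- by rewrite subUset sub1set xX.
- move=> u v /setU1P[->|uI] /setU1P[->|vI]; rewrite ?e_irr //; first exact: nx.
    by rewrite e_sym; apply: nx.
  exact: iI.
- by move=> v /setU1P[->//|]; apply: fI'.
Qed.

Lemma end_W : deg e (X :\: B) x <= 2 -> ~~ bigclique B -> #|B| <= k.-1 -> bigs X = bigs (X :\: B).
Proof.
move=> d2 nB Bk; apply/eqP; rewrite eqEsubset (W_mono (subsetDl X B)) andbT.
apply/subsetP => w /WP[Q [bQ QX wQ]]; apply/WP; exists Q; split=> //.
apply/subsetP => u uQ; rewrite in_setD (subsetP QX) // andbT; apply/negP => uB.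
have QB := end_block_meets d2 bQ QX uQ uB; have /bigcliqueP[Qk cQ] := bQ.
have E : Q = B by apply/eqP; rewrite eqEcard QB Qk.
by rewrite -E bQ in nB.
Qed.

Lemma end_ends (S : {set T}) : (forall w, w \in bigs (X :\: B) -> e x w -> w \in S) ->
  ends (X :\: B) :\: S \subset ends X.
Proof.
move=> hS; apply/subsetP => w /setDP[]; rewrite !in_ends => /andP[wW dw] wS.
have wX := subsetP (W_sub _) w wW.
rewrite (subsetP (W_mono (subsetDl X B))) //= end_deg_outer //.
by rewrite (negPf (contraNN (hS w wW) wS)) addn0.
Qed.

Lemma card_ends_drop (S : {set T}) : (forall w, w \in bigs (X :\: B) -> e x w -> w \in S) ->
  #|ends (X :\: B)| <= #|ends X| + #|S|.
Proof.
move=> hS; have := subset_leq_card (end_ends hS).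
have := cardsID S (ends (X :\: B)); have := subset_leq_card (subsetIr (ends (X :\: B)) S).
by clear; lia.
Qed.

Lemma hits_eq D Y : bigs X = bigs Y -> hits Y D -> hits X D.
Proof. by move=> E [DW hD]; split; rewrite E. Qed.

Lemma medium_sums : clique e B -> #|B| = k - 2 ->
  [/\ (#|X|%:R = #|X :\: B|%:R + (K - 2))%R &
   ((degsum e X)%:R = (degsum e (X :\: B))%:R + (K - 2) * (K - 3)
      + 2 * (deg e (X :\: B) x)%:R :> rat)%R].
Proof.
move=> cB Bk; have k2 : 2 <= k by move: k_gt5; clear; lia.
have k3 : 3 <= k by move: k_gt5; clear; lia.
split; first by rewrite end_card_drop natrD Bk natrB.
rewrite end_degsum_drop (degsum_clique cB) Bk !natrD natrM natrB //.
have -> : (k - 2).-1 = k - 3 by clear; lia.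
by rewrite natrB // -mul2n natrM.
Qed.

Lemma medium_not_big : #|B| = k - 2 -> ~~ bigclique B /\ #|B| <= k.-1.
Proof. by move=> Bk; split; [apply/negP => /bigcliqueP[]|]; move: Bk k_gt5; clear; lia. Qed.

(** The block contributes [(K - 2) p - 2 = h], just enough for the only outer neighbour of [x] to
    stop being an end. *)
Lemma step_medium1 (c : rat) : clique e B -> #|B| = k - 2 ->
  deg e (X :\: B) x = 1 -> good (X :\: B) c -> good X c.
Proof.
move=> cB Bk d1 [I [D [fI hD cP]]]; have [nB Bk'] := medium_not_big Bk.
exists I, D; split; [exact: (end_full fI).1| |].
  by apply: hits_eq hD; apply: end_W => //; rewrite d1.
apply: le_trans cP _; rewrite /Phi; have [-> ->] := medium_sums cB Bk.
have := @card_ends_drop [set w in X :\: B | e x w].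
rewrite -/(deg _ _ _) d1 => H; have {H} : #|ends (X :\: B)| <= #|ends X| + 1.
  by apply: H => w wW exw; rewrite inE (subsetP (W_sub _) w wW).
rewrite -(ler_nat rat) natrD -subr_ge0 => /(mulr_ge0 (ltW h_gt0)).
by move: ph_medium; lra.
Qed.

(** With two outer neighbours [x] has full degree and joins [I], so the block contributes
    [(K - 2) p - 4 + 2 = h] before the ends in [S] are subtracted. *)
Lemma step_medium2 (S : {set T}) (c : rat) : clique e B -> #|B| = k - 2 ->
  deg e (X :\: B) x = 2 -> (forall w, w \in bigs (X :\: B) -> e x w -> w \in S) ->
  good (X :\: B) c -> good X (c + h - h * #|S|%:R)%R.
Proof.
move=> cB Bk d2 hS [I [D [fI hD cP]]]; have [nB Bk'] := medium_not_big Bk.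
have xB : x \in B by rewrite in_setU1 eqxx.
have dx : deg e X x = k.-1 by rewrite end_deg_drop d2 (deg_clique cB xB) Bk; move: k_gt5; clear; lia.
have [fI' cI] := end_full_root dx fI.
exists (x |: I), D; split=> //.
  by apply: hits_eq hD; apply: end_W => //; rewrite d2.
rewrite /Phi cI; have [-> ->] := medium_sums cB Bk.
have := card_ends_drop hS; rewrite -(ler_nat rat) natrD d2 -natr1 -subr_ge0.
move=> /(mulr_ge0 (ltW h_gt0)); move: cP ph_medium; rewrite /Phi; lra.
Qed.

(** The cut vertex joins [I], which pays for its one outer edge, to [y]. The set [C] supplies
    [k - 2] new ends, and one [h] is lost: either [y] lies in a [K_(k-1)] and may stop being an end,
    or the block is a unit of its own and [x] is added to [D]. By [ph_big] this balances. *)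
Lemma step_big (c : rat) : bigclique B -> good (X :\: B) c -> good X c.
Proof.
move=> bB [I [D [fI [DW hD] cP]]]; have /bigcliqueP[Bk cB] := bB.
have xB : x \in B by rewrite in_setU1 eqxx.
have d1 : deg e (X :\: B) x = 1.
  have := degX XL xX; rewrite end_deg_drop (deg_clique cB xB) Bk; have := end_outer_deg; by move: k_gt5; clear; lia.
have dx : deg e X x = k.-1 by rewrite end_deg_drop d1 (deg_clique cB xB) Bk; move: k_gt5; clear; lia.
have [fI' cI] := end_full_root dx fI.
have BW : B \subset bigs X.
  by apply/subsetP => w wB; apply/WP; exists B; split=> //; exact: end_BX.
have W1 : bigs (X :\: B) \subset bigs X by apply: W_mono; apply: subsetDl.
have WE w : w \in bigs X -> w \in B \/ w \in bigs (X :\: B).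
  move=> /WP[Q [bQ QX wQ]]; have [/exists_inP[u uQ uB]|/exists_inPn none] := boolP [exists u in Q, u \in B].
    by left; apply: (subsetP (end_block_meets _ bQ QX uQ uB)); rewrite ?d1.
  right; apply/WP; exists Q; split=> //; apply/subsetP => u uQ.
  by rewrite in_setD (subsetP QX) // none.
have CE : C \subset ends X.
  apply/subsetP => u uC; have uB : u \in B by rewrite in_setU1 uC orbT.
  rewrite in_ends (subsetP BW) // end_deg_inner // (deg_clique cB uB) Bk; apply/eqP; clear; lia.
have [y [yX exy yu]] : exists y, [/\ y \in X :\: B, e x y & forall w, w \in X :\: B -> e x w -> w = y].
  have /cards1P[y yE] : #|[set w in X :\: B | e x w]| == 1 by apply/eqP.
  exists y; have : y \in [set y] by rewrite inE.
  rewrite -yE inE => /andP[yX exy]; split=> // w wX exw.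
  have : w \in [set w in X :\: B | e x w] by rewrite inE wX exw.
  by rewrite yE => /set1P.
pose S := if y \in bigs (X :\: B) then [set y] else set0.
have hS w : w \in bigs (X :\: B) -> e x w -> w \in S.
  move=> wW exw; have wy := yu w (subsetP (W_sub _) w wW) exw.
  by rewrite /S -wy wW inE.
have qle : #|ends (X :\: B)| + #|C| <= #|ends X| + #|S|.
  have E1 := subset_leq_card (end_ends hS).
  have E2 := cardsID S (ends (X :\: B)).
  have E3 := subset_leq_card (subsetIr (ends (X :\: B)) S).
  have : #|C| + #|ends (X :\: B) :\: S| <= #|ends X|.
    rewrite -cardsUI [X in _ + X](_ : _ = 0) ?addn0.
      by apply: subset_leq_card; rewrite subUset CE end_ends.
    apply/eqP; rewrite cards_eq0 -subset0; apply/subsetP => u /setIP[uC /setDP[]].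
    rewrite in_ends => /andP[uW _] _; have := subsetP (W_sub _) u uW.
    by rewrite in_setD in_setU1 uC orbT.
  by move: E1 E2 E3; clear; lia.
have Ck : #|C| = k - 2 by have := end_card_block; rewrite Bk; move: k_gt5; clear; lia.
pose D' := if y \in bigs (X :\: B) then D else x |: D.
have cD : #|D'| + #|S| <= #|D| + 1.
  rewrite /D' /S; case: ifP => _; rewrite ?cards1 // cards0 addn0 cardsU1; case: (_ \notin _); by clear; lia.
exists (x |: I), D'; split=> //.
  split.
    rewrite /D'; case: ifP => _; first exact: subset_trans DW W1.
    by rewrite subUset sub1set (subsetP BW) // (subset_trans DW W1).
  move=> w /WE[wB|wW]; last first.
    have [d dD lk] := hD w wW; exists d; last exact: link_mono W1 lk.
    by rewrite /D'; case: ifP => // _; rewrite in_setU1 dD orbT.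
  have lxw : link e (bigs X) x w by apply: link_clique cB BW xB wB.
  rewrite /D'; case: ifP => yW; last by exists x; rewrite ?setU11.
  have [d dD lk] := hD y yW; exists d => //; apply: connect_trans (link_mono W1 lk) _.
  apply: connect_trans lxw; apply: link1; [exact: (subsetP W1)|exact: (subsetP BW)|].
  by rewrite e_sym.
apply: le_trans cP _; rewrite /Phi cI.
rewrite end_card_drop end_degsum_drop (degsum_clique cB) Bk d1 -[(#|I|.+1)%:R%R]natr1 !natrD natrM.
have k0 : 2 <= k by apply: leq_trans k_gt5.
have -> : ((k.-1)%:R = K - 1 :> rat)%R by rewrite -subn1 natrB // ltnW.
have -> : ((k.-1.-1)%:R = K - 2 :> rat)%R by rewrite -!subn1 -subnDA natrB.
have : #|ends (X :\: B)| + (k - 2) + #|D'| <= #|ends X| + #|D| + 1.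
  by move: qle cD; rewrite Ck; clear; lia.
rewrite -(ler_nat rat) !natrD natrB // -subr_ge0 => /(mulr_ge0 (ltW h_gt0)).
rewrite (_ : (1.*2)%:R = 2 :> rat)%R; last by []; move: ph_big; lra.
Qed.

(** The clique of [y] and the vertex [x] exhaust the degree of [y]. As [x] has a second outer
    neighbour, [X :\ y] stays connected, and the nonadjacent neighbours [x] and [b] of [y]
    contradict [deg_conn_nonadjacent]. *)
Lemma end_outer_not_W y : conn e B -> deg e (X :\: B) x = 2 -> conn e (X :\: B) ->
  y \in bigs (X :\: B) -> e x y -> False.
Proof.
move=> cB d2 c1 yW exy; have yX1 := subsetP (W_sub _) y yW.
have /WP[Q [bQ QX1 yQ]] := yW; have /bigcliqueP[Qk cQ] := bQ.
have [yX yB] := setDP yX1.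
have QX : Q \subset X := subset_trans QX1 (subsetDl _ _).
have xQ : x \notin Q by apply/negP => /(subsetP QX1); rewrite !inE eqxx.
have cQy : #|Q :\ y| = k - 2 by have := cardsD1 y Q; rewrite yQ Qk; clear; lia.
have nbr u : u \in X -> e y u -> u \in x |: (Q :\ y).
  move=> uX eyu; suff -> : x |: (Q :\ y) = [set w in X | e y w] by rewrite inE uX.
  apply/eqP; rewrite eqEcard; apply/andP; split.
    apply/subsetP => w /setU1P[->|/setD1P[wy wQ]]; rewrite inE; first by rewrite xX e_sym.
    by rewrite (subsetP QX) // cQ // eq_sym.
  apply: leq_trans (degX XL yX) _; rewrite cardsU1 cQy.
  have -> : x \notin Q :\ y by rewrite inE negb_and xQ orbT.
  by move: k_gt5; clear; lia.
have [y' [y'X exy' yy']] : exists y', [/\ y' \in X :\: B, e x y' & y' != y].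
  have : 0 < #|[set w in X :\: B | e x w] :\ y|.
    have := cardsD1 y [set w in X :\: B | e x w].
    rewrite -/(deg _ _ _) d2 (_ : y \in _) ?inE ?exy ?yX1 //; first by clear; lia.
    by move: yX1; rewrite !inE => ->.
  case/card_gt0P => y' /setD1P[h1]; rewrite inE => /andP[h2 h3]; by exists y'.
have yZ : y \notin X :\ y by rewrite !inE eqxx.
have BZ : B \subset X :\ y.
  apply/subsetP => u uB; rewrite in_setD1 (subsetP end_BX) // andbT.
  by apply: contraNneq yB => <-.
(* All neighbours of [y] other than [x] lie in its clique, so a part without vertices of the clique
   could be joined to [y] only through [x]. *)
have side C' : closed_in e (X :\ y) C' -> C' != set0 -> (forall u, u \in Q -> u \notin C') -> False.
  move=> cC' C'0 QC'; have [C'Z hC'] := cC'.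
  have C'X : C' \subset X := subset_trans C'Z (subsetDl _ _).
  have nby u : u \in C' -> e y u -> u = x.
    move=> uC' eyu; have := nbr u (subsetP C'X u uC') eyu.
    rewrite in_setU1 => /orP[/eqP//|/setD1P[_ uQ]]; by have := QC' u uQ; rewrite uC'.
  have [xC'|xC'] := boolP (x \in C').
    have y'Z : y' \in X :\ y by rewrite in_setD1 yy'; case/setDP: y'X.
    have y'C : y' \in C' := hC' x y' xC' y'Z exy'.
    have E : C' :&: (X :\: B) = X :\: B.
      apply: c1; last by apply/set0Pn; exists y'; rewrite inE y'C.
      split; first exact: subsetIr.
      move=> u w /setIP[uC' uX1] wX1 euw; rewrite inE wX1 andbT.
      have [wy|wy] := eqVneq w y.
        rewrite wy e_sym in euw; have ux := nby u uC' euw.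
        by move: uX1; rewrite ux !inE eqxx.
      by apply: (hC' u) => //; rewrite in_setD1 wy; case/setDP: wX1.
    by move: yX1; rewrite -E => /setIP[/(subsetP C'Z)]; rewrite (negPf yZ).
  have E : C' = X.
    apply: cX => //; split=> // u w uC' wX euw; have [wy|wy] := eqVneq w y.
      by rewrite wy e_sym in euw; have ux := nby u uC' euw; rewrite ux (negPf xC') in uC'.
    by apply: (hC' u) => //; rewrite in_setD1 wy.
  by move: yX; rewrite -E => /(subsetP C'Z); rewrite (negPf yZ).
have QyZ : Q :\ y \subset X :\ y by apply: setSD.
have cZ : conn e (X :\ y).
  move=> C' cC' C'0; apply/eqP/negPn/negP => ne.
  have [/exists_inP[u uQ uC']|/exists_inPn none] := boolP [exists u in Q, u \in C']; last first.
    exact: (side C').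
  apply: (side _ (closed_compl e_sym cC')).
    apply: contraNneq ne => E; by rewrite eqEsubset (proj1 cC') -setD_eq0 E eqxx.
  have uy : u \in Q :\ y.
    by rewrite in_setD1 uQ andbT; apply: contraNneq yZ => E; rewrite -{1}E; exact: (subsetP (proj1 cC') u uC').
  have cQy' : clique e (Q :\ y) by move=> a b /setD1P[_ aQ] /setD1P[_ bQ']; apply: cQ.
  have QC := conn_meet (clique_conn cQy') QyZ cC' uy uC'.
  move=> w wQ; rewrite inE negb_and negbK; have [->|wy] := eqVneq w y; first by rewrite yZ orbT.
  by rewrite (subsetP QC) // in_setD1 wy.
have [b bQ' nxb] : exists2 b, b \in Q :\ y & ~~ e x b.
  apply/exists_inP; rewrite -negb_forall_in; apply/negP => /forall_inP H.
  have : Q \subset [set w in X :\: B | e x w].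
    apply/subsetP => w wQ; rewrite inE (subsetP QX1) //=; have [->//|wy] := eqVneq w y.
    by apply: H; rewrite in_setD1 wy.
  by move/subset_leq_card; rewrite -/(deg _ _ _) d2 Qk; move: k_gt5; clear; lia.
have xZ : x \in X :\ y by rewrite (subsetP BZ) // in_setU1 eqxx.
have [b_y b_Q] := setD1P bQ'.
have xb : x != b by apply: contraNneq xQ => ->.
have eyx : e y x by rewrite e_sym.
have eyb : e y b by apply: cQ; rewrite // eq_sym.
have ZL : X :\ y \subset L := subset_trans (subsetDl _ _) XL.
have := deg_conn_nonadjacent e_sym e_irr forestL ZL cZ (subsetP XL y yX) yZ xZ
  (subsetP QyZ b bQ') eyx eyb xb nxb.
have := subset_leq_card (_ : Q :\ y \subset [set u in X :\ y | e y u]).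
rewrite -/(deg _ _ _) cQy => H1 H2; have := leq_trans (H1 _) H2.
have -> : Q :\ y \subset [set u in X :\ y | e y u].
  apply/subsetP => w wQ; rewrite inE (subsetP QyZ) //=; case/setD1P: wQ => wy wQ.
  by apply: cQ => //; rewrite eq_sym.
by move=> /(_ isT); move: k_gt5; clear; lia.
Qed.

(** Since [X] is connected, every nonempty closed part of the rest contains one of the two outer
    neighbours of [x], so there are at most two components. *)
Lemma end_outer_split : deg e (X :\: B) x = 2 -> ~ conn e (X :\: B) ->
  exists C1 C2, [/\ X :\: B = C1 :|: C2, [disjoint C1 & C2],
    forall u w, u \in C1 -> w \in C2 -> ~~ e u w, conn e C1 /\ conn e C2 & C1 != set0 /\ C2 != set0].
Proof.
move=> d2 nc.
have touch C' : closed_in e (X :\: B) C' -> C' != set0 -> exists2 u, u \in C' & e x u.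
  move=> [C'X hC'] C'0; have [/exists_inP//|/exists_inPn H] := boolP [exists u in C', e x u].
  have E : C' = X.
    apply: cX => //; split; first exact: subset_trans C'X (subsetDl _ _).
    move=> u w uC' wX euw; have [wB|wB] := boolP (w \in B); last first.
      by apply: (hC' u) => //; rewrite in_setD wB.
    have uX1 := subsetP C'X u uC'; case/setU1P: wB => [wx|wC].
      by have := H u uC'; rewrite -wx (e_sym w) euw.
    have [uX uB] := setDP uX1; rewrite e_sym in euw.
    by rewrite (end_nbr wC uX euw) in uB.
  by move: xX; rewrite -E => /(subsetP C'X); rewrite !inE eqxx.
have three C1 C2 C3 : closed_in e (X :\: B) C1 -> closed_in e (X :\: B) C2 ->
    closed_in e (X :\: B) C3 -> C1 != set0 -> C2 != set0 -> C3 != set0 ->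
    [disjoint C1 & C2] -> [disjoint C1 & C3] -> [disjoint C2 & C3] -> False.
  move=> c1 c2 c3 n1 n2 n3 d12 d13 d23.
  have [u1 u1C e1] := touch _ c1 n1; have [u2 u2C e2] := touch _ c2 n2.
  have [u3 u3C e3] := touch _ c3 n3.
  have u12 : u1 != u2 by apply/eqP => E; rewrite E (disjointFl d12) in u1C.
  have u13 : u1 != u3 by apply/eqP => E; rewrite E (disjointFl d13) in u1C.
  have u23 : u2 != u3 by apply/eqP => E; rewrite E (disjointFl d23) in u2C.
  have := subset_leq_card (_ : [set u1; u2; u3] \subset [set w in X :\: B | e x w]).
  rewrite -/(deg _ _ _) d2 => H; have := H _; rewrite (_ : #|[set u1; u2; u3]| = 3); last first.
    by rewrite setUC cardsU1 !inE cards2 u12 negb_or (eq_sym u3) u13 (eq_sym u3) u23.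
  have -> : [set u1; u2; u3] \subset [set w in X :\: B | e x w].
    apply/subsetP => w; rewrite in_setU in_set2 in_set1 inE => /orP[/orP[]|] /eqP ->.
    - by rewrite e1 (subsetP c1.1).
    - by rewrite e2 (subsetP c2.1).
    - by rewrite e3 (subsetP c3.1).
  by move/(_ isT).
have /forallPn[C1] : ~~ connb e (X :\: B) by apply/negP => /connP.
rewrite negb_imply => /andP[/andP[/closedP cC1 C10] C1X].
have cC2 := closed_compl e_sym cC1; set C2 := (X :\: B) :\: C1 in cC2.
have [C1s hC1] := cC1.
have C20 : C2 != set0.
  by apply: contraNneq C1X => E; rewrite eqEsubset C1s -setD_eq0 -/C2 E eqxx.
have trans D1 D2 : closed_in e (X :\: B) D1 -> closed_in e D1 D2 -> closed_in e (X :\: B) D2.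
  move=> [s1 h1] [s2 h2]; split; first exact: subset_trans s2 s1.
  move=> u w uD wX euw; apply: (h2 u) => //; apply: (h1 u) => //; exact: (subsetP s2).
have cn D1 D2 : closed_in e (X :\: B) D1 -> closed_in e (X :\: B) D2 -> D2 != set0 ->
    [disjoint D1 & D2] -> conn e D1.
  move=> cD1 cD2 D20 dis C' cC' C'0; apply/eqP/negPn/negP => ne.
  have dD : D1 :\: C' != set0.
    by apply: contraNneq ne => E; rewrite eqEsubset (proj1 cC') -setD_eq0 E eqxx.
  apply: (three _ _ _ (trans _ _ cD1 cC') (trans _ _ cD1 (closed_compl e_sym cC')) cD2) => //.
  - by rewrite disjoint_subset; apply/subsetP => u uC; rewrite !inE uC.
  - exact: disjointWl (proj1 cC') dis.
  - exact: disjointWl (subsetDl _ _) dis.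
have dis : [disjoint C1 & C2] by rewrite disjoint_subset; apply/subsetP => u uC; rewrite !inE uC.
exists C1, C2; split=> //.
- by rewrite -{1}(setID (X :\: B) C1) (setIidPr C1s).
- move=> u w uC wC; apply/negP => euw; have wX := subsetP cC2.1 w wC.
  by have := hC1 u w uC wX euw; rewrite (disjointFl dis wC).
- split; first exact: (cn C1 C2).
  by apply: (cn C2 C1) => //; rewrite disjoint_sym.
Qed.

End EndBlock.

Lemma good_le X (c c' : rat) : (c' <= c)%R -> good X c -> good X c'.
Proof. by move=> cc [I [D [? ? H]]]; exists I, D; split=> //; apply: le_trans H. Qed.

Lemma good_setU X Y (c c' : rat) : [disjoint X & Y] ->
  (forall u w, u \in X -> w \in Y -> ~~ e u w) ->
  good X c -> good Y c' -> good (X :|: Y) (c + c')%R.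
Proof.
move=> dXY nXY [I [D [[IX iI fI] [DW hD] cI]]] [J [E [[JY iJ fJ] [EW hE] cJ]]].
have nYX u w : u \in Y -> w \in X -> ~~ e u w by move=> uY wX; rewrite e_sym nXY.
have dX u : u \in X -> deg e (X :|: Y) u = deg e X u.
  by move=> uX; rewrite deg_setU // (@deg_eq0 Y) ?addn0 // => w; apply: nXY.
have dY u : u \in Y -> deg e (X :|: Y) u = deg e Y u.
  by move=> uY; rewrite deg_setU // (@deg_eq0 X) // => w; apply: nYX.
have WE : bigs (X :|: Y) = bigs X :|: bigs Y.
  apply/eqP; rewrite eqEsubset; apply/andP; split; last first.
    by rewrite subUset (W_mono (subsetUl X Y)) (W_mono (subsetUr X Y)).
  apply/subsetP => w /WP[Q [bQ QXY wQ]]; have /bigcliqueP[_ cQ] := bQ.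
  have cl : closed_in e (X :|: Y) X.
    split=> [|u v uX /setUP[//|vY] euv]; first exact: subsetUl.
    by have := nXY u v uX vY; rewrite euv.
  have [/exists_inP[u uQ uX]|/exists_inPn none] := boolP [exists u in Q, u \in X].
    have QX := conn_meet (clique_conn cQ) QXY cl uQ uX.
    by rewrite in_setU; apply/orP; left; apply/WP; exists Q.
  rewrite in_setU; apply/orP; right; apply/WP; exists Q; split=> //.
  by apply/subsetP => u uQ; have := subsetP QXY u uQ; rewrite in_setU (negPf (none u uQ)).
have dWW : [disjoint bigs X & bigs Y].
  exact: disjointWl (W_sub X) (disjointWr (W_sub Y) dXY).
have endsE : ends (X :|: Y) = ends X :|: ends Y.
  apply/setP => w; rewrite in_setU !in_ends WE in_setU.
  have [wX|wX] := boolP (w \in bigs X).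
    by rewrite (disjointFr dWW wX) /= orbF dX // (subsetP (W_sub X)).
  have [wY|wY] //= := boolP (w \in bigs Y); by rewrite dY // (subsetP (W_sub Y)).
exists (I :|: J), (D :|: E); split.
- split; first exact: setUSS.
    move=> u w /setUP[uI|uJ] /setUP[wI|wJ]; first exact: iI.
    + by apply: nXY; [apply: (subsetP IX)|apply: (subsetP JY)].
    + by apply: nYX; [apply: (subsetP JY)|apply: (subsetP IX)].
    + exact: iJ.
  move=> v /setUP[vI|vJ]; first by rewrite dX ?fI ?(subsetP IX).
  by rewrite dY ?fJ ?(subsetP JY).
- rewrite /hits WE; split; first exact: setUSS.
  move=> w /setUP[wX|wY].
    have [d dD lk] := hD w wX; exists d; first by rewrite in_setU dD.
    exact: link_mono (subsetUl _ _) lk.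
  have [d dD lk] := hE w wY; exists d; first by rewrite in_setU dD orbT.
  exact: link_mono (subsetUr _ _) lk.
have cardD (A A' F F' : {set T}) : A \subset F -> A' \subset F' -> [disjoint F & F'] ->
    #|A :|: A'| = #|A| + #|A'|.
  move=> AF AF' dF; rewrite cardsU [X in _ - X](_ : _ = 0) ?subn0 //.
  apply/eqP; rewrite cards_eq0 setI_eq0; exact: disjointWl AF (disjointWr AF' dF).
have endsW Z : ends Z \subset bigs Z by apply/subsetP => w; rewrite in_ends => /andP[].
rewrite /Phi endsE (cardD _ _ _ _ (endsW X) (endsW Y) dWW) (cardD _ _ _ _ DW EW dWW).
rewrite (cardD _ _ _ _ IX JY dXY) (cardD _ _ _ _ (subxx X) (subxx Y) dXY).
rewrite (degsum_setU e_sym dXY) (_ : crossing e X Y = 0) ?addn0; last first.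
  by rewrite /crossing big1 // => u uX; apply: deg_eq0 => w; apply: nXY.
by rewrite !natrD; move: cI cJ; rewrite /Phi; lra.
Qed.

Lemma good_noW X : (forall Q, bigclique Q -> Q \subset X -> False) ->
  (2 + h <= (K - 3 + p) * #|X|%:R - (degsum e X)%:R)%R -> good X (2 + h)%R.
Proof.
move=> nQ hX; have W0 : bigs X = set0.
  by apply/eqP; rewrite -subset0; apply/subsetP => w /WP[Q [bQ QX _]]; case: (nQ Q bQ QX).
exists set0, set0; split.
- by split; [exact: sub0set|exact: independent0|move=> v; rewrite in_set0].
- by split; [exact: sub0set|move=> w; rewrite W0 in_set0].
rewrite /Phi !cards0; have := mulr_ge0 (ltW h_gt0) (ler0n rat #|ends X|).
by move: hX; lra.
Qed.

Lemma base_clique X : X != set0 -> clique e X -> #|X| <= k - 2 -> good X (2 + h)%R.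
Proof.
move=> X0 cX Xk; apply: good_noW.
  move=> Q /bigcliqueP[Qk _] /subset_leq_card; rewrite Qk.
  by move: Xk k_gt5; clear; lia.
have k2 : 2 <= k by move: k_gt5; clear; lia.
have b1 : 1 <= #|X| by rewrite card_gt0.
rewrite (degsum_clique cX) natrM -subn1 natrB //.
have {}Xk : (#|X|%:R <= K - 2)%R by rewrite -natrB // ler_nat.
have {}b1 : (1 <= #|X|%:R :> rat)%R by rewrite ler1n.
(* The surplus over [2 + h = (K - 2) p] is the product of these two factors. *)
have h1 : (0 <= K - 2 - #|X|%:R)%R by lra.
have h2 : (0 <= #|X|%:R - p)%R by move: p_lt1; lra.
have := mulr_ge0 h1 h2; move: ph_medium; lra.
Qed.

Lemma cycle_no_bigclique X Q : (forall v, v \in X -> deg e X v <= 2) ->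
  bigclique Q -> Q \subset X -> False.
Proof.
move=> d2 bQ QX; have /bigcliqueP[Qk _] := bQ.
have /card_gt0P[x xQ] : 0 < #|Q| by rewrite Qk; move: k_gt5; clear; lia.
have := bigclique_deg bQ QX xQ; have := d2 x (subsetP QX x xQ).
by move: k_gt5; clear; lia.
Qed.

Lemma degsum_cycle X : (forall v, v \in X -> deg e X v <= 2) -> degsum e X <= 2 * #|X|.
Proof. by move=> d2; rewrite mulnC -sum_nat_const; apply: leq_sum. Qed.

Lemma base_cycle X : 2 < #|X| -> (forall v, v \in X -> deg e X v <= 2) -> good X (2 + h)%R.
Proof.
move=> X3 d2; apply: good_noW => [Q|]; first exact: cycle_no_bigclique.
have := degsum_cycle d2; rewrite -(ler_nat rat) natrM => dX.
have {}X3 : (3 <= #|X|%:R :> rat)%R by rewrite (ler_nat rat 3).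
have k6 : (6 <= K)%R by rewrite (ler_nat rat 6).
have h1 : (0 <= #|X|%:R - 3 :> rat)%R by lra.
have h2 : (0 <= K - 5 + p)%R by move: p_gt0 k6; lra.
have := mulr_ge0 h1 h2; move: dX h_lt1 p_gt0; lra.
Qed.

Lemma base_bigclique X : bigclique X -> good X h.
Proof.
move=> bX; have /bigcliqueP[Xk cX] := bX.
have /card_gt0P[x xX] : 0 < #|X| by rewrite Xk; move: k_gt5; clear; lia.
have WX : bigs X = X.
  by apply/eqP; rewrite eqEsubset W_sub; apply/subsetP => w wX; apply/WP; exists X.
have eX : ends X = X.
  apply/setP => w; rewrite in_ends WX; have [wX|//] := boolP (w \in X).
  by rewrite (deg_clique cX wX) Xk -subn1 -subn1 -subnDA eqxx.
exists set0, [set x]; split.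
- by split; [exact: sub0set|exact: independent0|move=> v; rewrite in_set0].
- rewrite /hits WX sub1set; split=> // w wX; exists x; first by rewrite in_set1.
  exact: link_clique cX (subxx X) xX wX.
rewrite /Phi eX cards0 cards1 (degsum_clique cX) natrM Xk.
have -> : ((k.-1)%:R = K - 1 :> rat)%R by rewrite -subn1 natrB //; move: k_gt5; clear; lia.
have -> : ((k.-1.-1)%:R = K - 2 :> rat)%R.
  by rewrite -!subn1 -subnDA natrB //; move: k_gt5; clear; lia.
by move: ph_big; lra.
Qed.

Lemma small_conn_clique X : conn e X -> #|X| <= 2 -> clique e X.
Proof.
move=> cX X2 x y xX yX xy; apply/negPn/negP => nxy.
have XE : [set x; y] = X.
  by apply/eqP; rewrite eqEcard subUset !sub1set xX yX cards2 xy.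
have E : [set x] = X.
  apply: cX; last by apply/set0Pn; exists x; rewrite in_set1.
  split; first by rewrite sub1set.
  move=> u w /set1P->; rewrite -XE in_set2 => /orP[/eqP ->|/eqP ->]; first by rewrite in_set1.
  by rewrite (negPf nxy).
by move: yX; rewrite -E in_set1 eq_sym (negPf xy).
Qed.

Lemma block_cases B : B \subset L -> conn e B -> (forall y, y \in B -> conn e (B :\ y)) ->
  [\/ bigclique B, clique e B /\ #|B| = k - 2, clique e B /\ #|B| <= k - 3 |
      2 < #|B| /\ forall v, v \in B -> deg e B v <= 2].
Proof.
move=> BL cB cBy.
have cl : clique e B -> [\/ bigclique B, clique e B /\ #|B| = k - 2,
   clique e B /\ #|B| <= k - 3 | 2 < #|B| /\ forall v, v \in B -> deg e B v <= 2].
  move=> clB; have Bk := clique_card_lt BL clB.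
  have [B1|B1] := eqVneq #|B| k.-1; first by constructor 1; apply/bigcliqueP.
  have [B2|B2] := eqVneq #|B| (k - 2); first by constructor 2.
  by constructor 3; split=> //; move: Bk B1 B2; clear; lia.
have [|d2] := block_clique_or_cycle e_sym e_irr forestL BL cB cBy; first exact: cl.
have [B3|B3] : #|B| <= 2 \/ 2 < #|B| by case: (leqP #|B| 2); [left|right].
  by apply: cl; apply: small_conn_clique.
by constructor 4.
Qed.

Lemma small_block_bound (b : nat) (s : rat) : 1 < b ->
  (b <= k - 3 /\ (s = b%:R * (b%:R - 1))%R) \/ (2 < b /\ (s <= 2 * b%:R)%R) ->
  (s + h <= (K - 3 + p) * (b%:R - 1))%R.
Proof.
move=> b1 [[bk ->]|[b3 sb]].
  (* For [b = k - 3] the claim is [h <= (K - 4) p], which by [ph_medium] means [p <= 1]. *)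
  have [bE|bk'] := eqVneq b (k - 3).
    have -> : (b%:R = K - 3 :> rat)%R by rewrite bE natrB //; move: k_gt5; clear; lia.
    by move: ph_medium p_lt1; lra.
  have bk4 : (b%:R <= K - 4)%R.
    by rewrite -natrB ?ler_nat; move: bk bk' k_gt5; clear; lia.
  have {}b1 : (2 <= b%:R :> rat)%R by rewrite (ler_nat rat 2).
  have h1 : (0 <= b%:R - 2 :> rat)%R by lra.
  have h2 : (0 <= K - 4 - b%:R)%R by lra.
  have h3 : (0 <= b%:R - 1 :> rat)%R by lra.
  have := mulr_ge0 h1 h2; have := mulr_ge0 h3 (ltW p_gt0); move: h_lt1; lra.
(* For a cycle the slack grows with [b], and the case [b = 3] is [ph_cycle]. *)
have {}b3 : (3 <= b%:R :> rat)%R by rewrite (ler_nat rat 3).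
have k6 : (6 <= K)%R by rewrite (ler_nat rat 6).
have h1 : (0 <= b%:R - 3 :> rat)%R by lra.
have h2 : (0 <= K - 5 + p)%R by move: p_gt0 k6; lra.
have := mulr_ge0 h1 h2; move: sb ph_cycle h_lt1; lra.
Qed.

(** Preferring a root that does not separate [X] keeps it from being the cut vertex of an end block
    [K_(k-2)], because such a block has other vertices outside [bigs X] that do not separate. *)
Lemma noncut_vertex X : X != bigs X -> exists rho,
  [/\ rho \in X, rho \notin bigs X &
      conn e (X :\ rho) \/ forall r, r \in X -> r \notin bigs X -> ~ conn e (X :\ r)].
Proof.
move=> XW; have /subsetPn[r0 r0X r0W] : ~~ (X \subset bigs X).
  by apply: contraNN XW => XW; rewrite eqEsubset XW W_sub.
have [/existsP[r /and3P[rX rW /connP cr]]|/existsPn none] :=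
  boolP [exists r, [&& r \in X, r \notin bigs X & connb e (X :\ r)]].
  by exists r; split=> //; left.
exists r0; split=> //; right=> r rX rW /connP cr.
by have := none r; rewrite rX rW cr.
Qed.

(* Induction on [#|X|]: remove an end block, cut off by one vertex from a root
   that is chosen outside [bigs X] when there is one. *)
Theorem potential_bound X : X \subset L -> X != set0 -> conn e X ->
  good X h /\ (X != bigs X -> good X (2 + h)%R).
Proof.
have [n] := ubnP #|X|; elim: n X => // n IH X; rewrite ltnS => Xn XL X0 cX.
have h2h : (h <= 2 + h)%R by move: h_gt0; lra.
have IHX Y : Y \subset X -> Y != X -> Y != set0 -> conn e Y ->
    good Y h /\ (Y != bigs Y -> good Y (2 + h)%R).
  move=> YX nYX Y0 cY; apply: IH => //; last exact: subset_trans YX XL.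
  by apply: leq_trans Xn; apply: proper_card; rewrite properEneq nYX.
have conn_block x C : conn e C -> C != set0 -> conn e X -> x \in X -> C \subset X :\ x ->
    closed_in e (X :\ x) C -> C != X :\ x -> conn e (x |: C).
  move=> cC C0 _ xX CX clC CX'.
  have := end_root_deg cX xX CX C0 clC; case/card_gt0P => c; rewrite inE => /andP[cC' exc].
  have -> : x |: C = [set x; c] :|: C.
    by apply/setP => u; rewrite !inE; case: eqP => //= _; case: eqP => // ->; rewrite cC'.
  apply: (conn_setU (x := c)) => //; last by rewrite !inE eqxx orbT.
  apply: clique_conn => a b; rewrite !in_set2.
  case/orP=> /eqP -> /orP[] /eqP ->; rewrite ?eqxx //; by rewrite e_sym.
(* If [X] is covered by copies of [K_(k-1)], so is every end block, which is then itself such a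
   copy; here only the bound [h] is claimed. *)
have [XW|XW] := eqVneq X (bigs X).
  split; last by move/eqP.
  have [x0 _] := set0Pn _ X0.
  have [cXy|[x [C [[xX CX C0 CX' clC] [_ cC cBy]]]]] := block_or_end_sep e_sym x0 cX.
    have bcX : bigclique X.
      have [y yX] := set0Pn _ X0; have /WP[Q [bQ QX yQ]] : y \in bigs X by rewrite -XW.
      have /bigcliqueP[Qk cQ] := bQ; have := subset_leq_card QX; rewrite Qk => QX'.
      case: (block_cases XL cX cXy) => [//|[_ Xk]|[_ Xk]|[_ d2]].
      - by move: QX' Xk k_gt5; clear; lia.
      - by move: QX' Xk k_gt5; clear; lia.
      - by case: (cycle_no_bigclique d2 bQ QX).
    exact: base_bigclique.
  have BX := end_BX xX CX; have cB := conn_block x C cC C0 cX xX CX clC CX'.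
  have bcB : bigclique (x |: C).
    have [y yC] := set0Pn _ C0; have yX := subsetP (end_CX CX) y yC.
    have /WP[Q [bQ QX yQ]] : y \in bigs X by rewrite -XW.
    have QB := end_bigclique clC bQ QX yQ yC.
    have /bigcliqueP[Qk cQ] := bQ; have := subset_leq_card QB; rewrite Qk => QB'.
    case: (block_cases (subset_trans BX XL) cB cBy) => [//|[_ Xk]|[_ Xk]|[_ d2]].
    - by move: QB' Xk k_gt5; clear; lia.
    - by move: QB' Xk k_gt5; clear; lia.
    - by case: (cycle_no_bigclique d2 bQ QB).
  have R0 := end_rest_neq0 CX CX'.
  apply: (step_big XL cX xX CX CX' clC bcB).
  have /bigcliqueP[Bk cliB] := bcB; have xB : x \in x |: C by rewrite setU11.
  have d1 : deg e (X :\: (x |: C)) x = 1.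
    have := degX XL xX; rewrite (end_deg_drop xX CX) (deg_clique cliB xB) Bk.
    have := end_outer_deg cX xX CX CX' clC; move: k_gt5; clear; lia.
  have /cards1P[y yE] : #|[set w in X :\: (x |: C) | e x w]| == 1 by apply/eqP.
  have cR : conn e (X :\: (x |: C)).
    apply: (conn_setD e_sym cX (y := y)) => u w uB wX euw; apply/set1P; rewrite -yE inE wX /=.
    case/setU1P: uB => [<-//|uC]; case/setDP: wX => wX /negP[].
    exact: (end_nbr clC uC wX euw).
  apply: (IHX _ (subsetDl _ _) _ R0 cR).1; apply/negP => /eqP/setP/(_ x).
  by rewrite in_setD xB xX.
suff gX : good X (2 + h)%R by split=> // ; exact: good_le h2h gX.
have [rho [rX rW rcut]] := noncut_vertex XW.
have [cXy|[x [C [[xX CX C0 CX' clC] [rC cC cBy]]]]] := block_or_end_sep e_sym rho cX.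
  case: (block_cases XL cX cXy) => [bX|[cl Xk]|[cl Xk]|[X3 d2]].
  - by case/negP: rW; apply/WP; exists X.
  - by apply: base_clique => //; rewrite Xk.
  - by apply: base_clique => //; apply: leq_trans Xk _; move: k_gt5; clear; lia.
  - exact: base_cycle.
have BX := end_BX xX CX; have cB := conn_block x C cC C0 cX xX CX clC CX'.
have R0 := end_rest_neq0 CX CX'; have xC := end_xC CX.
have xB : x \in x |: C by rewrite setU11.
have notW Y : Y \subset X -> rho \in Y -> Y != bigs Y.
  move=> YX rY; apply/eqP => E; case/negP: rW; apply: (subsetP (W_mono YX)).
  by rewrite -E.
have cC1 : #|x |: C| = #|C|.+1 by rewrite cardsU1 xC.
have C1 : 0 < #|C| by rewrite card_gt0.
(* Only [C] is deleted; the root survives, so the rest is again not covered by copies of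
   [K_(k-1)]. *)
have small : (#|x |: C| <= k - 3 /\ clique e (x |: C)) \/
    (2 < #|x |: C| /\ forall v, v \in x |: C -> deg e (x |: C) v <= 2) -> good X (2 + h)%R.
  move=> hB; apply: (step_small XL cX xX CX C0 clC).
  - move=> Q bQ; apply/negP => QB; case: hB => [[Bk _]|[_ d2]].
      have /bigcliqueP[Qk _] := bQ; have := subset_leq_card QB; rewrite Qk.
      by move: Bk k_gt5; clear; lia.
    exact: cycle_no_bigclique d2 bQ QB.
  - have -> : (#|C|%:R = #|x |: C|%:R - 1 :> rat)%R by rewrite cC1 -natr1; ring.
    apply: small_block_bound; first by rewrite cC1.
    case: hB => [[Bk cl]|[B3 d2]]; [left|right]; split=> //.
      by rewrite (degsum_clique cl) natrM -subn1 natrB // cC1.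
    by have := degsum_cycle d2; rewrite -(ler_nat rat) natrM.
  - have rXC : rho \in X :\: C by rewrite in_setD rC.
    apply: (IHX _ (subsetDl _ _) _ _ (end_conn_keep cX clC)).2.
    + apply/negP => /eqP/setP E; have [c cC'] := set0Pn _ C0; have := E c.
      by rewrite in_setD cC' (subsetP (end_CX CX) c cC').
    + by apply/set0Pn; exists rho.
    + exact: notW (subsetDl _ _) rXC.
have rest_ne : X :\: (x |: C) != X.
  by apply/negP => /eqP/setP/(_ x); rewrite in_setD xB xX.
have restX : X :\: (x |: C) \subset X by apply: subsetDl.
have rest1 : deg e (X :\: (x |: C)) x = 1 -> conn e (X :\: (x |: C)).
  move=> d1; have /cards1P[y yE] : #|[set w in X :\: (x |: C) | e x w]| == 1 by apply/eqP.
  apply: (conn_setD e_sym cX (y := y)) => u w uB wX euw; apply/set1P; rewrite -yE inE wX /=.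
  case/setU1P: uB => [<-//|uC]; case/setDP: wX => wX /negP[].
  exact: (end_nbr clC uC wX euw).
have odeg := end_outer_deg cX xX CX CX' clC.
case: (block_cases (subset_trans BX XL) cB cBy) => [bB|[cl Bk]|[cl Bk]|cyc].
- have /bigcliqueP[Bk cl] := bB.
  have d1 : deg e (X :\: (x |: C)) x = 1.
    have := degX XL xX; rewrite (end_deg_drop xX CX) (deg_clique cl xB) Bk.
    by move: odeg k_gt5; clear; lia.
  apply: (step_big XL cX xX CX CX' clC bB).
  apply: (IHX _ restX rest_ne R0 (rest1 d1)).2; apply: notW => //.
  rewrite in_setD rX andbT in_setU1 (negPf rC) orbF; apply/eqP => rx.
  by case/negP: rW; rewrite rx; apply/WP; exists (x |: C).
- have [c cC'] := set0Pn _ C0; have cX' := subsetP (end_CX CX) c cC'.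
  have cW : c \notin bigs X.
    apply/negP => /WP[Q [bQ QX cQ]]; have := subset_leq_card (end_bigclique clC bQ QX cQ cC').
    by have /bigcliqueP[-> _] := bQ; rewrite Bk; move: k_gt5; clear; lia.
  have xc : x != c by apply: contraNneq xC => ->.
  (* A vertex of the block other than [x] does not separate [X]. By the choice of the root this
     excludes [rho = x], so the root survives the deletion of the whole block. *)
  have cXc : conn e (X :\ c).
    have -> : X :\ c = ((x |: C) :\ c) :|: (X :\: C).
      apply/setP => u; rewrite !inE; have [->|uc] /= := eqVneq u c; first by rewrite cC'.
      have [->|ux] /= := eqVneq u x; first by rewrite xX.
      by have [uC|uC] //= := boolP (u \in C); rewrite (subsetP (end_CX CX)).
    apply: (conn_setU (x := x)).
    - by apply: cBy; rewrite in_setU1 cC' orbT.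
    - exact: end_conn_keep cX clC.
    - by rewrite in_setD1 xc xB.
    - by rewrite in_setD xC.
  have rx : rho != x.
    apply/eqP => rx; case: rcut => [|cut]; last exact: (cut c).
    rewrite rx => cXx; case/eqP: CX'; exact: (cXx C clC C0).
  have rR : rho \in X :\: (x |: C) by rewrite in_setD rX in_setU1 (negPf rx) rC.
  have d12 : deg e (X :\: (x |: C)) x <= 2.
    have := degX XL xX; rewrite (end_deg_drop xX CX) (deg_clique cl xB) Bk.
    by move: k_gt5; clear; lia.
  have [d1|d1] := eqVneq (deg e (X :\: (x |: C)) x) 1.
    apply: (step_medium1 XL xX CX clC cl Bk d1).
    by apply: (IHX _ restX rest_ne R0 (rest1 d1)).2; apply: notW.
  have d2 : deg e (X :\: (x |: C)) x = 2 by move: d1 d12 odeg; clear; lia.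
  (* If the rest is connected, no outer neighbour of [x] lies in a [K_(k-1)], and no end is lost. *)
  have [/connP cR|/connP ncR] := boolP (connb e (X :\: (x |: C))).
    have : good X (2 + h + h - h * #|@set0 T|%:R)%R.
      apply: (step_medium2 XL xX CX clC cl Bk d2).
        move=> w wW exw; exfalso.
        exact: (end_outer_not_W XL cX xX CX cB d2 cR wW exw).
      by apply: (IHX _ restX rest_ne R0 cR).2; apply: notW.
    by apply: good_le; rewrite cards0 mulr0; move: h_gt0; lra.
  (* The two parts have potential [h] and [2 + h]; the additional [h], with the [h] gained from the
     block, pays for two lost ends. *)
  have [C1' [C2 [E dis nC [c1 c2] [n1 n2]]]] := end_outer_split cX xX clC d2 ncR.
  have C1X : C1' \subset X by apply: subset_trans restX; rewrite E subsetUl.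
  have C2X : C2 \subset X by apply: subset_trans restX; rewrite E subsetUr.
  have C1n : C1' != X.
    by apply/eqP => E1; move: (xX); rewrite -E1 => xC1; have : x \in X :\: (x |: C) by [rewrite E in_setU xC1]; rewrite in_setD xB.
  have C2n : C2 != X.
    by apply/eqP => E1; move: (xX); rewrite -E1 => xC1; have : x \in X :\: (x |: C) by [rewrite E in_setU xC1 orbT]; rewrite in_setD xB.
  have [g1 g1'] := IHX _ C1X C1n n1 c1; have [g2 g2'] := IHX _ C2X C2n n2 c2.
  have g12 : good (X :\: (x |: C)) (2 + h + h)%R.
    move: (rR); rewrite E in_setU => /orP[r1|r2].
      by apply: good_setU => //; apply: g1'; apply: notW.
    by apply: good_le (good_setU dis nC g1 (g2' (notW _ C2X r2))); lra.
  have := step_medium2 (S := [set w in X :\: (x |: C) | e x w]) XL xX CX clC cl Bk d2 _ g12.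
  rewrite -/(deg _ _ _) d2 => H; apply: good_le (H _); first by lra.
  by move=> w wW exw; rewrite inE (subsetP (W_sub _) w wW).
- by apply: small; left.
- by apply: small; right.
Qed.

Lemma exists_component X : X != set0 -> exists Y,
  [/\ closed_in e X Y, Y != set0 & conn e Y].
Proof.
move=> X0; pose P := [pred Y : {set T} | closedb e X Y && (Y != set0)].
have pX : P X by rewrite /= X0 andbT; apply/closedP; split.
case: (arg_minnP (fun Y : {set T} => #|Y|) pX) => Y /= /andP[/closedP cY Y0] min.
exists Y; split=> // C cC C0; apply/eqP; rewrite eqEcard (proj1 cC) /=.
apply: (min C); rewrite /= C0 andbT; apply/closedP; split.
  exact: subset_trans (proj1 cC) (proj1 cY).
move=> u w uC wX euw; apply: (proj2 cC u) => //; apply: (proj2 cY u) => //.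
exact: (subsetP (proj1 cC)).
Qed.

(** [D2] takes one vertex from each component covered by copies of [K_(k-1)], where
    [potential_bound] leaves a surplus [h]. In any other component each unit has a neighbour outside
    [bigs X], since otherwise it would be the whole component. *)
Lemma potential_total X : X \subset L -> exists D2 : {set T},
  [/\ D2 \subset bigs X, good X (h * #|D2|%:R)%R &
   forall w, w \in bigs X -> (exists2 d, d \in D2 & link e (bigs X) d w) \/
     exists v z, [/\ link e (bigs X) w v, z \in X, z \notin bigs X & e v z]].
Proof.
have [n] := ubnP #|X|; elim: n X => // n IH X; rewrite ltnS => Xn XL.
have [->|X0] := eqVneq X set0.
  have W0 : bigs set0 = set0 by apply/eqP; rewrite -subset0 W_sub.
  exists set0; rewrite W0; split=> [//||w]; last by rewrite in_set0.
  exists set0, set0; split.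
  - by split; [|exact: independent0|move=> v; rewrite in_set0].
  - by rewrite /hits W0; split=> // w; rewrite in_set0.
  rewrite /Phi /degsum big_set0 /ends W0 cards0 [X in (h * (X%:R - _))%R](_ : _ = 0); first by lra.
  by apply/eqP; rewrite cards_eq0 -subset0; apply/subsetP => w; rewrite inE in_set0.
have [Y [cY Y0 conY]] := exists_component X0; have [YX clY] := cY.
set Z := X :\: Y; have cZ : closed_in e X Z := closed_compl e_sym cY.
have XE : X = Y :|: Z by rewrite -{1}(setID X Y) (setIidPr YX).
have dis : [disjoint Y & Z] by rewrite disjoint_subset; apply/subsetP => u uY; rewrite !inE uY.
have nYZ u w : u \in Y -> w \in Z -> ~~ e u w.
  move=> uY wZ; apply/negP => euw; have wX := subsetP (proj1 cZ) w wZ.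
  by have := clY u w uY wX euw; rewrite (disjointFl dis wZ).
have YL := subset_trans YX XL.
have Zn : #|Z| < n.
  apply: leq_trans Xn; apply: proper_card; apply/properP; split; first exact: (proj1 cZ).
  by have [y yY] := set0Pn _ Y0; exists y; rewrite ?(subsetP YX) // inE yY.
have [E2 [E2W gZ hZ]] := IH Z Zn (subset_trans (proj1 cZ) XL).
have WY : bigs Y \subset bigs X := W_mono YX.
have WZ : bigs Z \subset bigs X := W_mono (proj1 cZ).
have sideW C : closed_in e X C -> forall w, w \in C -> w \in bigs X -> w \in bigs C.
  move=> cC w wC /WP[Q [bQ QX wQ]]; apply/WP; exists Q; split=> //.
  have /bigcliqueP[_ cQ] := bQ; by have := conn_meet (clique_conn cQ) QX cC wQ wC.
have lift C : C \subset X -> closed_in e X C -> forall D w, w \in bigs C ->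
   (exists2 d, d \in D & link e (bigs C) d w) \/
     (exists v z, [/\ link e (bigs C) w v, z \in C, z \notin bigs C & e v z]) ->
   (exists2 d, d \in D & link e (bigs X) d w) \/
     (exists v z, [/\ link e (bigs X) w v, z \in X, z \notin bigs X & e v z]).
  move=> CX cC D w wC [[d dD lk]|[v [z [lk zC zW evz]]]].
    by left; exists d => //; apply: link_mono lk; apply: W_mono.
  right; exists v, z; split=> //.
  - by apply: link_mono lk; apply: W_mono.
  - exact: (subsetP CX).
  - by apply: contraNN zW; apply: sideW.
have WE w : w \in bigs X -> w \in bigs Y \/ w \in bigs Z.
  move=> wW; have := subsetP (W_sub X) w wW; rewrite {1}XE => /setUP[wY|wZ].
    by left; apply: (sideW Y).
  by right; apply: (sideW Z).
suff [D1 [D1W gY hY]] : exists D1 : {set T}, [/\ D1 \subset bigs Y, good Y (h * #|D1|%:R)%R &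
   forall w, w \in bigs Y -> (exists2 d, d \in D1 & link e (bigs Y) d w) \/
     exists v z, [/\ link e (bigs Y) w v, z \in Y, z \notin bigs Y & e v z]].
  exists (D1 :|: E2); split.
  - by rewrite subUset (subset_trans D1W) // (subset_trans E2W).
  - have -> : #|D1 :|: E2| = #|D1| + #|E2|.
      rewrite cardsU [X in _ - X](_ : _ = 0) ?subn0 //; apply/eqP.
      rewrite cards_eq0 setI_eq0; apply: disjointWl (subset_trans D1W (W_sub Y)) _.
      exact: disjointWr (subset_trans E2W (W_sub Z)) dis.
    by rewrite natrD mulrDr XE; apply: good_setU.
  move=> w /WE[wY|wZ].
    have [[d dD lk]|pl] := lift Y YX cY D1 w wY (hY w wY); last by right.
    by left; exists d; rewrite // in_setU dD.
  have [[d dD lk]|pl] := lift Z (proj1 cZ) cZ E2 w wZ (hZ w wZ); last by right.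
  by left; exists d; rewrite // in_setU dD orbT.
have [gh g2h] := potential_bound YL Y0 conY.
have [YW|YW] := eqVneq Y (bigs Y).
  have [y yY] := set0Pn _ Y0; exists [set y]; split.
  - by rewrite sub1set -YW.
  - by rewrite cards1 mulr1.
  move=> w wW; left; exists y; first by rewrite in_set1.
  by rewrite -YW; apply: (link_conn conY yY); apply: (subsetP (W_sub Y)).
exists set0; split; first exact: sub0set.
  by rewrite cards0 mulr0; apply: good_le (g2h YW); move: h_gt0; lra.
move=> w wW; right; pose U := [set v in bigs Y | link e (bigs Y) w v].
have [/existsP[v /existsP[z /and4P[vU zY zW evz]]]|none] := boolP [exists v, exists z,
    [&& v \in U, z \in Y, z \notin bigs Y & e v z]].
  by exists v, z; split=> //; move: vU; rewrite inE => /andP[].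
exfalso; move/eqP: YW; apply; apply/eqP; rewrite eqEsubset W_sub andbT.
suff UY : U = Y by rewrite -{1}UY; apply/subsetP => v; rewrite inE => /andP[].
apply: conY; last by apply/set0Pn; exists w; rewrite inE wW /link connect0.
split; first by apply/subsetP => v; rewrite inE => /andP[/(subsetP (W_sub Y))].
move=> u z uU zY euz; have [zW|zW] := boolP (z \in bigs Y); last first.
  case/negP: none; apply/existsP; exists u; apply/existsP; exists z.
  by rewrite uU zY zW.
move: uU; rewrite /U in_set [z \in _]in_set zW => /andP[uW lk].
by apply: connect_trans lk _; apply: link1.
Qed.

End Potential.

(** * Cliques of order [k - 1] *)

Section RankedRecursion.

Variable T : finType.

(** The set is built one rank at a time, and later additions do not affect earlier decisions. *)
Lemma recursive_set (B : {set T}) (r : T -> nat) (rule : T -> {set T} -> bool) :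
  (forall b (J J' : {set T}), b \in B ->
     (forall c, r c < r b -> (c \in J) = (c \in J')) -> rule b J = rule b J') ->
  exists J : {set T}, J \subset B /\ forall b, b \in B -> (b \in J) = rule b J.
Proof.
move=> loc.
have [n] : exists n, forall b, r b < n.
  by exists (\max_b r b).+1 => b; rewrite ltnS leq_bigmax.
have : forall n, exists J : {set T}, (J \subset [set b in B | r b < n]) /\
    forall b, b \in B -> r b < n -> (b \in J) = rule b J.
  elim=> [|m [J [JB hJ]]].
    by exists set0; split; [exact: sub0set|].
  pose J' := J :|: [set b in B | (r b == m) && rule b J].
  have JJ' c : r c < m -> (c \in J) = (c \in J').
    by move=> cm; rewrite !inE (ltn_eqF cm) andbF orbF.
  exists J'; split.
    rewrite subUset; apply/andP; split; apply/subsetP => b.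
      by move/(subsetP JB); rewrite !inE => /andP[-> /ltnW]; rewrite ltnS.
    by rewrite !inE => /and3P[-> /eqP-> _]; rewrite ltnSn.
  move=> b bB; rewrite ltnS leq_eqVlt => /orP[/eqP bm|bm].
    have bJ : b \notin J.
      by apply/negP => /(subsetP JB); rewrite inE bm ltnn andbF.
    rewrite !inE (negPf bJ) bB bm eqxx /=; apply: loc => // c; rewrite bm; exact: JJ'.
  rewrite -JJ' // hJ //; apply: loc => // c cb; apply: JJ'; exact: ltn_trans bm.
move=> /(_ n)[J [JB hJ]] hn; exists J; split; last by move=> b bB; apply: hJ.
by apply: subset_trans JB _; apply/subsetP => b; rewrite inE => /andP[].
Qed.

Variable e : rel T.

(** Only descent is needed, not exact distances: [P] grows by one adjacent vertex at a time, and the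
    values outside [P] shift by one. *)
Lemma descent_to (X P : {set T}) :
  (forall x, x \in X -> exists2 p, p \in P & link e X x p) -> P \subset X ->
  exists d : T -> nat, (forall x, x \in X -> (d x == 0) = (x \in P)) /\
    forall x, x \in X -> x \notin P -> exists u, [/\ u \in X, e x u & d u < d x].
Proof.
have [n] := ubnP #|X :\: P|; elim: n P => // n IH P; rewrite ltnS => Pn hl PX.
have [XP|/subsetPn[x0 x0X x0P]] := boolP (X \subset P).
  exists (fun=> 0); split=> x xX; first by rewrite (subsetP XP).
  by rewrite (subsetP XP).
have [v [u [vX vP uP evu]]] : exists v u, [/\ v \in X, v \notin P, u \in P & e v u].
  have [q qP /connectP[s ps qs]] := hl x0 x0X.
  elim: s x0 x0X x0P ps qs => [|y s IHs] x xX xP /=; first by move=> _ E; rewrite -E qP in xP.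
  move=> /andP[/and3P[exy _ yX] ps] qs; have [yP|yP] := boolP (y \in P).
    by exists x, y.
  exact: IHs yX yP ps qs.
have [|||d [d0 dd]] := IH (v |: P).
- apply: leq_trans Pn; apply: proper_card; apply/properP; split.
    by apply: setDS; apply: subsetUr.
  by exists v; rewrite !inE ?eqxx ?vX ?vP.
- by move=> x xX; have [q qP lk] := hl x xX; exists q; rewrite // in_setU1 qP orbT.
- by rewrite subUset sub1set vX.
exists (fun x => if x \in P then 0 else (d x).+1); split.
  by move=> x xX; case: ifP.
move=> x xX xP; rewrite (negPf xP); have [xv|xv] := eqVneq x v.
  by exists u; rewrite xv (subsetP PX) // uP.
have [|w [wX exw dw]] := dd x xX; first by rewrite in_setU1 negb_or xv.
by exists w; split=> //; case: ifP.
Qed.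

End RankedRecursion.

Section BigCliques.

Variables (T : finType) (e : rel T) (L : {set T}) (k : nat).
Hypothesis e_sym : symmetric e.
Hypothesis e_irr : irreflexive e.
Hypothesis forestL : forall A X : {set T}, X != set0 -> X \subset L -> A \subset X ->
  independent e A -> \sum_(a in A) deg e X a < #|X|.
Hypothesis no_Kk : forall X : {set T}, clique e X -> #|X| <> k.
Hypothesis k_gt5 : 5 < k.
Hypothesis lowL : forall v, v \in L -> deg e [set: T] v = k.-1.

Local Notation W := (bigs e k L).
Local Notation bigclique := (bigclique e k).

(** A common vertex has degree [k - 1], so the union has at most [k] vertices, and the cliques
    differ in one vertex each, [a] and [b]. If these are adjacent, the union is a [K_k]; if not,
    they have two common neighbours. *)
Lemma bigclique_unique (Q1 Q2 : {set T}) w : bigclique Q1 -> bigclique Q2 ->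
  Q1 \subset L -> Q2 \subset L -> w \in Q1 -> w \in Q2 -> Q1 = Q2.
Proof.
move=> /bigcliqueP[k1 c1] /bigcliqueP[k2 c2] Q1L Q2L w1 w2.
apply/eqP/negPn/negP => ne.
have cardU : #|Q1 :|: Q2| <= k.
  rewrite (cardsD1 w) in_setU w1 /= -[X in _ <= X](@prednK k); last by apply: leq_trans k_gt5.
  rewrite add1n ltnS -(lowL (subsetP Q1L w w1)).
  apply: subset_leq_card; apply/subsetP => u /setD1P[uw uQ]; rewrite inE in_setT /=.
  by case/setUP: uQ => uQ; [apply: c1|apply: c2]; rewrite // eq_sym.
have ne1 : ~~ (Q1 \subset Q2) by apply: contraNN ne => s; rewrite eqEcard s k1 k2 leqnn.
have ne2 : ~~ (Q2 \subset Q1) by apply: contraNN ne => s; rewrite eq_sym eqEcard s k1 k2 leqnn.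
have [a a1 a2] := subsetPn ne1; have [b b2 b1] := subsetPn ne2.
have UE : a |: Q2 = Q1 :|: Q2.
  apply/eqP; rewrite eqEcard; apply/andP; split.
    by rewrite subUset sub1set in_setU a1 subsetUr.
  by rewrite cardsU1 a2 k2 add1n prednK //; apply: leq_trans k_gt5.
have UE' : b |: Q1 = Q1 :|: Q2.
  apply/eqP; rewrite eqEcard; apply/andP; split.
    by rewrite subUset sub1set in_setU b2 orbT subsetUl.
  by rewrite cardsU1 b1 k1 add1n prednK //; apply: leq_trans k_gt5.
have cI : #|Q1 :&: Q2| = k - 2.
  have := cardsUI Q1 Q2; rewrite -UE cardsU1 a2 k1 k2; move: k_gt5; clear; lia.
have ab : a != b by apply: contraNneq a2 => ->.
have nab : ~~ e a b.
  apply/negP => eab; apply: (no_Kk (X := a |: Q2)); last first.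
    by rewrite cardsU1 a2 k2; move: k_gt5; clear; lia.
  have in1 u : u \in Q2 -> u != b -> u \in Q1.
    move=> u2 ub; have : u \in b |: Q1 by rewrite UE' in_setU u2 orbT.
    by rewrite in_setU1 (negPf ub).
  move=> x y /setU1P[->|x2] /setU1P[->|y2]; rewrite ?eqxx // => xy; last exact: c2.
    by have [->//|yb] := eqVneq y b; apply: c1 => //; apply: in1.
  by rewrite e_sym; have [->//|xb] := eqVneq x b; apply: c1 => //; [apply: in1|rewrite eq_sym].
have /card_gt1P[u [v [uI vI uv]]] : 1 < #|Q1 :&: Q2|.
  by rewrite cI; move: k_gt5; clear; lia.
have [[u1 u2] [v1 v2]] := (setIP uI, setIP vI).
have neq x y (Q : {set T}) : x \in Q -> y \notin Q -> x != y by move=> xQ; apply: contraNneq => <-.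
apply: (@unique_common_neighbour _ _ _ e_sym e_irr forestL a b u v) => //.
- exact: (subsetP Q1L). - exact: (subsetP Q2L). - exact: (subsetP Q1L). - exact: (subsetP Q1L).
- by apply: c1 => //; rewrite eq_sym (neq _ _ _ u2 a2).
- by apply: c1 => //; rewrite eq_sym (neq _ _ _ v2 a2).
- by apply: c2 => //; rewrite eq_sym (neq _ _ _ u1 b1).
- by apply: c2 => //; rewrite eq_sym (neq _ _ _ v1 b1).
Qed.

(* [Qof w] and [ext w] are meaningful only for [w \in W]. *)
Definition Qof (w : T) : {set T} :=
  odflt set0 [pick Q : {set T} | [&& bigclique Q, Q \subset L & w \in Q]].

Definition ext (w : T) : T := odflt w [pick u | e w u && (u \notin Qof w)].

Lemma QofP w : w \in W -> [/\ bigclique (Qof w), Qof w \subset L & w \in Qof w].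
Proof.
case/WP=> Q [bQ QL wQ]; rewrite /Qof; case: pickP => [Q' /and3P[]//|/(_ Q)].
by rewrite bQ QL wQ.
Qed.

Lemma Qof_eq w u : w \in W -> u \in Qof w -> Qof u = Qof w.
Proof.
move=> wW uQ; have [bQ QL wQ] := QofP wW.
have uW : u \in W by apply/WP; exists (Qof w).
have [bQ' QL' uQ'] := QofP uW; exact: (bigclique_unique bQ' bQ QL' QL uQ' uQ).
Qed.

Lemma Qof_W w u : w \in W -> u \in Qof w -> u \in W.
Proof. by move=> wW uQ; have [bQ QL _] := QofP wW; apply/WP; exists (Qof w). Qed.

Lemma Qof_sym w u : w \in W -> u \in Qof w -> w \in Qof u.
Proof. by move=> wW uQ; rewrite (Qof_eq wW uQ); have [] := QofP wW. Qed.

Lemma Qof_adj w u : w \in W -> u \in Qof w -> u != w -> e w u.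
Proof.
by move=> wW uQ uw; have [/bigcliqueP[_ cQ] _ wQ] := QofP wW; apply: cQ => //; rewrite eq_sym.
Qed.

(** The clique takes [k - 2] of the [k - 1] neighbours of [w], so exactly one is left. *)
Lemma extP w : w \in W -> [/\ e w (ext w), ext w \notin Qof w &
  forall u, e w u -> u \in Qof w \/ u = ext w].
Proof.
move=> wW; have [bQ QL wQ] := QofP wW; have /bigcliqueP[Qk cQ] := bQ.
pose N := [set u in [set: T] | e w u].
have Nk : #|N| = k.-1 by exact: lowL (subsetP QL w wQ).
have QN : #|N :\: Qof w| = 1.
  have := cardsID (Qof w) N; have -> : N :&: Qof w = Qof w :\ w.
    apply/setP => u; rewrite !inE; have [->|uw] /= := eqVneq u w; first by rewrite e_irr.
    by have [uQ|uQ] := boolP (u \in Qof w); rewrite ?andbF ?andbT // Qof_adj.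
  by have := cardsD1 w (Qof w); rewrite wQ Nk Qk; move: k_gt5; clear; lia.
have /cards1P[x xE] : #|N :\: Qof w| == 1 by apply/eqP.
have hx u : (e w u && (u \notin Qof w)) = (u == x).
  by have /setP/(_ u) := xE; rewrite !inE andbC.
have -> : ext w = x.
  rewrite /ext; case: pickP => [u|/(_ x)]; first by rewrite hx => /eqP.
  by rewrite hx eqxx.
have := hx x; rewrite eqxx => /andP[-> ->]; split=> // u ewu.
by have [uQ|uQ] := boolP (u \in Qof w); [left|right; apply/eqP; rewrite -hx ewu].
Qed.

Lemma ext_ext w : w \in W -> ext w \in W -> ext (ext w) = w.
Proof.
move=> wW eW; have [ew nQ _] := extP wW; have [_ _ h] := extP eW.
rewrite e_sym in ew; case: (h w ew) => // wQ.
by case/negP: nQ; apply: Qof_sym.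
Qed.

End BigCliques.

(** * The digraph on cliques and vertices of degree [k] *)

Section Reducible.

Variables (T : finType) (e : rel T) (L : {set T}) (k : nat).
Hypothesis e_sym : symmetric e.
Hypothesis e_irr : irreflexive e.
Hypothesis forestL : forall A X : {set T}, X != set0 -> X \subset L -> A \subset X ->
  independent e A -> \sum_(a in A) deg e X a < #|X|.
Hypothesis no_Kk : forall X : {set T}, clique e X -> #|X| <> k.
Hypothesis k_gt5 : 5 < k.
Hypothesis lowL : forall v, v \in L -> deg e [set: T] v = k.-1.
Hypothesis irreducible : forall X : {set T}, X != set0 ->
  ~ online_choosable e X
      (fun v => k%:Z - 1 - (deg e [set: T] v)%:Z + (deg e X v)%:Z)%R.

Local Notation W := (bigs e k L).
Local Notation Q := (Qof e L k).
Local Notation ext := (ext e L k).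

Let QP := @QofP T e L k.
Let Qeq := @Qof_eq T e L k e_sym e_irr forestL no_Kk k_gt5 lowL.
Let Qsym := @Qof_sym T e L k e_sym e_irr forestL no_Kk k_gt5 lowL.
Let QW := @Qof_W T e L k.
Let Qadj := @Qof_adj T e L k.
Let eP := @extP T e L k e_irr k_gt5 lowL.
Let eext := @ext_ext T e L k e_sym e_irr forestL no_Kk k_gt5 lowL.

(** [Y] consists of vertices of degree [k], and [U] will be a union of units. On each unit [en] and
    [tg] are constant: the entry is joined to [Y], and the outer neighbour of the target is outside
    [X] or an earlier vertex of [Y]. A vertex of [Y] must omit arcs to two neighbours, and [exits]
    supplies them. *)
Variables (Y U : {set T}) (en tg : T -> T) (idx : T -> nat).
Let X := Y :|: U.

Hypothesis X_neq0 : X != set0.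
Hypothesis UW : U \subset W.
Hypothesis degY : forall y, y \in Y -> deg e [set: T] y = k.
Hypothesis idx_inj : {in Y &, injective idx}.
Hypothesis U_clique : forall w u, w \in U -> u \in Q w -> u \in U.
Hypothesis en_link : forall w, w \in U -> en w \in U /\ link e U w (en w).
Hypothesis tg_link : forall w, w \in U -> tg w \in U /\ link e U w (tg w).
Hypothesis en_const : forall w u, w \in U -> u \in U -> e w u -> en w = en u /\ tg w = tg u.
Hypothesis en_tg : forall w, w \in U -> en w != tg w.
Hypothesis en_ext : forall w, w \in U -> ext (en w) \in Y.
Hypothesis tg_ext : forall w, w \in U -> ext (tg w) \in X ->
  ext (tg w) \in Y /\ idx (ext (tg w)) < idx (ext (en w)).
Hypothesis exits : forall y, y \in Y -> 1 < #|[set w in U | e y w && (en w != w)]|.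

Let uW w : w \in U -> w \in W := subsetP UW w.

Lemma YU y : y \in Y -> y \in U = false.
Proof.
move=> yY; apply/negP => yU; have [_ QL yQ] := QP (uW yU).
have := lowL (subsetP QL y yQ); rewrite (degY yY); move: k_gt5; clear; lia.
Qed.

Lemma link_const w u : w \in U -> link e U w u -> en w = en u /\ tg w = tg u.
Proof.
move=> wU /connectP[s ps ->]; elim: s w wU ps => //= v s IH w wU /andP[/and3P[ewv _ vU] ps].
have [-> ->] := en_const wU vU ewv; exact: IH.
Qed.

(* [xs w] is the vertex of the clique of [w] closest to the target.  Walking from
   an entry [en w] by [r |-> ext (xs r)] meets one root [r] of each clique on the
   way; [RA] collects these roots.  The kernel of [S] is found in two phases: on
   [Y :|: RA] membership is decided by increasing rank, a root [r \in S] being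
   left out only if [xs r] can absorb it, because [xs r \in S] and the next root
   is not chosen; on the vertices that are not absorbed the one-way arcs are
   acyclic. *)
Lemma reducible_contradiction : False.
Proof.
have enen w : w \in U -> en (en w) = en w.
  by move=> wU; have [eU lk] := en_link wU; have [<-] := link_const wU lk.
have tgtg w : w \in U -> tg (tg w) = tg w.
  by move=> wU; have [tU lk] := tg_link wU; have [_ <-] := link_const wU lk.
have enQ w u : w \in U -> u \in Q w -> en u = en w /\ tg u = tg w.
  move=> wU uQ; have [->//|uw] := eqVneq u w.
  have uU := U_clique wU uQ; have ewu := Qadj (uW wU) uQ uw.
  by have [-> ->] := en_const wU uU ewu.
have nQ w u : w \in U -> u \in U -> e w u -> u \notin Q w -> u = ext w.
  by move=> wU uU ewu uQ; have [_ _ h] := eP (uW wU); case: (h u ewu) => // uQ'; rewrite uQ' in uQ.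
pose Tg := [set w in U | tg w == w].
have [||dt [dt0 dtd]] := @descent_to T e U Tg.
- move=> w wU; have [tU lk] := tg_link wU; exists (tg w) => //.
  by rewrite inE tU tgtg //=.
- by apply/subsetP => w; rewrite inE => /andP[].
(* The choice depends only on [Q w], so all vertices of a clique share it. *)
pose xs w := odflt w [pick u in Q w | [forall v in Q w, dt u <= dt v]].
have xsP w : w \in U -> xs w \in Q w /\ forall v, v \in Q w -> dt (xs w) <= dt v.
  move=> wU; rewrite /xs; case: pickP => [u /andP[uQ /forall_inP h]|none] //=.
  have [_ _ wQ] := QP (uW wU).
  case: (arg_minnP dt wQ) => u uQ h; have := none u; rewrite (uQ : u \in Q w) /=.
  by move/negbT/negP; case; apply/forall_inP.
have xsQ w u : w \in U -> u \in Q w -> xs u = xs w.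
  move=> wU uQ; rewrite /xs (Qeq (uW wU) uQ); case: pickP => //= none.
  by have [_ h] := xsP w wU; have := none (xs w); rewrite (xsP w wU).1; move/negbT/negP; case; apply/forall_inP.
have xsU w : w \in U -> xs w \in U by move=> wU; apply: (U_clique wU); case: (xsP w wU).
have xs_en w : w \in U -> tg (xs w) = tg w /\ en (xs w) = en w.
  by move=> wU; have [xQ _] := xsP w wU; have [-> ->] := enQ w _ wU xQ.
have xs_ext w : w \in U -> xs w != tg w -> ext (xs w) \in U /\ dt (ext (xs w)) < dt (xs w).
  move=> wU xt; have [xQ xmin] := xsP w wU; have xU := xsU w wU.
  have xT : xs w \notin Tg by rewrite inE xU (xs_en w wU).1 eq_sym.
  have [u [uU eu du]] := dtd _ xU xT.
  suff <- : u = ext (xs w) by [].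
  apply: nQ => //; rewrite (Qeq (uW wU) xQ); apply/negP => uQ.
  by have := xmin u uQ; rewrite leqNgt du.
have min_ext w : w \in U -> xs w = w -> w != tg w -> ext w \in U /\ dt (ext w) < dt w.
  by move=> wU xw wt; have := xs_ext w wU; rewrite xw; apply.
pose nxt r := if xs r == tg r then r else ext (xs r).
pose RA := [set r in U | fconnect nxt (en r) r].
have nxtU r : r \in U -> nxt r \in U /\ (en (nxt r) = en r /\ tg (nxt r) = tg r).
  move=> rU; rewrite /nxt; case: eqP => [//|/eqP xt]; have [eU _] := xs_ext r rU xt.
  split=> //; have [h1 h2] := xs_en r rU; rewrite -h1 -h2.
  have [e1 _ _] := eP (uW (xsU r rU)).
  by have [-> ->] := en_const (xsU r rU) eU e1.
have RAU r : r \in RA -> r \in U by rewrite inE => /andP[].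
have enRA w : w \in U -> en w \in RA.
  by move=> wU; rewrite inE enen // connect0 andbT; case: (en_link wU).
have nxtRA r : r \in RA -> nxt r \in RA.
  rewrite !inE => /andP[rU cr]; have [nU [-> _]] := nxtU r rU; rewrite nU /=.
  by apply: connect_trans cr (connect1 _); rewrite /= eqxx.
have RAind (P : T -> Prop) : (forall w, w \in U -> P (en w)) ->
    (forall r, r \in RA -> P r -> P (nxt r)) -> forall r, r \in RA -> P r.
  move=> P0 PS r rR; have rU := RAU r rR; move: rR; rewrite inE rU /= => /iter_findex <-.
  set i := findex _ _ _; suff [] : iter i nxt (en r) \in RA /\ P (iter i nxt (en r)) by [].
  elim: i => [|i [iR iP]] /=; first by split; [exact: enRA|exact: P0].
  by split; [exact: nxtRA|exact: PS].
have extU w : w \in U -> ext w \in U -> ext (ext w) = w.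
  by move=> wU eU; apply: eext; apply: uW.
(* A later root is entered from the preceding [xs], which is farther from the target, so leaving by
   the same edge would not lead closer. The outer neighbour of an entry is in [Y], hence no step
   towards the target either. *)
have xs_neq r : r \in RA -> xs r != r.
  move: r; apply: RAind => [w wU|r rR xr].
    have [eU _] := en_link wU; apply/eqP => xe.
    have [] := min_ext _ eU xe; first by have := en_tg eU; rewrite enen.
    by rewrite YU // en_ext.
  rewrite /nxt; have [_|xt] := eqVneq (xs r) (tg r); first exact: xr.
  have rU := RAU r rR.
  have [eU de] := xs_ext r rU xt; apply/eqP => xe.
  have eeU := extU _ (xsU r rU) eU.
  have [] := min_ext _ eU xe.
    apply/eqP => et; have := tg_ext eU; rewrite -et eeU in_setU (xsU r rU) orbT => /(_ isT) [].
    by move=> h _; have := YU h; rewrite (xsU r rU).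
  by rewrite eeU => _; move: de; clear; lia.
have RAprev r : r \in RA -> r = en r \/ exists r', [/\ r' \in RA, xs r' != tg r' & r = ext (xs r')].
  move: r; apply: RAind => [w wU|r rR Pr]; first by left; rewrite enen.
  by rewrite /nxt; case: eqP => [_ //|/eqP xt]; right; exists r.
(* The distance to the target falls along the path, so the path never returns to a clique. *)
have RAdec r n : r \in RA -> iter n nxt r = r \/ dt (xs (iter n nxt r)) < dt (xs r).
  elim: n r => [|n IHn] r rR; first by left.
  rewrite iterSr; have rU := RAU r rR.
  case: (eqVneq (xs r) (tg r)) => xt.
    have -> : nxt r = r by rewrite /nxt xt eqxx.
    exact: IHn.
  have nE : nxt r = ext (xs r) by rewrite /nxt (negPf xt).
  have [eU de] := xs_ext r rU xt; have [xQ xmin] := xsP _ eU.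
  have := xmin (ext (xs r)); have [_ _ eQ] := QP (uW eU); move=> /(_ eQ) le.
  right; case: (IHn _ (nxtRA r rR)) => [->|]; rewrite nE.
    exact: leq_ltn_trans le de.
  by move=> h; apply: ltn_trans h (leq_ltn_trans le de).
have RAuniq r r' : r \in RA -> r' \in RA -> r' \in Q r -> r' = r.
  move=> rR rR' rQ; have rU := RAU r rR; have rU' := RAU r' rR'.
  have [ee _] := enQ r r' rU rQ; have xx := xsQ r r' rU rQ.
  have /iter_findex E : fconnect nxt (en r) r by move: rR; rewrite inE => /andP[].
  have /iter_findex E' : fconnect nxt (en r) r' by move: rR'; rewrite inE ee => /andP[].
  move: E E'; set i := findex _ _ r; set j := findex _ _ r' => E E'.
  case/orP: (leq_total i j) => ij.
    have := RAdec r (j - i) rR; rewrite -{1 3}E -iterD subnK // E' xx ltnn.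
    by case.
  have := RAdec r' (i - j) rR'; rewrite -{1 3}E' -iterD subnK // E xx ltnn.
  by case=> // ->.
have RAnbr r u : r \in RA -> u \in RA -> e r u -> False.
  move=> rR uR eru; have rU := RAU r rR; have uU := RAU u uR.
  have [uQ|uQ] := boolP (u \in Q r); first by rewrite (RAuniq r u) // e_irr in eru.
  have ur := nQ r u rU uU eru uQ.
  have [re|[r' [rR' xt E]]] := RAprev r rR.
    by have := en_ext rU; rewrite -re -ur => /YU; rewrite uU.
  have rU' := RAU r' rR'; have eU := xsU r' rU'.
  have ux : u = xs r' by rewrite ur E extU // -E.
  have [xQ _] := xsP r' rU'; have := xs_neq r' rR'.
  by rewrite -ux (RAuniq r' u) ?eqxx // ux.
have RAY r y : r \in RA -> y \in Y -> e r y -> r = en r /\ ext r = y.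
  move=> rR yY ery; have rU := RAU r rR; have [_ _ h] := eP (uW rU).
  have ye : y = ext r.
    by case: (h y ery) => // yQ; have := YU yY; rewrite (U_clique rU yQ).
  split=> //; have [//|[r' [rR' xt E]]] := RAprev r rR.
  have eU := xsU r' (RAU r' rR').
  by have := YU yY; rewrite ye E extU ?eU // -E.
(* The rank is lexicographic in base [M]: first the index of the vertex of [Y] at the entry, then
   the distance to the target. The last digit [M.-1] puts that vertex above all roots of its
   units. *)
pose M := (\max_w dt w).+2.
have dtM w : (dt w).+1 < M by rewrite !ltnS leq_bigmax.
pose rk b := if b \in Y then idx b * M + M.-1 else idx (ext (en b)) * M + dt (xs b).
have rkY y : y \in Y -> rk y = idx y * M + M.-1 by move=> yY; rewrite /rk yY.
have rkR r : r \in U -> rk r = idx (ext (en r)) * M + dt (xs r).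
  by move=> rU; rewrite /rk; case: ifP => // rY; rewrite YU in rU.
have rk_next r : r \in RA -> ext (xs r) \in X ->
    ext (xs r) \in Y :|: RA /\ rk (ext (xs r)) < rk r.
  move=> rR eX; have rU := RAU r rR; have xU := xsU r rU; have [te ee] := xs_en r rU.
  have [xt|xt] := eqVneq (xs r) (tg r).
    have := tg_ext rU; rewrite -xt => /(_ eX)[eY lt].
    split; first by rewrite in_setU eY.
    rewrite rkY // rkR //; apply: (@leq_trans (idx (ext (en r)) * M)); last exact: leq_addr.
    apply: (@leq_trans ((idx (ext (xs r))).+1 * M)); last by rewrite leq_mul2r lt orbT.
    by rewrite mulSn addnC /M; clear; lia.
  have [eU de] := xs_ext r rU xt.
  have nR : ext (xs r) \in RA by have := nxtRA r rR; rewrite /nxt (negPf xt).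
  split; first by rewrite in_setU nR orbT.
  rewrite !rkR //; have := nxtU r rU; rewrite /nxt (negPf xt) => -[_ [-> _]].
  rewrite ltn_add2l; have [_ xmin] := xsP _ eU; apply: leq_ltn_trans de.
  by apply: xmin; have [] := QP (uW eU).
have rk_entry r y : r \in RA -> y \in Y -> e r y -> rk r < rk y.
  move=> rR yY ery; have rU := RAU r rR; have [re ye] := RAY r y rR yY ery.
  by rewrite (rkY y yY) (rkR r rU) -re ye ltn_add2l; have := dtM (xs r); rewrite /M; clear; lia.
have rk_inj : {in Y &, injective rk}.
  move=> y y' yY yY'; rewrite !rkY // => /addIn /eqP; rewrite eqn_mul2r => /orP[//|/eqP].
  exact: idx_inj.
pose P0 := [set w in U | [exists r in RA, r \in Q w]].
have P0P w : w \in P0 -> exists r, [/\ r \in RA, r \in Q w & w \in Q r].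
  rewrite inE => /andP[wU /exists_inP[r rR rQ]]; exists r; split=> //.
  exact: Qsym (uW wU) rQ.
have P0U w : w \in P0 -> w \in U by rewrite inE => /andP[].
have RAP0 r : r \in RA -> r \in P0.
  move=> rR; have rU := RAU r rR; rewrite inE rU /=; apply/exists_inP; exists r => //.
  by have [] := QP (uW rU).
have P0Q w u : w \in P0 -> u \in Q w -> u \in P0.
  move=> wP uQ; have wU := P0U w wP; have uU := U_clique wU uQ.
  move: wP; rewrite !inE wU uU /= => /exists_inP[r rR rQ]; apply/exists_inP; exists r => //.
  by rewrite (Qeq (uW wU) uQ).
have xsP0 r : r \in RA -> xs r \in P0.
  by move=> rR; apply: (P0Q r (xs r) (RAP0 r rR)); case: (xsP r (RAU r rR)).
have [||dl [dl0 dld]] := @descent_to T e U P0.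
- move=> w wU; have [eU lk] := en_link wU; exists (en w) => //; apply: RAP0; exact: enRA.
- by apply/subsetP => w; apply: P0U.
have RAext r : r \in RA -> ext r \in X -> ext r \in Y \/ [/\ ext r \in P0, ext r \notin RA & ext r \notin Q r].
  move=> rR; rewrite in_setU => /orP[|eU]; first by left.
  right; have rU := RAU r rR; have [er nq _] := eP (uW rU).
  have [re|[r' [rR' xt E]]] := RAprev r rR.
    by have := en_ext rU; rewrite -re => /YU; rewrite eU.
  have ex : ext r = xs r' by rewrite E extU ?xsU ?RAU // -E.
  split=> //; first by rewrite ex xsP0.
  by apply/negP => eR; apply: (RAnbr r (ext r)).
(* Every vertex of [U] must omit an arc to some neighbour. A root omits its [ext], the vertex [xs]
   omits the root of its clique, any other vertex of a clique on the path omits [xs], and a vertex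
   off the path omits a neighbour nearer to the path. Vertices of [Y] send arcs only into [Y :|: RA]
   and so omit their exits. *)
pose D u v := e u v &&
  (if u \in Y then (v \in Y :|: RA) && (rk v < rk u)
   else if v \in Y then u \notin RA
   else if (u \in P0) && (v \in P0) then
     (if v \in Q u then (u \in RA) || (if u == xs u then v \notin RA else v != xs u)
      else u \notin RA)
   else dl u <= dl v).
have UY w : w \in U -> w \in Y = false.
  by move=> wU; apply/negP => /YU; rewrite wU.
have DRA r v : r \in RA -> v \in Q r -> v != r -> D r v.
  move=> rR vQ vr; have rU := RAU r rR; have vU := U_clique rU vQ.
  by rewrite /D (Qadj (uW rU) vQ vr) UY // UY // RAP0 // (P0Q r v (RAP0 r rR) vQ) vQ rR.
have DextB u : u \in U -> u \notin RA -> u \in P0 -> ext u \in Y :|: RA -> D u (ext u).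
  move=> uU uR uP eB; have [eu nq _] := eP (uW uU); rewrite /D eu UY //=.
  case: ifP => // eY; move: eB; rewrite in_setU eY /= => eR.
  by rewrite uP RAP0 // (negPf nq).
apply: (irreducible X_neq0); apply: (@online_choosable_kernel _ _ D) => [u uX|S SX].
  move: uX; rewrite in_setU => /orP[uY|uU]; last first.
    have [_ QL uQ] := QP (uW uU).
    rewrite (lowL (subsetP QL u uQ)).
    suff [v [vX euv nD]] : exists v, [/\ v \in X, e u v & ~~ D u v].
      have : #|[set u0 in X | D u u0]| < deg e X u.
        apply: proper_card; apply/properP; split.
          by apply/subsetP => w; rewrite !inE => /andP[-> /andP[->]].
        by exists v; rewrite !inE ?(negPf nD) ?andbF // euv andbT; rewrite in_setU in vX.
      by move: k_gt5; clear; lia.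
    have UX w : w \in U -> w \in X by move=> wU; rewrite in_setU wU orbT.
    have [uP|uP] := boolP (u \in P0); last first.
      have [v [vU euv lt]] := dld u uU uP; exists v; split=> //; first exact: UX.
      by rewrite /D euv UY // UY // (negPf uP) /= -ltnNge.
    have [uR|uR] := boolP (u \in RA).
      have [eu nq _] := eP (uW uU).
      have eX : ext u \in X.
        have [re|[r' [rR' xt E]]] := RAprev u uR.
          by rewrite in_setU re en_ext.
        by rewrite UX // E extU ?xsU ?RAU // -E.
      exists (ext u); split=> //; rewrite /D eu UY //=.
      have [eY|[eP0 nR nq']] := RAext u uR eX; first by rewrite eY uR.
      by rewrite UY ?P0U // uP eP0 (negPf nq) uR.
    have [r [rR rQ uQr]] := P0P u uP; have rU := RAU r rR.
    have xr : xs u = xs r := xsQ r u rU uQr.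
    have [ux|ux] := eqVneq u (xs u).
      exists r; split; [exact: UX| |].
        by apply: (Qadj (uW uU) rQ); apply: contraNneq uR => <-.
      by rewrite /D !UY // uP RAP0 // rQ (negPf uR) -ux eqxx rR andbF.
    have [xQ _] := xsP u uU; have xU := xsU u uU.
    exists (xs u); split; [exact: UX| |].
      by apply: (Qadj (uW uU) xQ); rewrite eq_sym.
    rewrite /D !UY // uP (P0Q u _ uP xQ) xQ (negPf uR) (negPf ux) /=.
    by rewrite eqxx andbF.
  (* An arc from [Y] into [U] ends in a root, and a root next to [Y] is the entry of its unit. *)
  have dis : #|[set v in X | D u v]| + #|[set w in U | e u w && (en w != w)]| <= deg e X u.
    rewrite -cardsUI [X in _ + X](_ : _ = 0) ?addn0.
      apply: subset_leq_card; apply/subsetP => w /setUP[]; rewrite !inE.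
        by move=> /andP[-> /andP[->]].
      by move=> /and3P[-> -> _]; rewrite orbT.
    apply/eqP; rewrite cards_eq0 -subset0; apply/subsetP => w /setIP[].
    rewrite !inE => /andP[_ /andP[euw]] Dw /and3P[wU _ ew]; move: Dw; rewrite uY.
    rewrite in_setU UY //= => /andP[wR _].
    by rewrite e_sym in euw; have [E _] := RAY w u wR uY euw; rewrite -E eqxx in ew.
  have := exits uY; rewrite (degY uY); move: dis; clear.
  by move: #|_| => a; move: #|_| => b; lia.
(* Comparing ranks makes the rule read smaller ranks only; by [rk_next] the comparison holds for a
   root whenever the vertex after it lies in [X]. *)
pose rule b (J : {set T}) :=
  if b \in Y then (b \in S) && [forall u in Y :|: RA, (e b u && (rk u < rk b)) ==> (u \notin J)]
  else (b \in S) && ((xs b \in S) ==> ((ext (xs b) \in J) && (rk (ext (xs b)) < rk b))).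
have [|J [JB hJ]] := @recursive_set T (Y :|: RA) rk rule.
  move=> b J J' bB h; rewrite /rule; case: ifP => bY; congr (_ && _).
    apply: eq_forallb_in => u uB; case: ltnP; rewrite ?andbF // => lt.
    by rewrite (h u lt).
  by case: ltnP; rewrite ?andbF // => lt; rewrite (h _ lt).
have JX u : u \in J -> u \in X.
  by move/(subsetP JB); rewrite !in_setU => /orP[->//|/RAU ->]; rewrite orbT.
have JS u : u \in J -> u \in S.
  by move=> uJ; have := hJ u (subsetP JB u uJ); rewrite uJ /rule; case: ifP => _ /esym/andP[].
have Jlow y u : y \in Y -> y \in J -> u \in Y :|: RA -> e y u -> rk u < rk y -> u \notin J.
  move=> yY yJ uB eyu lt; have := hJ y (subsetP JB y yJ); rewrite yJ /rule yY => /esym/andP[_].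
  by move/forall_inP => /(_ u uB); rewrite eyu lt.
have Jroot r : r \in RA -> r \in J -> xs r \in S -> ext (xs r) \in J.
  move=> rR rJ xS; have := hJ r (subsetP JB r rJ); rewrite rJ /rule (UY r (RAU r rR)).
  by move=> /esym/andP[_]; rewrite xS => /andP[].
pose R := [set v in S | (v \notin Y :|: RA) && ~~ [exists u in J, D v u]].
have RP v : v \in R -> [/\ v \in S, v \in U, v \notin RA & forall u, u \in J -> ~~ D v u].
  rewrite inE => /and3P[vS]; rewrite in_setU negb_or => /andP[vY vR] /exists_inPn h; split=> //.
  by have := subsetP SX v vS; rewrite in_setU (negPf vY).
(* Within a clique only [xs] fails to send an arc to the root. But if the root is chosen although
   [xs] is in [S], the vertex after [xs] is chosen too and absorbs it. *)
have JR u v : u \in J -> v \in R -> e u v -> False.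
  move=> uJ /RP[vS vU vR nD] euv; have uB := subsetP JB u uJ.
  have evu : e v u by rewrite e_sym.
  have [uY|uY] := boolP (u \in Y).
    by have := nD u uJ; rewrite /D evu UY // uY vR.
  have uR : u \in RA by move: uB; rewrite in_setU (negPf uY).
  have uU := RAU u uR; have uP := RAP0 u uR.
  have [vQ|vQ] := boolP (v \in Q u).
    have vP := P0Q u v uP vQ; have xv := xsQ u v uU vQ; have uQv := Qsym (uW uU) vQ.
    have := nD u uJ; rewrite /D evu (UY v vU) (negPf uY) vP uP uQv (negPf vR) /=.
    case: eqP => [vx _|_]; last by rewrite xv eq_sym xs_neq.
    have eJ := Jroot u uR uJ; rewrite -xv -vx in eJ; have {}eJ := eJ vS.
    by have := nD _ eJ; rewrite DextB // (subsetP JB).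
  have ve := nQ u v uU vU euv vQ.
  have [|/YU|[vP' _ _]] := RAext u uR; rewrite -?ve ?vU //; first by rewrite in_setU vU orbT.
  rewrite -ve in vP'.
  have uQ : u \notin Q v by apply: contraNN vQ => uQ; apply: Qsym (uW vU) uQ.
  by have := nD u uJ; rewrite /D evu (UY v vU) (negPf uY) vP' uP (negPf uQ) vR.
(* Among the vertices left, one-way arcs lead from [xs] to the rest of its clique or away from the
   path. *)
pose r2 v := if v \in P0 then (v != xs v : nat) else (dl v).+2.
have kR : has_kernel e D R.
  apply: (has_kernel_ranked e_sym e_irr (r := r2)) => u v /RP[_ uU uR _] /RP[_ vU vR _] euv.
  have evu : e v u by rewrite e_sym.
  rewrite /D evu euv (UY u uU) (UY v vU) /= [(v \in P0) && _]andbC.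
  case: (boolP ((u \in P0) && (v \in P0))) => [/andP[uP vP]|nP].
    have [vQ|vQ] := boolP (v \in Q u).
      have uQv := Qsym (uW uU) vQ; rewrite uQv (negPf uR) (negPf vR) /=.
      rewrite (xsQ u v uU vQ) /r2 uP vP (xsQ u v uU vQ); case: (eqVneq v (xs u)) => //= vx.
      by rewrite negbK => ->.
    have uQv : u \notin Q v by apply: contraNN vQ => uQ; apply: Qsym (uW vU) uQ.
    by rewrite (negPf uQv) vR.
  rewrite -ltnNge => lt; rewrite (ltnW lt) /= /r2.
  have vP : v \notin P0 by rewrite -(dl0 v vU); move: lt; case: (dl v).
  rewrite (negPf vP); case: ifP => _; first by case: (_ != _).
  by rewrite !ltnS.
have [I [IR iI kI]] := kR; exists (J :|: I); split.
- rewrite subUset; apply/andP; split; apply/subsetP => v; first exact: JS.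
  by move/(subsetP IR)/RP => -[].
- have iJ : independent e J.
    have yy u v : u \in Y -> u \in J -> v \in J -> rk v < rk u -> ~~ e u v.
      move=> uY uJ vJ lt; apply/negP => euv.
      by have := Jlow u v uY uJ (subsetP JB v vJ) euv lt; rewrite vJ.
    move=> u v uJ vJ; have := subsetP JB u uJ; have := subsetP JB v vJ.
    rewrite !in_setU => /orP[vY|vR] /orP[uY|uR].
    + case: (ltngtP (rk u) (rk v)) => [lt|lt|E].
      * by rewrite e_sym yy.
      * exact: yy.
      * by rewrite (rk_inj u v uY vY E) e_irr.
    + apply/negP => euv; have lt := rk_entry u v uR vY euv.
      by rewrite e_sym in euv; move/negP: (yy v u vY vJ uJ lt).
    + apply/negP => euv; have evu : e v u by rewrite e_sym.
      by have lt := rk_entry v u vR uY evu; move/negP: (yy u v uY uJ vJ lt).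
    + by apply/negP => euv; apply: (RAnbr u v).
  move=> u v /setUP[uJ|uI] /setUP[vJ|vI]; first exact: iJ.
  + by apply/negP; apply: JR => //; apply: (subsetP IR).
  + by rewrite e_sym; apply/negP; apply: JR => //; apply: (subsetP IR).
  + exact: iI.
move=> v vS; rewrite in_setU negb_or => /andP[vJ vI].
have [vR|vR] := boolP (v \in R).
  by have [u uI Dvu] := kI v vR vI; exists u; rewrite // in_setU uI orbT.
have [vB|vB] := boolP (v \in Y :|: RA); last first.
  move: vR; rewrite inE vS vB /= negbK => /exists_inP[u uJ Dvu].
  by exists u; rewrite // in_setU uJ.
have := hJ v vB; rewrite (negPf vJ) /rule vS /=.
have [vY|vY] := boolP (v \in Y).
  move/esym/negbT; rewrite negb_forall_in => /exists_inP[u uB].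
  rewrite negb_imply negbK => /andP[/andP[evu lt] uJ].
  by exists u; rewrite ?in_setU ?uJ // /D evu vY uB lt.
have rR : v \in RA by move: vB; rewrite in_setU (negPf vY).
have rU := RAU v rR; move/esym/negbT; rewrite negb_imply => /andP[xS nJ].
(* A root left out of [J] sends arcs to its whole clique. Its [xs] survives the first phase, and the
   second phase either chooses it or absorbs it by a vertex of the same clique. *)
set x := xs v in xS nJ; have xU : x \in U := xsU v rU.
have [xQ _] := xsP v rU; rewrite -/x in xQ.
have xv : x != v := xs_neq v rR.
have xR : x \notin RA by apply/negP => xR; case/eqP: xv; exact: RAuniq.
have exJ : ext x \notin J.
  apply/negP => eJ; have [_ lt] := rk_next v rR (JX _ eJ).
  by move: nJ; rewrite eJ lt.
have exB : ext x \in R -> False.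
  move=> eR; have [eS eU _ _] := RP _ eR.
  have [eB _] := rk_next v rR (subsetP SX _ eS).
  by move: eR; rewrite inE eB andbF.
have xRR : x \in R.
  rewrite inE xS in_setU (UY x xU) (negPf xR) /=; apply/exists_inPn => u uJ.
  apply/negP => /andP[exu _]; have [_ _ h] := eP (uW xU).
  case: (h u exu) => [uQ|ue]; last by rewrite -ue uJ in exJ.
  have uQv : u \in Q v by rewrite -(Qeq (uW rU) xQ).
  have uU := U_clique rU uQv; have := subsetP JB u uJ; rewrite in_setU (UY u uU) /= => uR.
  by rewrite (RAuniq v u rR uR uQv) (negPf vJ) in uJ.
have [xI|xI] := boolP (x \in I).
  by exists x; rewrite ?in_setU ?xI ?orbT // DRA.
have [u uI Dxu] := kI x xRR xI; have uR := subsetP IR u uI.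
have [_ uU uRA _] := RP u uR; have /andP[exu _] := Dxu.
have [_ _ h] := eP (uW xU); case: (h u exu) => [uQ|ue]; last by case: exB; rewrite -ue.
exists u; first by rewrite in_setU uI orbT.
have uQv : u \in Q v by rewrite -(Qeq (uW rU) xQ).
by apply: DRA => //; apply: contraNneq uRA => ->.
Qed.

End Reducible.

(** * Units and vertices of degree [k] *)

Section Units.

Variables (T : finType) (e : rel T) (L : {set T}) (k : nat).
Hypothesis e_sym : symmetric e.
Hypothesis e_irr : irreflexive e.
Hypothesis forestL : forall A X : {set T}, X != set0 -> X \subset L -> A \subset X ->
  independent e A -> \sum_(a in A) deg e X a < #|X|.
Hypothesis no_Kk : forall X : {set T}, clique e X -> #|X| <> k.
Hypothesis k_gt5 : 5 < k.
Hypothesis lowL : forall v, v \in L -> deg e [set: T] v = k.-1.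
Hypothesis irreducible : forall X : {set T}, X != set0 ->
  ~ online_choosable e X
      (fun v => k%:Z - 1 - (deg e [set: T] v)%:Z + (deg e X v)%:Z)%R.

Local Notation W := (bigs e k L).
Local Notation Q := (Qof e L k).
Local Notation ext := (ext e L k).

Let QP := @QofP T e L k.
Let QW := @Qof_W T e L k.
Let Qadj := @Qof_adj T e L k.
Let eP := @extP T e L k e_irr k_gt5 lowL.

(** Canonical representatives turn choices made per unit into functions on vertices. *)
Definition rep (w : T) : T :=
  fingraph.root [rel x y | [&& e x y, x \in W & y \in W]] w.

Lemma link_sym (Z : {set T}) : symmetric (link e Z).
Proof. by apply: sym_connect_sym => x y /=; rewrite e_sym [(x \in Z) && _]andbC. Qed.

Lemma rep_eq w u : (rep w == rep u) = link e W w u.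
Proof. exact: root_connect (link_sym W) w u. Qed.

Lemma rep_rep w : rep (rep w) = rep w.
Proof. exact: root_root (link_sym W) w. Qed.

Lemma link_in (Z : {set T}) x y : x \in Z -> link e Z x y -> y \in Z.
Proof.
move=> xZ /connectP[s ps ->]; elim: s x xZ ps => //= v s IH x xZ /andP[/and3P[_ _ vZ] ps].
exact: IH.
Qed.

Lemma rep_W w : w \in W -> rep w \in W.
Proof. by move=> wW; apply: link_in wW _; rewrite -rep_eq rep_rep. Qed.

Lemma rep_adj w u : w \in W -> u \in W -> e w u -> rep w = rep u.
Proof. by move=> wW uW ewu; apply/eqP; rewrite rep_eq link1. Qed.

Lemma link_closed (U : {set T}) x y : U \subset W ->
  (forall w u, w \in U -> u \in W -> e w u -> u \in U) ->
  x \in U -> link e W x y -> link e U x y.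
Proof.
move=> UW cl xU /connectP[s ps ->]; elim: s x xU ps => [|v s IH] x xU /=; first by rewrite /link connect0.
move=> /andP[/and3P[exv _ vW] ps]; have vU := cl x v xU vW exv.
by apply: connect_trans (IH v vU ps); apply: link1.
Qed.

Lemma ext_high w y : w \in W -> y \notin L -> e w y -> ext w = y.
Proof.
move=> wW yL ewy; have [_ _ h] := eP wW; case: (h y ewy) => // yQ.
by have [_ QL _] := QP wW; rewrite (subsetP QL y yQ) in yL.
Qed.

Lemma high_notin y : deg e [set: T] y = k -> y \notin L.
Proof. by move=> dy; apply/negP => /lowL; move: k_gt5; rewrite dy; clear; lia. Qed.

Lemma W_L w : w \in W -> w \in L.
Proof. exact: (subsetP (W_sub e k L)). Qed.

(** Units are closed under adjacency within [W], so all requirements on [U] reduce to one entry and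
    one target per unit. *)
Lemma unit_contradiction (Y R : {set T}) (en tg : T -> T) (idx : T -> nat) :
  Y != set0 -> {in Y &, injective idx} ->
  (forall y, y \in Y -> deg e [set: T] y = k) ->
  (forall r, r \in R -> [/\ en r \in W, rep (en r) = r & ext (en r) \in Y]) ->
  (forall r, r \in R -> [/\ tg r \in W, rep (tg r) = r, ext (tg r) \notin W &
     ext (tg r) \in Y -> idx (ext (tg r)) < idx (ext (en r))]) ->
  (forall y, y \in Y -> 1 < #|[set w in W | [&& e y w, rep w \in R & en (rep w) != w]]|) ->
  False.
Proof.
move=> Y0 idx_inj degY enP tgP exits; pose U := [set w in W | rep w \in R].
have UW : U \subset W by apply/subsetP => w; rewrite inE => /andP[].
have UP w : w \in U -> w \in W /\ rep w \in R by rewrite inE => /andP[].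
have cl w u : w \in U -> u \in W -> e w u -> u \in U.
  by move=> /UP[wW rR] uW ewu; rewrite inE uW -(rep_adj wW uW ewu).
apply: (reducible_contradiction e_sym e_irr forestL no_Kk k_gt5 lowL irreducible
  (Y := Y) (U := U) (en := en \o rep) (tg := tg \o rep) (idx := idx)) => //=.
- by case/set0Pn: Y0 => y yY; apply/set0Pn; exists y; rewrite in_setU yY.
- move=> w u wU uQ; have [wW _] := UP w wU; have [->//|uw] := eqVneq u w.
  by apply: (cl w) => //; [exact: (QW wW)|exact: Qadj].
- move=> w wU; have [wW rR] := UP w wU; have [eW re _] := enP _ rR.
  split; first by rewrite inE eW re.
  by apply: (link_closed UW cl wU); rewrite -rep_eq re.
- move=> w wU; have [wW rR] := UP w wU; have [eW re _ _] := tgP _ rR.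
  split; first by rewrite inE eW re.
  by apply: (link_closed UW cl wU); rewrite -rep_eq re.
- by move=> w u /UP[wW _] /UP[uW _] ewu; rewrite (rep_adj wW uW ewu).
- move=> w /UP[wW rR]; apply/eqP => E; have [_ _ eY] := enP _ rR.
  by have [_ _ _] := tgP _ rR; rewrite -E => /(_ eY); rewrite ltnn.
- by move=> w /UP[wW rR]; have [] := enP _ rR.
- move=> w /UP[wW rR]; have [_ _ nW lt] := tgP _ rR; rewrite in_setU => /orP[yY|/UP[eW]].
    by split=> //; apply: lt.
  by rewrite eW in nW.
move=> y yY; apply: leq_trans (exits y yY) _; apply: subset_leq_card.
by apply/subsetP => w; rewrite !inE => /and4P[-> -> -> ->].
Qed.

Local Notation K := (k%:R : rat)%R.

Variables p h : rat.
Hypothesis ph_big : ((K - 1) * (1 - p) = h * (K - 3))%R.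
Hypothesis ph_medium : ((K - 2) * p = 2 + h)%R.
Hypothesis h_gt0 : (0 < h)%R.
Hypothesis h_lt1 : (h < 1)%R.
Hypothesis p_gt0 : (0 < p)%R.
Hypothesis p_lt1 : (p < 1)%R.
Hypothesis ph_cycle : (0 <= 2 * (K - 6) + 2 * p - h)%R.

Let degL v : v \in L -> deg e L v < k.
Proof.
move=> vL; have := lowL vL; have := deg_le e v (subsetT L); move: k_gt5; clear; lia.
Qed.

Let pbound := @potential_bound T e L k e_sym e_irr forestL degL no_Kk k_gt5 p h
  ph_big ph_medium h_gt0 h_lt1 p_gt0 p_lt1 ph_cycle.

(** If all edges from the unit to vertices outside [W] went to [y], it would have at most [k] ends,
    too few for its potential unless it is a single [K_(k-1)]; that clique and [y] would form a
    [K_k]. *)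
Lemma unit_target y w : deg e [set: T] y = k -> w \in W -> e y w ->
  exists t, [/\ t \in W, rep t = rep w, ext t \notin W & ext t != y].
Proof.
move=> dy wW eyw; have yL := high_notin dy.
pose U := [set u in W | rep u == rep w].
have UW : U \subset W by apply/subsetP => u; rewrite inE => /andP[].
have [/existsP[t /and3P[]]|none] := boolP [exists t, [&& t \in U, ext t \notin W & ext t != y]].
  by rewrite in_set => /andP[tW /eqP rt] tnW ty; exists t.
have inU u : (u \in U) = (u \in W) && (rep u == rep w) by rewrite in_set.
have {}none t : t \in U -> ext t \in W \/ ext t = y.
  move=> tU; have [|tW] := boolP (ext t \in W); [by left|right].
  by move/existsPn: none => /(_ t); rewrite tU tW /= negbK => /eqP.
have wU : w \in U by rewrite inU wW eqxx.
have cl u v : u \in U -> v \in W -> e u v -> v \in U.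
  by rewrite !inU => /andP[uW /eqP <-] vW euv; rewrite vW (rep_adj uW vW euv) eqxx.
have QU u : u \in U -> Q u \subset U.
  move=> uU; have uW := subsetP UW u uU; apply/subsetP => v vQ; have [->//|vu] := eqVneq v u.
  by apply: (cl u) => //; [exact: (QW uW)|exact: Qadj].
have UL : U \subset L by apply/subsetP => u /(subsetP UW)/W_L.
have U0 : U != set0 by apply/set0Pn; exists w.
have cU : conn e U.
  move=> C [CU clC] /set0Pn[c cC]; apply/eqP; rewrite eqEsubset CU; apply/subsetP => u uU.
  have cU := subsetP CU c cC.
  have lk : link e U c u.
    apply: (link_closed UW cl cU); rewrite -rep_eq.
    by move: cU uU; rewrite !inU => /andP[_ /eqP ->] /andP[_ /eqP ->].
  move: lk cC => /connectP[s ps ->]; elim: s c {cU} ps => //= v s IH c /andP[/and3P[ecv _ vU] ps] cC.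
  by apply: IH ps _; apply: (clC c).
have [[I [D [[IU iI fI] [_ hD] Pb]]] _] := pbound UL U0 cU.
have D1 : 0 < #|D|.
  have wWU : w \in bigs e k U.
    by have [bQ _ wQ] := QP wW; apply/WP; exists (Q w); split=> //; apply: QU.
  by have [d dD _] := hD w wWU; rewrite card_gt0; apply/set0Pn; exists d.
have I1 : k.-1 * #|I| < #|U|.
  apply: leq_ltn_trans (forestL U0 UL IU iI); rewrite mulnC -sum_nat_const.
  by apply: leq_sum => v /fI ->.
have dU u : u \in U -> k.-1 <= deg e U u + (u \in ends e k U).
  move=> uU; have uW := subsetP UW u uU; have [eu nq hu] := eP uW.
  have [bQ QL uQ] := QP uW; have uWU : u \in bigs e k U by apply/WP; exists (Q u); split=> //; apply: QU.
  have := bigclique_deg e_irr bQ (QU u uU) uQ; rewrite in_ends uWU /=.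
  have : deg e U u <= k.-1 by rewrite -(lowL (subsetP UL u uU)); apply: deg_le; apply: subsetT.
  by case: eqP; move: k_gt5; clear; lia.
have dsum : k.-1 * #|U| <= degsum e U + #|ends e k U|.
  have -> : #|ends e k U| = \sum_(u in U) (u \in ends e k U).
    rewrite -sum1_card big_mkcond [RHS]big_mkcond /=; apply: eq_bigr => u _.
    have [uE|] := boolP (u \in ends e k U); last by case: (u \in U).
    by rewrite (subsetP (W_sub e k U)) //; move: uE; rewrite in_ends => /andP[].
  by rewrite /degsum -big_split mulnC -sum_nat_const; apply: leq_sum.
have endsN : #|ends e k U| <= k.
  rewrite -[X in _ <= X]dy; apply: subset_leq_card; apply/subsetP => u; rewrite in_ends => /andP[uWU /eqP du].
  have uU := subsetP (W_sub e k U) u uWU; have uW := subsetP UW u uU.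
  have [eu nq hu] := eP uW; rewrite inE in_setT /=.
  have [eW|<-] := none u uU; last by rewrite e_sym.
  have eU := cl u _ uU eW eu; exfalso.
  have : deg e [set: T] u <= deg e U u.
    have UN v : e u v -> v \in U by move=> /hu[|->//]; apply: (subsetP (QU u uU)).
    apply: subset_leq_card; apply/subsetP => v; rewrite [v \in _]in_set => /andP[_ euv].
    by apply/setIdP; split=> //; apply: UN.
  by rewrite (lowL (subsetP UL u uU)) du; move: k_gt5; clear; lia.
(* On [2 (k - 1)] or more vertices, [(k - 1) #|I| < #|U|] and at most [k] ends push the potential
   below [h]. *)
have Usmall : #|U| < 2 * k.-1.
  rewrite ltnNge; apply/negP => Ubig.
  have ub : (2 * (K - 1) <= #|U|%:R)%R.
    by move: Ubig; rewrite -(ler_nat rat) natrM -subn1 natrB //; apply: leq_trans k_gt5.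
  have k6 : (6 <= K)%R by rewrite (ler_nat rat 6).
  have kE : (k.-1%:R = K - 1 :> rat)%R by rewrite -subn1 natrB //; apply: leq_trans k_gt5.
  have i1 : ((K - 1) * #|I|%:R <= #|U|%:R - 1 :> rat)%R.
    by move: I1; rewrite -(ler_nat rat) -natr1 natrM kE; lra.
  have ds : ((K - 1) * #|U|%:R <= (degsum e U)%:R + #|ends e k U|%:R :> rat)%R.
    by move: dsum; rewrite -(ler_nat rat) natrD natrM kE.
  have en : (#|ends e k U|%:R <= K)%R by rewrite ler_nat.
  have dd : (1 <= #|D|%:R :> rat)%R by rewrite (ler_nat rat 1).
  move: Pb i1 ds en dd ub; rewrite /Phi.
  move: #|I|%:R%R (degsum e U)%:R%R #|ends e k U|%:R%R #|D|%:R%R #|U|%:R%R => i ds q d n Pb i1 dsl en dd ub.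
  have hd : (0 <= h * (d - 1))%R by apply: mulr_ge0; [exact: ltW|lra].
  have s1 : (h <= (p - 2) * n + (1 + h) * q + 2 * i - h)%R by move: Pb hd dsl; lra.
  have s2 : (0 <= (K - 1) * ((p - 2) * n + (1 + h) * q + 2 * i - h - h))%R.
    by apply: mulr_ge0; lra.
  have s3 : (0 <= (K - 3) * (1 + h) * (n - 2 * (K - 1)))%R.
    by apply: mulr_ge0; [apply: mulr_ge0|]; move: h_gt0; lra.
  have s4 : (0 <= (K - 1) * (1 + h) * (K - q))%R.
    by apply: mulr_ge0; [apply: mulr_ge0|]; move: h_gt0; lra.
  have s5 : (0 <= (K - 1) * (1 + h) * (K - 6))%R.
    by apply: mulr_ge0; [apply: mulr_ge0|]; move: h_gt0; lra.
  have s6 : (0 <= h * (K - 1))%R by apply: mulr_ge0; [exact: ltW|lra].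
  have s7 : (n * ((K - 1) * (1 - p)) = n * (h * (K - 3)))%R by rewrite ph_big.
  by move: s2 s3 s4 s5 s6 s7 i1; lra.
have [bQ _ wQ] := QP wW; have /bigcliqueP[Qk cQ] := bQ.
have UQ : U = Q w.
  apply/eqP; rewrite eqEsubset QU // andbT; apply/subsetP => u uU; apply: contraTT Usmall => uQ.
  have uW := subsetP UW u uU; have [bQ' QL' uQ'] := QP uW; have /bigcliqueP[Qk' _] := bQ'.
  have [_ QL _] := QP wW.
  have dis : [disjoint Q w & Q u].
    rewrite -setI_eq0 -subset0; apply/subsetP => v /setIP[v1 v2].
    have E := bigclique_unique e_sym e_irr forestL no_Kk k_gt5 lowL bQ bQ' QL QL' v1 v2.
    by rewrite E uQ' in uQ.
  rewrite -leqNgt mul2n -addnn -{1}Qk -Qk' -cardsUI disjoint_setI0 // cards0 addn0.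
  by apply: subset_leq_card; rewrite subUset !QU.
exfalso; apply: (no_Kk (X := y |: Q w)); last first.
  have yQ : y \notin Q w by apply: contraNN yL => yQ; apply: W_L; exact: QW wW yQ.
  by rewrite cardsU1 yQ Qk; move: k_gt5; clear; lia.
have yadj u : u \in Q w -> e y u.
  move=> uQ; have uU : u \in U by rewrite UQ.
  have uW := subsetP UW u uU; have [eu nq _] := eP uW.
  have [eW|<-] := none u uU; last by rewrite e_sym.
  have := cl u _ uU eW eu; rewrite UQ => eQ.
  have E := @Qof_eq T e L k e_sym e_irr forestL no_Kk k_gt5 lowL _ _ wW uQ.
  by rewrite E eQ in nq.
move=> a b /setU1P[->|aQ] /setU1P[->|bQ'] ab; last exact: cQ.
- by rewrite eqxx in ab.
- exact: yadj.
- by rewrite e_sym yadj.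
Qed.

Definition units (y : T) : {set T} := rep @: [set w in W | e y w].

(** With one entry chosen in each unit that [y] meets, two further edges from [y] to [W] would be
    exits, and these units would be reducible together with [y]. *)
Lemma deg_W_le_units y : deg e [set: T] y = k -> deg e W y <= #|units y|.+1.
Proof.
move=> dy; have yL := high_notin dy; set N := [set w in W | e y w].
rewrite /deg -/N leqNgt; apply/negP => big.
have NP w : w \in N -> w \in W /\ e y w by rewrite in_set => /andP[].
have enP r : exists w, r \in units y -> w \in N /\ rep w = r.
  have [/imsetP[w wN ->]|_] := boolP (r \in units y); first by exists w.
  by exists r.
have [en {}enP] := fin_all_exists enP.
have tgP r : exists t, r \in units y -> [/\ t \in W, rep t = r, ext t \notin W & ext t != y].
  have [/imsetP[w /NP[wW eyw] ->]|_] := boolP (r \in units y); last by exists r.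
  by have [t ht] := unit_target dy wW eyw; exists t.
have [tg {}tgP] := fin_all_exists tgP.
apply: (@unit_contradiction [set y] (units y) en tg (fun _ => 0)).
- by apply/set0Pn; exists y; rewrite set11.
- by move=> a b /set1P-> /set1P->.
- by move=> a /set1P->.
- move=> r rU; have [/NP[wW eyw] er] := enP r rU; split=> //.
  by rewrite (@ext_high _ y) ?set11 // e_sym.
- by move=> r rU; have [tW tr tX ty] := tgP r rU; split=> // /set1P E; rewrite E eqxx in ty.
move=> _ /set1P->; set M := [set w in W | _].
have : #|N :\: M| <= #|units y|.
  have inj : {in N :\: M &, injective rep}.
    have fixed w : w \in N :\: M -> en (rep w) = w.
      move=> /setDP[wN]; have [wW eyw] := NP w wN.
      have rU : rep w \in units y by apply: imset_f.
      by rewrite in_set wW eyw rU /= negbK => /eqP.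
    by move=> w u /fixed {2}<- /fixed {2}<- ->.
  rewrite -(card_in_imset inj); apply: subset_leq_card; apply/subsetP => r /imsetP[w wN ->].
  by apply: imset_f; case/setDP: wN.
have -> : #|N :\: M| = #|N| - #|M|.
  rewrite cardsD (setIidPr _) //; apply/subsetP => w.
  by rewrite in_set => /and3P[wW eyw _]; rewrite in_set wW eyw.
by move: big; clear; lia.
Qed.

(* A unit with a plain vertex (a neighbour in [L] outside [W]) can be served by
   one entering edge, any other unit by two. *)
Definition plain (r : T) : bool :=
  [exists v, [&& v \in W, rep v == r, ext v \in L & ext v \notin W]].

Definition demand (r : T) : nat := if plain r then 1 else 2.

Variable Hk : {set T}.
Hypothesis degHk : forall y, y \in Hk -> deg e [set: T] y = k.

(** Too many incidences yield a subset and an orientation with two edges directed to each vertex of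
    [Hk] and [demand r] to each unit [r]. An edge directed to a unit serves as its entry, a second
    one as its target, and the edges directed to a vertex of [Hk] are its exits. *)
Lemma card_units_le : \sum_(y in Hk) #|units y| <= 2 * #|Hk| + \sum_(r in rep @: W) demand r.
Proof.
set R0 := rep @: W; pose V := Hk :|: R0.
pose E := [set q : T * T | (q.1 \in Hk) && (q.2 \in units q.1)].
have R0L r : r \in R0 -> r \in L by move=> /imsetP[w wW ->]; apply: W_L; apply: rep_W.
have HkL y : y \in Hk -> y \notin L by move/degHk/high_notin.
have unitsR0 y r : r \in units y -> r \in R0.
  by move=> /imsetP[w wN ->]; apply: imset_f; move: wN; rewrite in_set => /andP[].
have EE : edges_in E V = E.
  apply/setP => q; rewrite !in_set; case: (boolP (q.1 \in Hk)) => //= qH.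
  by case: (boolP (q.2 \in units q.1)) => //= /unitsR0 ->; rewrite orbT.
have -> : \sum_(y in Hk) #|units y| = #|E|.
  rewrite -sum1_card (eq_bigl (fun q : T * T => (q.1 \in Hk) && (q.2 \in units q.1))); last first.
    by move=> q; rewrite in_set.
  rewrite -(pair_big_dep (mem Hk) (fun y r => r \in units y) (fun _ _ => 1)) /=.
  by apply: eq_bigr => y _; rewrite sum1_card.
have [V0|V0] := eqVneq V set0.
  suff -> : E = set0 by rewrite cards0.
  apply/eqP; rewrite -subset0; apply/subsetP => q; rewrite in_set => /andP[qH _].
  by have := in_set0 q.1; rewrite -V0 in_setU qH.
pose n v := if v \in Hk then 2 else demand v.
have nV : \sum_(v in V) n v = 2 * #|Hk| + \sum_(r in R0) demand r.
  have dis : [disjoint Hk & R0].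
    rewrite disjoint_subset; apply/subsetP => y yH; rewrite inE; apply/negP => /R0L.
    by apply/negP; apply: HkL.
  rewrite sum_setU //; congr (_ + _).
    by rewrite mulnC -sum_nat_const; apply: eq_bigr => y yH; rewrite /n yH.
  apply: eq_bigr => r rR; rewrite /n; case: ifP => // rH.
  by have := HkL r rH; rewrite R0L.
rewrite leqNgt; apply/negP => big.
have [|V' [hd [V'0 V'V hhd nV']]] := orientation_of_dense V0 (E := E) (n := n).
  by rewrite EE nV ltnW.
pose Y := V' :&: Hk; pose R := V' :&: R0; pose IN v := [set q in edges_in E V' | hd q == v].
have INP v q : q \in IN v -> [/\ q.1 \in Y, q.2 \in R, q.2 \in units q.1 & hd q = v].
  rewrite !in_set => /andP[/andP[/andP[q1 q2] /andP[q1V q2V]] /eqP hq].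
  by split=> //; rewrite ?q1V ?q2V //=; apply: unitsR0 q2.
have entry q v : q \in IN v -> exists w, [/\ w \in W, rep w = q.2, e q.1 w & ext w = q.1].
  move=> /INP[/setIP[_ qH] _ /imsetP[w]]; rewrite in_set => /andP[wW eqw] -> _.
  by exists w; split=> //; apply: ext_high => //; [apply: HkL|rewrite e_sym].
have YHk y : y \in Y -> y \in Hk by move=> /setIP[].
have YW y : y \in Y -> y \notin W by move=> /YHk/HkL; apply: contraNN; apply: W_L.
have RI r : r \in R -> demand r <= #|IN r|.
  move=> /setIP[rV rR]; apply: leq_trans (nV' r rV); rewrite /n; case: ifP => // rH.
  by have := HkL r rH; rewrite R0L.
have R1 r : r \in R -> 0 < demand r by rewrite /demand; case: plain.
have Y0 : Y != set0.
  case/set0Pn: V'0 => v vV; have := subsetP V'V v vV; rewrite in_setU => /orP[vH|vR].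
    by apply/set0Pn; exists v; rewrite inE vV.
  have vR' : v \in R by rewrite inE vV.
  have /card_gt0P[q /INP[qY _ _ _]] : 0 < #|IN v| by apply: leq_trans (RI v vR'); apply: R1.
  by apply/set0Pn; exists q.1.
(* Any linear order serves: of two edges directed to a unit, the one at the later vertex becomes the
   entry, the other the target. *)
pose idx (y : T) : nat := enum_rank y.
(* The entry edge is recorded as directed to the unit, so that no edge directed to a vertex of [Y]
   ends in an entry. *)
have choice r : exists ab : T * T, r \in R ->
    [/\ [/\ ab.1 \in W, rep ab.1 = r & ext ab.1 \in Y], hd (ext ab.1, r) = r &
     [/\ ab.2 \in W, rep ab.2 = r, ext ab.2 \notin W &
      ext ab.2 \in Y -> idx (ext ab.2) < idx (ext ab.1)]].
  have [rR|_] := boolP (r \in R); last by exists (r, r).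
  have := RI r rR; rewrite /demand; have [/existsP[v /and4P[vW /eqP vr vL vX]] _|_] := boolP (plain r).
    have /card_gt0P[q qI] : 0 < #|IN r| by apply: leq_trans (RI r rR); apply: R1.
    have [w [wW wr eqw wq]] := entry _ _ qI; have [qY _ _ hq] := INP _ _ qI.
    have q2 : q.2 = r.
      case: (hhd q) => h12; rewrite hq in h12; last by rewrite h12.
      by have := HkL _ (YHk _ qY); rewrite -h12 R0L //; case/setIP: rR.
    have hq' : hd (q.1, r) = r by rewrite -{1}q2 -surjective_pairing.
    exists (w, v) => _ /=; rewrite wq wr q2; split=> //; split=> //.
    by move=> /YHk/HkL; rewrite vL.
  move=> /card_gt1P[q [q' [qI qI' qq]]].
  have E2 z : z \in IN r -> z = (z.1, r).
    move=> zI; have [zY _ _ hz] := INP _ _ zI; rewrite {1}[z]surjective_pairing; congr (_, _).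
    case: (hhd z) => h12; rewrite hz in h12; last by rewrite h12.
    by have := HkL _ (YHk _ zY); rewrite -h12 R0L //; case/setIP: rR.
  wlog lt : q q' qI qI' qq / idx q'.1 < idx q.1.
    move=> H; case: (ltngtP (idx q'.1) (idx q.1)) => [lt|lt|].
    - exact: (H q q').
    - by apply: (H q' q) => //; rewrite eq_sym.
    - move/val_inj/enum_rank_inj => E1; case/eqP: qq.
      by rewrite (E2 _ qI) (E2 _ qI') E1.
  have [w [wW wr _ wq]] := entry _ _ qI; have [w' [wW' wr' _ wq']] := entry _ _ qI'.
  have [qY _ _ hq] := INP _ _ qI; have [qY' _ _ hq'] := INP _ _ qI'.
  have e2 : q.2 = r by rewrite (E2 _ qI).
  have e2' : q'.2 = r by rewrite (E2 _ qI').
  have hr : hd (q.1, r) = r by rewrite -E2.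
  exists (w, w') => _ /=; rewrite wq wq' wr wr' e2 e2'; split=> //; split=> //.
  exact: YW.
have [ab abP] := fin_all_exists choice.
apply: (@unit_contradiction Y R (fun r => (ab r).1) (fun r => (ab r).2) idx) => //.
- by move=> y y' _ _ /val_inj/enum_rank_inj.
- by move=> y /YHk/degHk.
- by move=> r /abP[].
- by move=> r /abP[].
move=> y yY; have yV : y \in V' by case/setIP: yY.
have := nV' y yV; rewrite /n (YHk y yY) -/(IN y) => /leq_trans; apply.
have out q : exists w, q \in IN y -> [/\ w \in W, rep w = q.2, e q.1 w & ext w = q.1].
  have [/entry[w hw]|_] := boolP (q \in IN y); first by exists w.
  by exists y.
have [g gP] := fin_all_exists out.
have q1y q : q \in IN y -> q.1 = y.
  move=> qI; have [_ qR _ hq] := INP _ _ qI; case: (hhd q) => h12; rewrite hq in h12 => //.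
  by have := HkL _ (YHk _ yY); rewrite h12 R0L //; case/setIP: qR.
have inj : {in IN y &, injective g}.
  move=> q q' qI qI' E1; have [_ r1 _ _] := gP q qI; have [_ r2 _ _] := gP q' qI'.
  by rewrite [q]surjective_pairing [q']surjective_pairing -r1 -r2 E1 !q1y.
rewrite -(card_in_imset inj); apply: subset_leq_card; apply/subsetP => w /imsetP[q qI ->].
have [wW rw eqw xw] := gP q qI; have [_ qR _ hq] := INP _ _ qI.
rewrite in_set wW rw qR -{1}(q1y q qI) eqw /=; apply/eqP => E1.
have [_ hr _] := abP _ qR; rewrite E1 xw -surjective_pairing hq in hr.
by have := HkL _ (YHk _ yY); rewrite hr R0L //; case/setIP: qR.
Qed.

(** A unit that is not plain contains a vertex linked to [D2], so the total demand is at most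
    [#|D| + #|D2|]. The coefficient three adds the one of [deg_W_le_units] to the two of
    [card_units_le]. *)
Lemma low_potential : exists I (n : nat),
  [/\ full_independent e k L I,
      \sum_(y in Hk) deg e W y <= 3 * #|Hk| + n &
      (0 <= (K - 3 + p) * #|L|%:R - (degsum e L)%:R + 2 * #|I|%:R
            + h * (#|ends e k L|%:R - n%:R))%R].
Proof.
have [D2 [D2W [I [D [fI [DW hD] Pb]]] hD2]] := @potential_total T e L k e_sym e_irr forestL degL
  no_Kk k_gt5 p h ph_big ph_medium h_gt0 h_lt1 p_gt0 p_lt1 ph_cycle L (subxx _).
exists I, (#|D| + #|D2|); split=> //; last by move: Pb; rewrite /Phi natrD; lra.
have : \sum_(y in Hk) deg e W y <= #|Hk| + \sum_(y in Hk) #|units y|.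
  rewrite -sum1_card -big_split; apply: leq_sum => y yH; rewrite /= add1n.
  exact: deg_W_le_units (degHk yH).
have : \sum_(r in rep @: W) demand r <= #|D| + #|D2|; last first.
  by have := card_units_le; clear; lia.
have repW r : r \in rep @: W -> r \in W /\ rep r = r.
  by move=> /imsetP[w wW ->]; rewrite rep_rep rep_W.
apply: (@leq_trans (\sum_(r in rep @: W) (1 + (r \in rep @: D2)))).
  apply: leq_sum => r /repW[rW rr]; rewrite /demand; case: (boolP (plain r)) => [_|pl].
    exact: leq_addr.
  have [[d dD lk]|[v [z [lk zL zW evz]]]] := hD2 r rW.
    by rewrite (_ : r \in _) //; apply/imsetP; exists d => //; apply/eqP; rewrite -{1}rr rep_eq link_sym.
  have vW := link_in rW lk; have [_ _ hv] := eP vW.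
  case/negP: pl; apply/existsP; exists v; rewrite vW -{1}rr eq_sym rep_eq lk /=.
  case: (hv z evz) => [zQ|<-]; last by rewrite zL zW.
  by rewrite (QW vW zQ) in zW.
rewrite big_split sum1_card; apply: leq_add.
  apply: leq_trans (leq_imset_card rep (mem D)); apply: subset_leq_card; apply/subsetP => r /repW[rW rr].
  by have [d dD lk] := hD r rW; apply/imsetP; exists d => //; apply/eqP; rewrite -{1}rr rep_eq link_sym.
apply: leq_trans (leq_imset_card rep (mem D2)); rewrite -sum1_card big_mkcond [X in _ <= X]big_mkcond.
by apply: leq_sum => r _; case: (r \in rep @: W); case: (r \in _).
Qed.

End Units.

(** * The average degree *)

Section Independent.

Variables (T : finType) (e : rel T) (k : nat).
Hypothesis e_sym : symmetric e.
Hypothesis e_irr : irreflexive e.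

Lemma degsum_setD1 (H : {set T}) v : v \in H ->
  degsum e H = degsum e (H :\ v) + 2 * deg e H v.
Proof.
move=> vH; have dis : [disjoint [set v] & H :\ v] by rewrite disjoints1 !inE eqxx.
rewrite -{1}(setD1K vH) degsum_setU // crossing1 deg_setD1 //.
by rewrite /degsum big_set1 /deg (_ : [set _ in _ | _] = set0) ?cards0 ?add0n ?mul2n //;
  apply/setP => u; rewrite !inE; case: eqP => // ->; rewrite e_irr.
Qed.

(** A perfect matching is the tight case, with [2 (2 k - 1) = 2 k + 2 (k - 1)] per edge. Isolated
    vertices are taken, and vertices of degree at least two may be discarded because
    [4 (k - 1) >= 2 k - 1]. *)
Lemma large_independent (H : {set T}) : 1 < k ->
  exists J : {set T}, [/\ J \subset H, independent e J &
    (2 * k).-1 * #|H| <= 2 * k * #|J| + k.-1 * degsum e H].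
Proof.
move=> k1; have [n] := ubnP #|H|; elim: n H => // n IH H; rewrite ltnS => Hn.
have IHv v : v \in H -> exists J : {set T}, [/\ J \subset H :\ v, independent e J &
    (2 * k).-1 * #|H :\ v| <= 2 * k * #|J| + k.-1 * degsum e (H :\ v)].
  by move=> vH; apply: IH; move: Hn; rewrite (cardsD1 v H) vH.
have [->|/set0Pn[v vH]] := eqVneq H set0.
  exists set0; split; [exact: sub0set|exact: independent0|by rewrite cards0 muln0].
have add (x : T) (J : {set T}) : independent e J -> (forall y, y \in J -> ~~ e x y) ->
    independent e (x |: J).
  move=> iJ xJ a b /setU1P[->|aJ] /setU1P[->|bJ]; rewrite ?e_irr //; first exact: xJ.
    by rewrite e_sym xJ.
  exact: iJ.
have notin (x : T) (J A : {set T}) : J \subset A :\ x -> x \notin J.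
  by move=> JA; apply/negP => /(subsetP JA); rewrite !inE eqxx.
have [/existsP[u /andP[uH du]]|dle] := boolP [exists u, (u \in H) && (1 < deg e H u)].
  have [J [JH iJ bJ]] := IHv u uH; exists J; split=> //; first exact: subset_trans JH (subsetDl _ _).
  move: bJ du k1; rewrite (degsum_setD1 uH) (cardsD1 u H) uH mulnDr mulnDr.
  move: (deg e H u) => d; move: (degsum _ _) #|J| #|H :\ u| => s j m bJ du k1.
  have : k.-1 * 4 <= k.-1 * (2 * d) by rewrite leq_mul2l; apply/orP; right; move: du; clear; lia.
  by move: bJ k1; move: ((2 * k).-1 * m) (k.-1 * (2 * d)) (k.-1 * s) (2 * k * j); clear; lia.
have [/existsP[u /andP[uH /eqP du]]|dge] := boolP [exists u, (u \in H) && (deg e H u == 0)].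
  have [J [JH iJ bJ]] := IHv u uH; exists (u |: J); split.
  - by rewrite subUset sub1set uH; apply: subset_trans JH (subsetDl _ _).
  - apply: add => // y /(subsetP JH)/setD1P[_ yH]; apply/negP => euy.
    by have /eqP := du; rewrite cards_eq0 => /eqP/setP/(_ y); rewrite !inE yH euy.
  move: bJ k1; rewrite (degsum_setD1 uH) du muln0 addn0 (cardsD1 u H) uH cardsU1 (notin _ _ _ JH).
  move: (degsum _ _) #|J| #|H :\ u| => s j m; rewrite !mulnDr !muln1.
  by move: ((2 * k).-1 * m) (k.-1 * s) (2 * k * j); clear; lia.
have dv1 u : u \in H -> deg e H u = 1.
  move=> uH; move/existsPn: dle => /(_ u); move/existsPn: dge => /(_ u).
  by rewrite uH /=; clear; lia.
have /cards1P[u uE] : #|[set w in H | e v w]| == 1 by apply/eqP; exact: dv1.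
have uI : u \in [set w in H | e v w] by rewrite uE set11.
have /setIdP[uH evu] := uI.
have uHv : u \in H :\ v by rewrite !inE uH andbT; apply: contraTneq evu => ->; rewrite e_irr.
have [|J [JH iJ bJ]] := IH (H :\ v :\ u).
  move: Hn; rewrite (cardsD1 v H) vH => Hn; apply: leq_trans _ Hn.
  by rewrite ltnS; apply: subset_leq_card; apply: subsetDl.
have JH' := subset_trans JH (subsetDl _ _).
exists (v |: J); split.
- by rewrite subUset sub1set vH; apply: subset_trans JH' (subsetDl _ _).
- apply: add => // y yJ; apply/negP => evy; have /setD1P[yu /setD1P[_ yH]] := subsetP JH y yJ.
  have : y \in [set w in H | e v w] by apply/setIdP.
  by rewrite uE inE (negPf yu).
move: bJ k1; rewrite (degsum_setD1 vH) (dv1 v vH) (degsum_setD1 uHv) (cardsD1 v H) vH.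
rewrite (cardsD1 u (H :\ v)) uHv cardsU1 (notin _ _ _ JH').
move: (degsum _ _) #|J| #|H :\ v :\ u| (deg _ _ _) => s j m d; rewrite !mulnDr !muln1.
by move: ((2 * k).-1 * m) (k.-1 * s) (2 * k * j) (k.-1 * (2 * d)); clear; lia.
Qed.

Lemma sum_deg_le_edge_set : \sum_v deg e [set: T] v <= 2 * #|edge_set e|.
Proof.
have -> : \sum_v deg e [set: T] v = \sum_(v in [set: T]) deg e [set: T] v.
  by apply: eq_bigl => v; rewrite inE.
rewrite sum_deg_card; set P := [set _ | _].
have PE (q : T * T) : q \in P -> [set q.1; q.2] \in edge_set e.
  rewrite !inE /= => eq; apply/existsP; exists q.1; apply/existsP; exists q.2.
  by rewrite eq eqxx.
rewrite -sum1_card (partition_big (fun q : T * T => [set q.1; q.2]) (mem (edge_set e))) //=.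
rewrite mulnC -sum_nat_const; apply: leq_sum => A; rewrite inE => /existsP[x /existsP[y /andP[exy /eqP AE]]].
rewrite sum1_card; apply: (@leq_trans #|[set (x, y); (y, x)]|); last first.
  by rewrite cards2; case: (_ != _).
apply: subset_leq_card; apply/subsetP => -[a b]; rewrite inE /= => /andP[].
rewrite !inE /= => eab /eqP E.
have : a \in A by rewrite -E !inE eqxx.
have : b \in A by rewrite -E !inE eqxx orbT.
rewrite AE !inE => /orP[]/eqP b1 /orP[]/eqP a1; rewrite a1 b1 ?eqxx ?orbT //.
  by rewrite a1 b1 e_irr in eab.
by rewrite a1 b1 e_irr in eab.
Qed.

End Independent.

(** * The weights and the final estimate *)

Section Arithmetic.

Variable K : rat.
Hypothesis K_ge6 : (6 <= K)%R.

(* [h] and [p] solve the two equations that make the potential of a [K_(k-1)]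
   and of a [K_(k-2)] end block tight. *)
Lemma weights_exist : exists p h mu : rat,
  [/\ (K - 1) * (1 - p) = h * (K - 3), (K - 2) * p = 2 + h, 0 < h, h < 1 & 0 < p]%R /\
  [/\ p < 1, 0 <= 2 * (K - 6) + 2 * p - h, 0 < mu, mu * (K - 1) = 2 &
    (K - 3) ^+ 2 * (2 * K - 3) / (K ^+ 4 - 2 * K ^+ 3 - 11 * K ^+ 2 + 28 * K - 14)
      * (K + 3 * h - mu * (K - 5 / 2) + (2 - p - mu)) = 2 - p - mu]%R.
Proof.
have K6 := K_ge6; have t0 : (0 <= K - 6)%R by lra.
(* Powers of [K - 6] certify the polynomial inequalities below. *)
have tt := mulr_ge0 t0 t0; have ttt := mulr_ge0 tt t0; have tttt := mulr_ge0 tt tt.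
have b0 : (0 < K ^+ 2 - 4 * K + 5)%R by lra.
have bn : (K ^+ 2 - 4 * K + 5 != 0)%R by rewrite gt_eqF.
have c0 : (K - 1 != 0)%R by apply/eqP; lra.
exists ((3 * K - 7) / (K ^+ 2 - 4 * K + 5))%R, ((K - 1) * (K - 4) / (K ^+ 2 - 4 * K + 5))%R.
(* [mu] is the multiplier of [independent_count] that cancels the term [2 * #|I|] of the
   potential. *)
exists (2 / (K - 1))%R; split; split.
- by field.
- by field.
- by apply: divr_gt0 => //; apply: mulr_gt0; lra.
- by rewrite ltr_pdivrMr // mul1r; lra.
- by apply: divr_gt0 => //; lra.
- by rewrite ltr_pdivrMr // mul1r; lra.
- rewrite (_ : _ - _ = (2 * (K - 6) * (K ^+ 2 - 4 * K + 5) + 2 * (3 * K - 7) - (K - 1) * (K - 4))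
    / (K ^+ 2 - 4 * K + 5))%R; last by field.
  by apply: divr_ge0; [lra|exact: ltW].
- by apply: divr_gt0 => //; lra.
- by field.
field; rewrite c0 bn /=.
by apply/eqP; lra.
Qed.

(** In the extremal case all high vertices have degree [k], so [hp = sp = 0]. Then [(2 - p - mu) l]
    is at most [(K + 3 h - mu (K - 5 / 2)) hk], while the degree sum exceeds [K - 1] per vertex by
    [hk] in total; the equation for [delta] is the resulting ratio. *)
Lemma degree_arithmetic (delta mu p h l m i j q sp hk hp sH n eL dL : rat) :
  (mu * (K - 1) = 2)%R -> (0 < mu)%R -> (0 < h)%R -> (h < 1)%R -> (p < 1)%R -> (0 <= hp)%R ->
  (delta * (K + 3 * h - mu * (K - 5 / 2) + (2 - p - mu)) = 2 - p - mu)%R ->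
  (0 <= (K - 3 + p) * l - dL + 2 * i + h * (eL - n))%R ->
  (q <= 3 * hk + n)%R -> (eL <= q + sp)%R ->
  ((K - 1) * i + K * j + K * (hk + hp) + 1 <= l + (K * hk + sp) + 2 * (hk + hp))%R ->
  ((2 * K - 1) * (hk + hp) <= 2 * K * j + (K - 1) * sH)%R ->
  (K * hk + sp + dL = (K - 1) * l + sH)%R ->
  ((K + 1) * hp <= sp)%R ->
  ((K - 1) * l + K * hk + sp <= 2 * m)%R ->
  ((K - 1 + delta) * (l + hk + hp) <= 2 * m)%R.
Proof.
have K6 := K_ge6; move=> muK mu0 h0 h1 p1 hp0 deltaE a1 a2 a3 a4 a5 a6 a7 a8.
(* The multiplier [mu] eliminates [i], and half of it on the bound for [j] eliminates both [j] and
   [sH]. *)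
have M : ((2 - p - mu) * l <= (1 + mu) * (K * hk + sp) - mu * (2 * K - 5 / 2) * (hk + hp)
     + 3 * h * hk + h * sp)%R.
  have m1 : (0 <= mu * (l + (K * hk + sp) + 2 * (hk + hp) - (K - 1) * i - K * j - K * (hk + hp) - 1))%R.
    by apply: mulr_ge0; [exact: ltW|lra].
  have m2 : (0 <= mu * (2 * K * j + (K - 1) * sH - (2 * K - 1) * (hk + hp)))%R.
    by apply: mulr_ge0; [exact: ltW|lra].
  have m3 : (0 <= h * (q + sp - eL))%R by apply: mulr_ge0; [exact: ltW|lra].
  have m4 : (0 <= h * (3 * hk + n - q))%R by apply: mulr_ge0; [exact: ltW|lra].
  have e1 : (mu * (K - 1) * i = 2 * i)%R by rewrite muK.
  have e2 : (mu * (K - 1) * sH = 2 * sH)%R by rewrite muK.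
  by move: m1 m2 m3 m4 e1 e2 a1 a6 mu0; lra.
have mu1 : (0 <= mu * (K - 6))%R by apply: mulr_ge0; [exact: ltW|lra].
have hK : (0 <= (K - 5) * (1 - h))%R by apply: mulr_ge0; lra.
(* Vertices of degree above [k] only help: [slope] and [base] are the coefficients of
   [sp - (K + 1) hp] and of [hp] in the slack. *)
have slope : (0 <= K + 3 * h - mu * (K - 5 / 2) + (2 - p - mu) - 1 - mu - h)%R.
  by move: K6 muK mu1 mu0 h0 p1 {a1 a2 a3 a4 a5 a6 a7 a8 M hK deltaE}; lra.
have base : (0 <= K + 1 - p + (5 - K) * h - mu * (K - 1 / 2))%R.
  by move: K6 muK mu1 mu0 hK p1 {a1 a2 a3 a4 a5 a6 a7 a8 M slope deltaE}; lra.
have s0 : (0 <= sp - (K + 1) * hp)%R by rewrite subr_ge0.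
have s1 := mulr_ge0 slope s0.
have s2 := mulr_ge0 base hp0.
set Gamma := (K + 3 * h - mu * (K - 5 / 2) + (2 - p - mu))%R in deltaE slope s1.
have Gamma0 : (0 < Gamma)%R.
  by move: slope mu0 h0 {a1 a2 a3 a4 a5 a6 a7 a8 M s1 s2 base deltaE}; lra.
have F : (Gamma * (delta * (l + hk + hp)) <= Gamma * (hk + sp - (K - 1) * hp))%R.
  rewrite mulrA [(Gamma * delta)%R]mulrC deltaE.
  by move: M s2 s1 {a1 a2 a3 a4 a5 a6 a7 a8 base slope deltaE}; rewrite /Gamma; lra.
rewrite ler_pM2l // in F.
by move: F a8 {a1 a2 a3 a4 a5 a6 a7 M s1 s2 base slope deltaE}; lra.
Qed.

End Arithmetic.

Section AverageDegree.

Variables (T : finType) (e : rel T) (k : nat).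
Hypothesis e_sym : symmetric e.
Hypothesis e_irr : irreflexive e.
Hypothesis e_crit : online_list_critical e k.
Hypothesis e_ncomplete : ~ complete_graph e.
Hypothesis k_gt5 : 5 < k.

Local Notation dg v := (deg e [set: T] v).
Local Notation K := (k%:R : rat)%R.

Let L := [set v | (dg v).+1 == k].
Let H := ~: L.
Let Hk := [set v in H | dg v == k].
Let Hp := [set v in H | dg v != k].

Let k_gt0 : 0 < k. Proof. exact: leq_trans k_gt5. Qed.

Lemma card_gt0_critical : 0 < #|T|.
Proof.
rewrite lt0n; apply/eqP => T0; apply: e_crit.1.
have -> : [set: T] = set0 by apply/eqP; rewrite -cards_eq0 cardsT T0.
exact: online_choosable_empty.
Qed.

Let lowL v : v \in L -> dg v = k.-1.
Proof. by rewrite inE => /eqP <-. Qed.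

Let dH v : v \in H -> k <= dg v.
Proof.
rewrite !inE => dv; have := min_degree e_sym e_irr e_crit v.
by rewrite leq_eqVlt eq_sym (negPf dv).
Qed.

Let dHk v : v \in Hk -> dg v = k.
Proof. by rewrite inE => /andP[_ /eqP]. Qed.

Let dHp v : v \in Hp -> k < dg v.
Proof. by rewrite inE => /andP[vH dv]; rewrite ltn_neqAle eq_sym dv dH. Qed.

Let forestL (A X : {set T}) : X != set0 -> X \subset L -> A \subset X ->
  independent e A -> \sum_(a in A) deg e X a < #|X|.
Proof.
move=> X0 XL AX iA; rewrite -sum1_card.
apply: leq_trans (independent_edge_bound e_sym e_irr e_crit X0 AX iA) _.
apply: leq_sum => v /(subsetP XL)/lowL ->; move: k_gt5; clear; lia.
Qed.

Let no_Kk X := @no_big_clique T e k e_sym e_crit e_ncomplete k_gt0 X.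
Let irreducible := @critical_irreducible T e k e_sym e_crit.

Let Hsplit (F : T -> nat) : \sum_(v in H) F v = \sum_(v in Hk) F v + \sum_(v in Hp) F v.
Proof.
rewrite (bigID (fun v => dg v == k)) /=; congr (_ + _); apply: eq_bigl => v; by rewrite !inE.
Qed.

Let LH : [disjoint L & H]. Proof. by rewrite disjoints_subset setCK. Qed.

Let LUH : [set: T] = L :|: H. Proof. by rewrite setUCr. Qed.

Let dsplit v : dg v = deg e L v + deg e H v.
Proof. by rewrite LUH deg_setU. Qed.

(** An end has degree [k - 2] in [L], hence a neighbour in [H]. These edges are counted from [H],
    and at [Hp] all edges are conceded. *)
Lemma ends_le : #|ends e k L| <= \sum_(v in Hk) deg e (bigs e k L) v + \sum_(v in Hp) dg v.
Proof.
have WL := W_sub e k L.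
apply: (@leq_trans (crossing e (bigs e k L) H)).
  rewrite -sum1_card; apply: (@leq_trans (\sum_(w in ends e k L) deg e H w)).
    apply: leq_sum => w; rewrite in_ends => /andP[wW /eqP dw].
    by have := lowL (subsetP WL w wW); rewrite dsplit dw; move: k_gt5; clear; lia.
  rewrite /crossing [X in _ <= X](bigID (mem (ends e k L))) /=; apply: leq_trans (leq_addr _ _).
  by rewrite leq_eqVlt; apply/orP; left; apply/eqP; apply: eq_bigl => w; rewrite in_ends; case: (w \in bigs e k L).
rewrite crossingC // /crossing Hsplit leq_add2l; apply: leq_sum => v _; apply: deg_le; exact: subsetT.
Qed.

Lemma low_degree_sum : \sum_(v in H) dg v + degsum e L = k.-1 * #|L| + degsum e H.
Proof.
have -> : \sum_(v in H) dg v = crossing e H L + degsum e H.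
  by rewrite -big_split; apply: eq_bigr => v _; exact: dsplit.
have -> : k.-1 * #|L| = degsum e L + crossing e L H.
  rewrite mulnC -sum_nat_const -big_split; apply: eq_bigr => v vL.
  by rewrite /= -dsplit (lowL vL).
by rewrite (crossingC e_sym H L) addnAC [_ + degsum e L]addnC.
Qed.

(** The vertices of [I] have full degree inside [L] and so no neighbour in [H]. Hence [I :|: J] is
    independent, and [independent_edge_bound] applies to the whole graph. *)
Lemma independent_count (I J : {set T}) : full_independent e k L I -> J \subset H -> independent e J ->
  k.-1 * #|I| + k * #|J| + k * #|H| < #|L| + \sum_(v in H) dg v + 2 * #|H|.
Proof.
move=> [IL iI fI] JH iJ.
have IH u v : u \in I -> v \in H -> ~~ e u v.
  move=> uI vH; apply/negP => euv; have uL := subsetP IL u uI.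
  have := lowL uL; rewrite dsplit (fI u uI) => E.
  suff : 0 < deg e H u by move: E; clear; lia.
  by apply/card_gt0P; exists v; apply/setIdP.
have disIJ : [disjoint I & J] by apply: disjointWl IL _; apply: disjointWr JH LH.
have iIJ : independent e (I :|: J).
  move=> a b /setUP[aI|aJ] /setUP[bI|bJ]; [exact: iI| | |exact: iJ].
    by apply: IH => //; apply: (subsetP JH).
  by rewrite e_sym; apply: IH => //; apply: (subsetP JH).
have T0 : [set: T] != set0 by rewrite -cards_eq0 cardsT -lt0n card_gt0_critical.
have := independent_edge_bound e_sym e_irr e_crit T0 (subsetT _) iIJ.
rewrite sum_setU //.
have -> : \sum_(v in [set: T]) ((dg v).+2 - k) = #|L| + \sum_(v in H) ((dg v).+2 - k).
  rewrite {1}LUH sum_setU //; congr (_ + _).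
  by rewrite -sum1_card; apply: eq_bigr => v /lowL ->; move: k_gt5; clear; lia.
have : \sum_(v in H) dg v + 2 * #|H| = \sum_(v in H) ((dg v).+2 - k) + k * #|H|.
  rewrite mulnC [k * _]mulnC -!sum_nat_const -!big_split; apply: eq_bigr => v /dH /=.
  by clear; lia.
have : k.-1 * #|I| <= \sum_(a in I) dg a.
  by rewrite mulnC -sum_nat_const; apply: leq_sum => v /(subsetP IL)/lowL ->.
have : k * #|J| <= \sum_(a in J) dg a.
  by rewrite mulnC -sum_nat_const; apply: leq_sum => v /(subsetP JH)/dH.
move: (k.-1 * _) (k * #|J|) (k * #|H|) (\sum_(v in H) _) (\sum_(v in H) dg v) (\sum_(v in I) _) (\sum_(v in J) _).
by clear; lia.
Qed.

Theorem average_degree_bound :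
  (K - 1 + (K - 3) ^+ 2 * (2 * K - 3) / (K ^+ 4 - 2 * K ^+ 3 - 11 * K ^+ 2 + 28 * K - 14)
     <= average_degree e)%R.
Proof.
have k6 : (6 <= K)%R by rewrite (ler_nat rat 6).
set delta := (_ / _)%R.
have kE : (k.-1%:R = K - 1 :> rat)%R by rewrite -subn1 natrB.
have [p [h [mu [[ph_big ph_medium h_gt0 h_lt1 p_gt0] [p_lt1 ph_cycle mu_gt0 muK deltaE]]]]] :=
  weights_exist k6.
have [I [n [fI qk Pb]]] := low_potential e_sym e_irr forestL no_Kk k_gt5 lowL irreducible
  ph_big ph_medium h_gt0 h_lt1 p_gt0 p_lt1 ph_cycle dHk.
have [J [JH iJ bJ]] := large_independent e_sym e_irr H (ltn_trans (isT : 1 < 5) k_gt5).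
have ic := independent_count fI JH iJ.
have ls := low_degree_sum; have el := ends_le.
have hH : #|H| = #|Hk| + #|Hp| by rewrite -!sum1_card Hsplit.
have sHk : \sum_(v in Hk) dg v = k * #|Hk|.
  by rewrite mulnC -sum_nat_const; apply: eq_bigr.
have sHp : k.+1 * #|Hp| <= \sum_(v in Hp) dg v.
  by rewrite mulnC -sum_nat_const; apply: leq_sum => v; apply: dHp.
have sT : \sum_v dg v = k.-1 * #|L| + k * #|Hk| + \sum_(v in Hp) dg v.
  transitivity (\sum_(v in L :|: H) dg v); first by apply: eq_bigl => v; rewrite -LUH inE.
  rewrite sum_setU // Hsplit sHk addnA; congr (_ + _ + _).
  by rewrite mulnC -sum_nat_const; apply: eq_bigr.
have cT : #|T| = #|L| + #|Hk| + #|Hp|.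
  by rewrite -cardsT LUH cardsU (disjoint_setI0 LH) cards0 subn0 hH addnA.
have edges := sum_deg_le_edge_set e_irr; rewrite sT in edges.
have T0 : (0 < #|T|%:R :> rat)%R by rewrite ltr0n card_gt0_critical.
rewrite /average_degree ler_pdivlMr //.
rewrite Hsplit sHk in ic ls.
move: edges Pb qk el ic bJ ls sHp; rewrite hH cT.
move: (\sum_(v in Hp) dg v) (\sum_(y in Hk) deg e _ y) #|Hk| #|Hp| #|L| #|edge_set e| #|I| #|J|
  (degsum e L) (degsum e H) #|ends e k L| => sp q hk hp l m i j dL sH eL.
have k2E : ((2 * k).-1%:R = 2 * K - 1 :> rat)%R.
  by rewrite -subn1 natrB ?natrM //; move: k_gt0; clear; lia.
move=> edges Pb qk el ic bJ /(congr1 (fun x => x%:R : rat)%R); move: edges qk el ic bJ.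
rewrite -!(ler_nat rat) !(natrD, natrM) -!natr1 !natrD !natrM kE k2E => edges qk el ic bJ ls sHp.
have hp0 : (0 <= hp%:R :> rat)%R by rewrite ler0n.
rewrite natrD in ic.
exact: (degree_arithmetic k6 muK mu_gt0 h_gt0 h_lt1 p_lt1 hp0 deltaE Pb qk el ic bJ ls sHp edges).
Qed.

End AverageDegree.

Local Open Scope ring_scope.

(* Stated over an arbitrary field because computing in [rat] does not terminate in
   reasonable time. *)
Lemma bound_six (R : realFieldType) : 5 + 93 / 766 <= 6 - 1 + (6 - 3) ^+ 2 * (2 * 6 - 3)
  / (6 ^+ 4 - 2 * 6 ^+ 3 - 11 * 6 ^+ 2 + 28 * 6 - 14) :> R.
Proof.
rewrite (_ : (6 - 3) ^+ 2 * (2 * 6 - 3) = 81); last by ring.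
rewrite (_ : 6 ^+ 4 - 2 * 6 ^+ 3 - 11 * 6 ^+ 2 + 28 * 6 - 14 = 622); last by ring.
lra.
Qed.

Theorem mainTheorem2 (T : finType) (e : rel T) (k : nat)
    (e_sym : symmetric e) (e_irr : irreflexive e)
    (e_crit : online_list_critical e k)
    (e_ncomplete : ~ complete_graph e) :
  ((7 <= k)%N ->
     let K : rat := k%:R in
     K - 1 + (K - 3) ^+ 2 * (2 * K - 3)
             / (K ^+ 4 - 2 * K ^+ 3 - 11 * K ^+ 2 + 28 * K - 14)
       <= average_degree e) /\
  (k = 6%N -> 5 + 93 / 766 <= average_degree e).
Proof.
split=> [k7|k6]; first by apply: average_degree_bound => //; apply: leq_trans k7.
have := average_degree_bound e_sym e_irr e_crit e_ncomplete.
by rewrite k6 => /(_ isT); apply: le_trans (bound_six rat).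
Qed.
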